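(* Let $V$ be an $n$-dimensional left vector space over a division ring $R$, $n\ge 3$, and let $1\le k\le n-1$ with $n\ne 2k$. Let $f:\mathfrak{G}_k\to\mathfrak{G}_k$ be a bijection preserving the class of base subsets. Then $f$ is induced by a semilinear isomorphism of $V$ to itself or to the dual space $V^*$; that is, either there is a semilinear automorphism $l:V\to V$ such that $f(S,U)=(l(S),l(U))$ for all $(S,U)\in\mathfrak{G}_k$, or there is a semilinear isomorphism $s:V\to V^*$ such that $f(S,U)=(s(U)^0,s(S)^0)$ for all $(S,U)\in\mathfrak{G}_k$.
   Context: $\mathcal{G}_i$ denotes the set of $i$-dimensional subspaces of $V$, and $\mathfrak{G}_k$ the set of all pairs $(S,U)\in\mathcal{G}_k\times\mathcal{G}_{n-k}$ with $S+U=V$. If $B$ is a base (basis) of $V$, the base subset of $\mathfrak{G}_k$ associated with $B$ is the set of all $(S,U)\in\mathfrak{G}_k$ such that both $S$ and $U$ are spanned by vectors belonging to $B$. A bijection $f:\mathfrak{G}_k\to\mathfrak{G}_k$ preserves the class of base subsets if both $f$ and $f^{-1}$ send base subsets to base subsets. $V^*$ is the dual space of $V$ (a right vector space over $R$, regarded as a left vector space over the opposite division ring). A semilinear isomorphism is an additive bijection that is semilinear with respect to an isomorphism of the underlying division rings ($R\to R$ for maps $V\to V$, $R\to R^{\mathrm{op}}$ for maps $V\to V^*$). For a subspace $W\subset V^*$, $W^0=\{x\in V:\varphi(x)=0\ \text{for all}\ \varphi\in W\}$ is its annihilator in $V$. *)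

(* Defs.v *)
From HB Require Import structures.
From mathcomp Require Import all_boot all_order all_algebra.
From mathcomp Require Import boolp classical_sets functions.

Set Implicit Arguments.
Unset Strict Implicit.
Unset Printing Implicit Defensive.

Import GRing.Theory.

Local Open Scope classical_set_scope.
Local Open Scope ring_scope.

(* MathComp has no structure of division rings. Despite its name,
   GRing.field_axiom does not involve commutativity: it says that every
   nonzero element of a unitRingType is a (two-sided) unit. *)
Definition division_ring (R : unitRingType) : Prop := GRing.field_axiom R.

(* The library's {vspace V} and \dim are restricted to commutative fields, so
   subspaces are handled here as classical sets of vectors. *)
Section Subspaces.
Variables (R : nzRingType) (V : lmodType R).

Definition is_subspace (W : set V) : Prop := submod_closed [in W].

Definition span_set (X : set V) : set V := smallest is_subspace X.

Definition lin_indep (d : nat) (b : 'I_d -> V) : Prop :=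
  forall a : 'I_d -> R, \sum_i a i *: b i = 0 -> forall i, a i = 0.

Definition is_basis (d : nat) (W : set V) (b : 'I_d -> V) : Prop :=
  lin_indep b /\ span_set (range b) = W.

Definition has_dim (d : nat) (W : set V) : Prop :=
  exists b : 'I_d -> V, is_basis W b.

Definition grassmannian (i : nat) : set (set V) :=
  [set W | is_subspace W /\ has_dim i W].

Definition sum_subspaces (S U : set V) : set V :=
  [set x + y | x in S & y in U].

(* n is meant to be the dimension of V. *)
Definition compl_pairs (n k : nat) : set (set V * set V) :=
  [set p | [/\ grassmannian k p.1, grassmannian (n - k) p.2
             & sum_subspaces p.1 p.2 = setT]].

Definition spanned_by_part_of (B W : set V) : Prop :=
  exists2 X : set V, X `<=` B & W = span_set X.

Definition base_subset_of (n k : nat) (B : set V) : set (set V * set V) :=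
  [set p | [/\ compl_pairs n k p, spanned_by_part_of B p.1
             & spanned_by_part_of B p.2]].

Definition base_subset (n k : nat) (X : set (set V * set V)) : Prop :=
  exists2 b : 'I_n -> V, is_basis setT b & X = base_subset_of n k (range b).

(* The maps considered are total on pairs of sets, but only their restriction
   to compl_pairs n k matters; the preimage under that restriction is the image
   under its inverse when f is bijective on compl_pairs n k. *)
Definition preserves_base_subsets (n k : nat)
    (f : set V * set V -> set V * set V) : Prop :=
  (forall X, base_subset n k X -> base_subset n k (f @` X)) /\
  (forall X, base_subset n k X ->
     base_subset n k (compl_pairs n k `&` f @^-1` X)).

End Subspaces.

(* The dual of a left R-module: its elements are the linear forms, and it is a
   right R-module via (phi a)(x) = phi(x) a, that is, a left module over the
   opposite ring R^c. *)
Definition dual (R : nzRingType) (V : lmodType R) : Type := {scalar V}.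

Section Dual.
Variables (R : nzRingType) (V : lmodType R).
Implicit Types phi psi : {scalar V}.

Lemma scalar_ext phi psi : phi =1 psi -> phi = psi.
Proof.
case: phi psi => [f [[f1] [f2]]] [g [[g1] [g2]]] /= /funext fg.
subst g; congr (GRing.Linear.Pack (GRing.Linear.Class _ _)).
  by congr (GRing.isNmodMorphism.Axioms_ _); exact: Prop_irrelevance.
by congr (GRing.isScalable.Axioms_ _); exact: Prop_irrelevance.
Qed.

Fact dual_zero_linear : scalar (fun _ : V => 0 : R).
Proof. by move=> a x y; rewrite mulr0 addr0. Qed.

Fact dual_opp_linear phi : scalar (fun x => - phi x).
Proof. by move=> a x y; rewrite linearP opprD mulrN. Qed.

Fact dual_add_linear phi psi : scalar (fun x => phi x + psi x).
Proof. by move=> a x y; rewrite !linearP mulrDr addrACA. Qed.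

Fact dual_scale_linear (a : R) phi : scalar (fun x => phi x * a).
Proof. by move=> b x y; rewrite linearP mulrDl mulrA. Qed.

Definition mk_scalar (g : V -> R) (g_lin : scalar g) : {scalar V} :=
  HB.pack_for {scalar V} g (GRing.isLinear.Build R V R *%R g g_lin).

Definition dual_zero : dual V := mk_scalar dual_zero_linear.
Definition dual_opp (phi : dual V) : dual V := mk_scalar (dual_opp_linear phi).
Definition dual_add (phi psi : dual V) : dual V :=
  mk_scalar (dual_add_linear phi psi).
Definition dual_scale (a : R^c) (phi : dual V) : dual V :=
  mk_scalar (dual_scale_linear a phi).

Fact dual_addA : associative dual_add.
Proof. by move=> p q r; apply: scalar_ext => x /=; rewrite addrA. Qed.

Fact dual_addC : commutative dual_add.
Proof. by move=> p q; apply: scalar_ext => x /=; rewrite addrC. Qed.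

Fact dual_add0 : left_id dual_zero dual_add.
Proof. by move=> p; apply: scalar_ext => x /=; rewrite add0r. Qed.

Fact dual_addN : left_inverse dual_zero dual_opp dual_add.
Proof. by move=> p; apply: scalar_ext => x /=; rewrite addNr. Qed.

HB.instance Definition _ := gen_eqMixin (dual V).
HB.instance Definition _ := gen_choiceMixin (dual V).
HB.instance Definition _ :=
  GRing.isZmodule.Build (dual V) dual_addA dual_addC dual_add0 dual_addN.

Fact dual_scaleA (a b : R^c) (phi : dual V) :
  dual_scale a (dual_scale b phi) = dual_scale (a * b) phi.
Proof. by apply: scalar_ext => x /=; rewrite -mulrA. Qed.

Fact dual_scale1 : left_id 1 dual_scale.
Proof. by move=> p; apply: scalar_ext => x /=; rewrite mulr1. Qed.

Fact dual_scaleDr : right_distributive dual_scale +%R.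
Proof. by move=> a p q; apply: scalar_ext => x /=; rewrite mulrDl. Qed.

Fact dual_scaleDl (phi : dual V) :
  {morph dual_scale^~ phi : a b / a + b}.
Proof. by move=> a b; apply: scalar_ext => x /=; rewrite mulrDr. Qed.

HB.instance Definition _ :=
  GRing.Zmodule_isLmodule.Build R^c (dual V)
    dual_scaleA dual_scale1 dual_scaleDr dual_scaleDl.

Definition annihilator (W : set (dual V)) : set V :=
  [set x | forall phi : {scalar V}, W phi -> phi x = 0].

End Dual.

(* Main.v *)
(** A pair (S, U) is handled through the projection onto S along U. Two pairs lie
in a common base subset exactly when their projections commute, so f preserves
commutation in both directions.

Call (S, U) and (S', U') adjacent when one is obtained from the other by a
transvection fixing S or fixing U. Adjacency is expressible by base subsets and
commutation alone: two such pairs lie in frames that differ in a single plane,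
and the pairs commuting with everything that commutes with both of them form a
pencil; conversely the idempotents e + e b (1 - e) and e + (1 - e) b e built from
two projections e, b lie in that double commutant and are adjacent to e. Hence f
preserves adjacency. Triangles of adjacent pairs show that f either keeps, for
all pairs, or exchanges, for all pairs, the two kinds of adjacency (S fixed, U
fixed); in the second case one composes with the annihilator map to the dual.

In the first case f (S, U) = (g S, h U) where g and h preserve complementarity.
Complementarity determines the pencils of k-subspaces, and, after reducing to
2k < n, a count of the members of a star inside a frame shows that g maps stars
to stars. One then descends from k-subspaces to points, where the fundamental
theorem of projective geometry applies. *)

Require Import Defs.
From HB Require Import structures.
From mathcomp Require Import all_boot all_order all_algebra.
From mathcomp Require Import zify.
From mathcomp Require Import boolp classical_sets functions.

Set Implicit Arguments.
Unset Strict Implicit.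
Unset Printing Implicit Defensive.

Import GRing.Theory.

Local Open Scope classical_set_scope.
Local Open Scope ring_scope.

(** * Linear algebra over a division ring *)

(** Why n = 2k is excluded: (S, U) and (U, S) would then lie in the same base subsets, and
    exchanging a single such couple while fixing all other pairs would preserve every base subset.
    The hypothesis acts in three places: a k-set of frame indices must separate one couple of
    indices without separating another; the complementary shears must drop out of the double
    commutant; and the count of a star in a frame needs 2k < n strictly.

    The bound n >= 3 gives a frame vector outside the plane of a transvection, and later a second
    direction in the hyperplane at infinity.

    Scalars do not commute, so a rank-one map v |-> phi(v) t cannot be rescaled freely. The remedy
    is that the only idempotents of R are 0 and 1, which are central.

    Base subsets see S and U only jointly. Adjacency is the way to isolate a component, since an
    adjacent pair differs in exactly one of them; connectedness of the adjacency graph then makes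
    the choice between V and its dual a global one. *)

Section LinearAlgebra.
Variables (R : unitRingType) (hR : division_ring R) (V : lmodType R).
Implicit Types (A B C S T U W : set V) (s t : seq V).

Lemma subspaceP W :
  is_subspace W <-> W 0 /\ forall a u v, W u -> W v -> W (a *: u + v).
Proof.
split=> [[/set_mem W0 Wl]|[W0 Wl]].
  by split=> // a u v /mem_set Wu /mem_set Wv; exact/set_mem/Wl.
split; first exact: mem_set.
by move=> a u v /set_mem Wu /set_mem Wv; exact/mem_set/Wl.
Qed.

Lemma subspace0 W : is_subspace W -> W 0.
Proof. by case/subspaceP. Qed.

Lemma subspaceD W u v : is_subspace W -> W u -> W v -> W (u + v).
Proof. by case/subspaceP=> _ Wl Wu Wv; rewrite -[u]scale1r; exact: Wl. Qed.

Lemma subspaceZ W a u : is_subspace W -> W u -> W (a *: u).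
Proof. by case/subspaceP=> W0 Wl Wu; rewrite -[_ *: _]addr0; exact: Wl. Qed.

Lemma subspaceN W u : is_subspace W -> W u -> W (- u).
Proof. by move=> sW Wu; rewrite -scaleN1r; exact: subspaceZ. Qed.

Lemma subspaceB W u v : is_subspace W -> W u -> W v -> W (u - v).
Proof. by move=> sW Wu Wv; apply: subspaceD => //; exact: subspaceN. Qed.

Lemma subspace_sum W (I : Type) (r : seq I) (P : pred I) (F : I -> V) :
  is_subspace W -> (forall i, P i -> W (F i)) -> W (\sum_(i <- r | P i) F i).
Proof.
move=> sW WF; elim/big_ind: _ => //; first exact: subspace0.
by move=> x y; exact: subspaceD.
Qed.

Lemma subspaceT : is_subspace [set: V].
Proof. exact/subspaceP. Qed.

Lemma subspace_set0 : is_subspace [set (0 : V)].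
Proof. by apply/subspaceP; split=> // a u v -> ->; rewrite scaler0 addr0. Qed.

Lemma subspaceI A B : is_subspace A -> is_subspace B -> is_subspace (A `&` B).
Proof.
move=> sA sB; apply/subspaceP; split; first by split; exact: subspace0.
move=> a u v [Au Bu] [Av Bv]; split; apply: subspaceD => //; exact: subspaceZ.
Qed.

Lemma scaleI W a x : is_subspace W -> a != 0 -> W (a *: x) -> W x.
Proof.
move=> sW a0 /(subspaceZ a^-1 sW).
by rewrite scalerA mulVr ?scale1r //; exact: hR.
Qed.

Local Notation "A :+: B" := (sum_subspaces A B) (at level 52, left associativity).

Lemma sumsP A B v : (A :+: B) v <-> exists x y, [/\ A x, B y & v = x + y].
Proof.
split=> [[x Ax [y By <-]]|[x [y [Ax By ->]]]]; first by exists x, y.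
by exists x => //; exists y.
Qed.

Lemma sums_intro A B x y : A x -> B y -> (A :+: B) (x + y).
Proof. by move=> Ax By; exists x => //; exists y. Qed.

Lemma subspace_sums A B :
  is_subspace A -> is_subspace B -> is_subspace (A :+: B).
Proof.
move=> sA sB; apply/subspaceP; split.
  by rewrite -[0]addr0; apply: sums_intro; exact: subspace0.
move=> a _ _ [x Ax [y By <-]] [x' Ax' [y' By' <-]].
rewrite scalerDr addrACA; apply: sums_intro; apply: subspaceD => //;
  exact: subspaceZ.
Qed.

Lemma sumsC A B : A :+: B = B :+: A.
Proof.
by apply/seteqP; split=> _ [x Ax [y By <-]]; rewrite addrC; exact: sums_intro.
Qed.

Lemma sumsA A B C : A :+: (B :+: C) = A :+: B :+: C.
Proof.
apply/seteqP; split.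
  move=> _ [x Ax [_ [y By [z Cz <-]] <-]].
  by rewrite addrA; do 2![apply: sums_intro => //].
move=> _ [_ [x Ax [y By <-]] [z Cz <-]].
by rewrite -addrA; do 2![apply: sums_intro => //].
Qed.

Lemma sums_subl A B : is_subspace B -> A `<=` A :+: B.
Proof.
by move=> sB x Ax; rewrite -[x]addr0; apply: sums_intro => //; exact: subspace0.
Qed.

Lemma sums_subr A B : is_subspace A -> B `<=` A :+: B.
Proof. by move=> sA; rewrite sumsC; exact: sums_subl. Qed.

Lemma sums_sub A B C : is_subspace C -> A `<=` C -> B `<=` C -> A :+: B `<=` C.
Proof.
by move=> sC AC BC _ [x /AC Cx [y /BC Cy <-]]; exact: subspaceD.
Qed.

Lemma sumsSS A A' B B' : A `<=` A' -> B `<=` B' -> A :+: B `<=` A' :+: B'.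
Proof.
by move=> AA BB _ [x /AA ? [y /BB ? <-]]; exact: sums_intro.
Qed.

Lemma add0s A : [set 0] :+: A = A.
Proof.
apply/seteqP; split=> [_ [_ -> [y Ay <-]]|x Ax]; first by rewrite add0r.
by rewrite -[x]add0r; exact: sums_intro.
Qed.

(** Spans and independence are taken over lists rather than indexed families, so that the exchange
    argument is an induction without reindexing; [lc_enum] and [lin_indep_free] translate back to
    families. *)
Fixpoint lc s : set V :=
  if s is x :: s' then [set v | exists a y, lc s' y /\ v = a *: x + y]
  else [set 0].

Fixpoint free s : Prop := if s is x :: s' then ~ lc s' x /\ free s' else True.

Lemma subspace_lc s : is_subspace (lc s).
Proof.
elim: s => [|x s IHs] /=; first exact: subspace_set0.
apply/subspaceP; split.
  by exists 0, 0; rewrite scale0r addr0; split=> //; exact: subspace0.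
move=> c _ _ [a [y [sy ->]]] [b [z [sz ->]]].
exists (c * a + b), (c *: y + z); split; last first.
  by rewrite scalerDr scalerDl scalerA addrACA.
by apply: subspaceD => //; exact: subspaceZ.
Qed.
Hint Resolve subspace_lc subspaceT subspace_set0 : core.

Lemma lc_sub s W : is_subspace W -> (forall x, x \in s -> W x) -> lc s `<=` W.
Proof.
move=> sW; elim: s => [|x s IHs] /= Ws v; first by move=> ->; exact: subspace0.
case=> a [y [sy ->]]; apply: subspaceD => //.
  by apply: subspaceZ => //; apply: Ws; rewrite inE eqxx.
by apply: IHs => // z zs; apply: Ws; rewrite inE zs orbT.
Qed.

Lemma lc_mem s x : x \in s -> lc s x.
Proof.
elim: s => // y s IHs /=; rewrite inE => /orP[/eqP ->|/IHs sx].
  by exists 1, 0; rewrite scale1r addr0; split=> //; exact: subspace0.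
by exists 0, x; rewrite scale0r add0r.
Qed.

Lemma lc_subP s W : is_subspace W -> lc s `<=` W <-> forall x, x \in s -> W x.
Proof.
by move=> sW; split=> [sub x /lc_mem /sub//|]; exact: lc_sub.
Qed.

Lemma lc_subset s t : {subset s <= t} -> lc s `<=` lc t.
Proof. by move=> st; apply: lc_sub => // x /st; exact: lc_mem. Qed.

Lemma lc_cat s t : lc (s ++ t) = lc s :+: lc t.
Proof.
apply/seteqP; split.
  apply: lc_sub; first exact: subspace_sums.
  move=> x; rewrite mem_cat => /orP[] /lc_mem.
  - exact: sums_subl.
  - exact: sums_subr.
apply: sums_sub => //; apply: lc_subset => x; rewrite mem_cat => ->//.
by rewrite orbT.
Qed.

Lemma lc_cons x s : lc (x :: s) = lc [:: x] :+: lc s.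
Proof. by rewrite -cat1s lc_cat. Qed.

Lemma lc1P x v : lc [:: x] v <-> exists a, v = a *: x.
Proof.
split=> [[a [_ [-> ->]]]|[a ->]]; first by exists a; rewrite addr0.
by exists a, 0; rewrite addr0.
Qed.

(** [W] stands for the span of the vectors already exchanged in [steinitz]. Some vector of [t]
    enters [x] with a nonzero coefficient; division by it lets [x] take its place. *)
Lemma exchange W x t : is_subspace W -> ~ W x -> (W :+: lc t) x ->
  exists2 t', size t = (size t').+1 &
    W :+: lc t `<=` W :+: lc (x :: t').
Proof.
move=> sW nWx; elim: t => [|y t IHt].
  by rewrite sumsC add0s => /nWx.
have [/IHt[t' st tt'] _|nx] := pselect ((W :+: lc t) x).
  exists (y :: t'); first by rewrite /= st.
  apply: sums_sub; first exact: subspace_sums.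
    exact: sums_subl.
  have sub : forall z, lc t z -> (W :+: lc [:: x, y & t']) z.
    move=> z tz; have /tt' : (W :+: lc t) z by exact: sums_subr.
    apply: sumsSS => //; apply: lc_subset => u.
    by rewrite !inE => /orP[->//|->]; rewrite !orbT.
  apply: lc_sub; first exact: subspace_sums.
  move=> z; rewrite inE => /orP[/eqP->|/lc_mem/sub//].
  by apply: sums_subr => //; apply: lc_mem; rewrite !inE eqxx orbT.
case/sumsP=> w [_ [Ww [a [z [tz ->]]] xE]].
have [a0|a0] := eqVneq a 0.
  by case: nx; rewrite xE a0 scale0r add0r; exact: sums_intro.
exists t => //.
have sX : is_subspace (W :+: lc (x :: t)) by exact: subspace_sums.
have lcs : forall u, lc t u -> (W :+: lc (x :: t)) u.
  move=> u tu; apply: sums_subr => //; rewrite lc_cons; exact: sums_subr.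
apply: sums_sub => //; first exact: sums_subl.
apply: lc_sub => // u; rewrite inE => /orP[/eqP->|/lc_mem/lcs//].
apply: (@scaleI _ a) => //.
have -> : a *: y = x - w - z by rewrite xE [w + _]addrC !addrK.
apply: subspaceB => //; last exact: lcs.
apply: subspaceB => //; last exact: sums_subl.
by apply: sums_subr => //; apply: lc_mem; rewrite inE eqxx.
Qed.

Lemma steinitz s t : free s -> (forall x, x \in s -> lc t x) ->
  exists2 t', size t = (size s + size t')%N & lc t `<=` lc (s ++ t').
Proof.
elim: s => [|x s IHs] /= => [_ _|[nx fs] st]; first by exists t.
have [//|y ys|t' sz sub] := IHs; first by apply: st; rewrite inE ys orbT.
have [||t'' sz' sub'] := @exchange (lc s) x t' _ nx; first exact: subspace_lc.
  by rewrite -lc_cat; apply/sub/st; rewrite inE eqxx.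
exists t''; first by rewrite sz sz' addnS.
move=> v /sub; rewrite lc_cat => /sub'; rewrite lc_cons sumsA.
by rewrite [lc s :+: _]sumsC -lc_cons -lc_cat.
Qed.

Lemma free_size s t : free s -> lc s `<=` lc t -> (size s <= size t)%N.
Proof.
move=> fs st; have [x xs|t' -> _] := steinitz fs (t := t); last exact: leq_addr.
exact/st/lc_mem.
Qed.

Lemma lc_enum d (b : 'I_d -> V) v :
  lc [seq b i | i <- enum 'I_d] v <-> exists a : 'I_d -> R, v = \sum_i a i *: b i.
Proof.
elim: d b v => [|d IHd] b v.
  rewrite (_ : enum 'I_0 = [::]) /=; last by apply: size0nil; rewrite size_enum_ord.
  split=> [->|[a ->]]; last by rewrite big_ord0.
  by exists (fun=> 0); rewrite big_ord0.
rewrite enum_ordSl /= -map_comp; split.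
  case=> c [y [/IHd[a ->] ->]].
  exists (fun i => if unlift ord0 i is Some j then a j else c).
  rewrite big_ord_recl unlift_none; congr (_ + _).
  by apply: eq_bigr => i _; rewrite liftK.
case=> a ->; rewrite big_ord_recl; exists (a ord0), (\sum_i a (lift ord0 i) *: b (lift ord0 i)).
by split=> //; apply/IHd; exists (a \o lift ord0).
Qed.

Lemma lin_indep_free d (b : 'I_d -> V) :
  lin_indep b <-> free [seq b i | i <- enum 'I_d].
Proof.
elim: d b => [|d IHd] b.
  rewrite (_ : enum 'I_0 = [::]) /=; last by apply: size0nil; rewrite size_enum_ord.
  by split=> // _ a _ [].
rewrite enum_ordSl /= -map_comp; split=> [ib|[nb /IHd ib]].
  split.
    case/lc_enum=> a bE.
    have := ib (fun i => if unlift ord0 i is Some j then a j else - 1).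
    rewrite big_ord_recl unlift_none scaleN1r.
    under eq_bigr do rewrite liftK.
    rewrite -bE addNr => /(_ erefl ord0); rewrite unlift_none => /eqP.
    by rewrite oppr_eq0 oner_eq0.
  apply/IHd => a a0 i.
  have := ib (fun i => if unlift ord0 i is Some j then a j else 0).
  rewrite big_ord_recl unlift_none scale0r add0r.
  under eq_bigr do rewrite liftK.
  by move=> /(_ a0 (lift ord0 i)); rewrite liftK.
move=> a; rewrite big_ord_recl => a0.
have a00 : a ord0 = 0.
  apply: contra_notP nb => /eqP an0.
  apply/lc_enum; exists (fun i => - (a ord0)^-1 * a (lift ord0 i)).
  under eq_bigr do rewrite -scalerA.
  rewrite -scaler_sumr; move/eqP: a0; rewrite addrC addr_eq0 => /eqP ->.
  by rewrite scaleNr scalerN opprK scalerA mulVr ?scale1r //; exact: hR.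
rewrite a00 scale0r add0r in a0.
move=> i; have [j ->|->//] := unliftP ord0 i.
exact: (ib (a \o lift ord0)).
Qed.

Lemma span_set_min (X : set V) W : is_subspace W -> X `<=` W -> span_set X `<=` W.
Proof. by move=> sW; exact: smallest_sub. Qed.

Lemma subspace_span (X : set V) : is_subspace (span_set X).
Proof.
apply/subspaceP; split; first by move=> W [/subspace0].
move=> a u v Xu Xv W [sW XW]; apply: subspaceD => //.
  by apply: subspaceZ => //; exact: Xu.
exact: Xv.
Qed.

Lemma span_range d (b : 'I_d -> V) :
  span_set (range b) = lc [seq b i | i <- enum 'I_d].
Proof.
apply/seteqP; split.
  apply: span_set_min => // _ [i _ <-].
  by apply/lc_mem/map_f; rewrite mem_enum.
apply: lc_sub; first exact: subspace_span.
by move=> x /mapP[i _ ->]; apply: sub_gen_smallest; exists i.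
Qed.

Lemma map_nth_ord s d : size s = d ->
  [seq nth 0 s (val i) | i <- enum 'I_d] = s.
Proof.
move=> <-; rewrite -[RHS](mkseq_nth 0) /mkseq -val_enum_ord -map_comp.
by [].
Qed.

Lemma has_dimP d W :
  has_dim d W <-> exists s, [/\ size s = d, free s & lc s = W].
Proof.
split=> [[b [/lin_indep_free fb <-]]|[s [sz fs <-]]].
  exists [seq b i | i <- enum 'I_d]; split=> //.
    by rewrite size_map size_enum_ord.
  by rewrite span_range.
exists (fun i => nth 0 s (val i)); split.
  by apply/lin_indep_free; rewrite map_nth_ord.
by rewrite span_range map_nth_ord.
Qed.

Lemma has_dim_uniq d e W : has_dim d W -> has_dim e W -> d = e.
Proof.
move=> /has_dimP[s [<- fs sW]] /has_dimP[t [<- ft tW]].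
by apply/eqP; rewrite eqn_leq !free_size // sW tW.
Qed.

(** * Dimension and complements *)

Section FiniteDim.
Variables (n : nat) (hV : has_dim n [set: V]).

Lemma free_size_le s : free s -> (size s <= n)%N.
Proof.
move=> fs; have /has_dimP[t [<- _ tT]] := hV.
by apply: free_size => //; rewrite tT.
Qed.

Lemma free_extend W s : is_subspace W -> free s -> lc s `<=` W ->
  exists2 s', free (s' ++ s) & lc (s' ++ s) = W.
Proof.
move=> sW; have [m] := ubnP (n - size s); elim: m s => // m IHm s lm fs sub.
have [sE|nE] := pselect (lc s = W); first by exists [::].
have [x [Wx nx]] : exists x, W x /\ ~ lc s x.
  apply: contra_notP nE => nE; apply/seteqP; split=> // x Wx.
  by apply: contrapT => nx; apply: nE; exists x.
have fx : free (x :: s) by [].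
have [||s' fs' s'W] := IHm (x :: s) _ fx.
- by have := free_size_le fx => /= ?; lia.
- apply/lc_subP => // y; rewrite inE => /orP[/eqP->//|/lc_mem]; exact: sub.
by exists (rcons s' x); rewrite cat_rcons.
Qed.

Definition dimv W : nat := xget 0%N [set d | has_dim d W].

Lemma dimvP W : is_subspace W -> has_dim (dimv W) W.
Proof.
move=> sW; have [||s' fs s'W] := @free_extend W [::] sW => //.
  by move=> x ->; exact: subspace0.
rewrite cats0 in fs s'W.
have dW : [set d | has_dim d W] (size s') by apply/has_dimP; exists s'.
exact: (xgetI 0%N dW).
Qed.

Lemma has_dim_sub d W : has_dim d W -> is_subspace W.
Proof. by case/has_dimP=> s [_ _ <-]. Qed.

Lemma dimvE d W : has_dim d W -> dimv W = d.
Proof.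
by move=> dW; apply: has_dim_uniq (dW); apply: dimvP; exact: has_dim_sub dW.
Qed.

Lemma dimvT : dimv setT = n.
Proof. exact: dimvE. Qed.

Lemma dimv_basis W : is_subspace W ->
  exists s, [/\ size s = dimv W, free s & lc s = W].
Proof. by move/dimvP/has_dimP. Qed.

Lemma dimv_lc s : free s -> dimv (lc s) = size s.
Proof. by move=> fs; apply: dimvE; apply/has_dimP; exists s. Qed.

Lemma dimv_le A B : is_subspace A -> is_subspace B -> A `<=` B ->
  (dimv A <= dimv B)%N.
Proof.
move=> /dimv_basis[s [<- fs sA]] /dimv_basis[t [<- ft tB]] AB.
by apply: free_size => //; rewrite sA tB.
Qed.

Lemma dimv_eq A B : is_subspace A -> is_subspace B -> A `<=` B ->
  (dimv B <= dimv A)%N -> A = B.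
Proof.
move=> sA sB AB; have [s [<- fs sE]] := dimv_basis sA.
have [//|//||s' fs' <-] := @free_extend B s; first by rewrite sE.
rewrite (dimv_lc fs') size_cat -{2}[size s]add0n leq_add2r leqn0 => /eqP.
by move/size0nil=> ->.
Qed.

Lemma dimv_le_n A : is_subspace A -> (dimv A <= n)%N.
Proof. by move=> sA; rewrite -dimvT; exact: dimv_le. Qed.

Lemma free_cat s t : free s -> free t -> lc s `&` lc t `<=` [set 0] ->
  free (s ++ t).
Proof.
elim: s => //= x s IHs [nx fs] ft st; split; last first.
  apply: IHs => // y [sy ty]; apply: st; split=> //.
  by exists 0, y; rewrite scale0r add0r.
rewrite lc_cat => -[y sy [z tz yz]].
have z0 : z = 0.
  apply: st; split=> //; exists 1, (- y); split; last first.
    by rewrite scale1r -yz addrC addKr.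
  exact: subspaceN.
by apply: nx; rewrite -yz z0 addr0.
Qed.

Lemma free_cat_disjoint s t : free (s ++ t) -> lc s `&` lc t `<=` [set 0].
Proof.
elim: s => [_ v []//|x s IHs /= [nx /IHs st]] v [[a [y [sy ->]]] tv].
have [a0|a0] := eqVneq a 0.
  by apply: st; split; [rewrite a0 scale0r add0r|].
case: nx; rewrite lc_cat; have sS := subspace_sums (subspace_lc s) (subspace_lc t).
apply: (scaleI sS a0); rewrite -[_ *: _](addrK y); apply: subspaceB => //.
  exact: sums_subr.
exact: sums_subl.
Qed.

Lemma dimv_sum A B : is_subspace A -> is_subspace B -> A `&` B `<=` [set 0] ->
  dimv (A :+: B) = (dimv A + dimv B)%N.
Proof.
move=> /dimv_basis[s [<- fs <-]] /dimv_basis[t [<- ft <-]] st.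
by rewrite -lc_cat dimv_lc ?size_cat //; exact: free_cat.
Qed.

Lemma compl_in A B : is_subspace A -> is_subspace B -> A `<=` B ->
  exists C, [/\ is_subspace C, A `&` C `<=` [set 0] & A :+: C = B].
Proof.
move=> sA sB; have [s [_ fs <-]] := dimv_basis sA.
move=> /(free_extend sB fs)[s' fs' s'B]; exists (lc s'); split=> //; last first.
  by rewrite sumsC -lc_cat.
by rewrite setIC; exact: free_cat_disjoint.
Qed.

Lemma dimv_sumI A B : is_subspace A -> is_subspace B ->
  (dimv (A :+: B) + dimv (A `&` B) = dimv A + dimv B)%N.
Proof.
move=> sA sB; have sAB := subspaceI sA sB.
have [C [sC IC AE]] := compl_in sAB sA (@subIsetl _ _ _).
have CA : C `<=` A by rewrite -AE; exact: sums_subr.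
have -> : A :+: B = C :+: B.
  apply/seteqP; split; last by apply: sumsSS.
  rewrite -{1}AE; apply: sums_sub; first exact: subspace_sums.
    apply: sums_sub; first exact: subspace_sums.
      by move=> x [_ Bx]; exact: sums_subr.
    exact: sums_subl.
  exact: sums_subr.
rewrite dimv_sum //; last first.
  by move=> x [Cx Bx]; apply: IC; split=> //; split=> //; exact: CA.
by rewrite -{2}AE dimv_sum // addnC addnA.
Qed.

Definition compl S U : Prop :=
  [/\ is_subspace S, is_subspace U, S `&` U `<=` [set 0] & S :+: U = setT].

Lemma complC S U : compl S U -> compl U S.
Proof. by case=> sS sU I T; split; rewrite 1?setIC 1?sumsC. Qed.

Lemma compl_dim S U : compl S U -> (dimv S + dimv U = n)%N.
Proof. by case=> sS sU I T; rewrite -dimv_sum // T dimvT. Qed.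

Lemma compl_dimP S U : is_subspace S -> is_subspace U -> S `&` U `<=` [set 0] ->
  (dimv S + dimv U = n)%N -> compl S U.
Proof.
move=> sS sU I d; split=> //; apply: dimv_eq => //; first exact: subspace_sums.
by rewrite dimv_sum // d dimvT.
Qed.

Lemma compl_in0 S U x : compl S U -> S x -> U x -> x = 0.
Proof. by case=> _ _ I _ Sx Ux; exact: I. Qed.

Lemma compl_decomp S U x : compl S U -> exists y z, [/\ S y, U z & x = y + z].
Proof. by case=> _ _ _ T; apply/sumsP; rewrite T. Qed.

Lemma grassmannianP d W : grassmannian d W <-> is_subspace W /\ dimv W = d.
Proof.
split=> [[sW dW]|[sW <-]]; first by split=> //; exact: dimvE.
by split=> //; exact: dimvP.
Qed.

(** With dimensions [k] and [n - k], spanning [V] already forces a trivial intersection, so the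
    pairs are direct decompositions. *)
Lemma compl_pairsP k p : (k <= n)%N ->
  compl_pairs n k p <-> compl p.1 p.2 /\ dimv p.1 = k.
Proof.
move=> kn; split=> [[/grassmannianP[s1 d1] /grassmannianP[s2 d2] T]|].
  split=> //; split=> //.
  have := dimv_sumI s1 s2; rewrite T dimvT d1 d2 subnKC // => /eqP.
  rewrite -{2}[n]addn0 eqn_add2l => /eqP d0 x Ix.
  have [s [sz _ sE]] := dimv_basis (subspaceI s1 s2).
  by move: Ix; rewrite -sE; rewrite d0 in sz; rewrite (size0nil sz).
case=> c d; have := compl_dim c; case: (c) => s1 s2 I T; rewrite d => e.
by split=> //; apply/grassmannianP; split=> //; rewrite -e addKn.
Qed.

Lemma compl_extend A S : is_subspace A -> is_subspace S -> A `&` S `<=` [set 0] ->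
  exists2 C, A `<=` C & compl S C.
Proof.
move=> sA sS I; have sAS := subspace_sums sA sS.
have [C [sC IC CT]] := compl_in sAS subspaceT (@subsetT _ _).
exists (A :+: C); first exact: sums_subl.
split=> //; first exact: subspace_sums.
  move=> x [Sx [a Aa [c Cc xE]]]; have c0 : c = 0.
    apply: IC; split=> //; rewrite -[c](addKr a) xE; apply: sums_intro => //.
    exact: subspaceN.
  by apply: I; split=> //; rewrite -xE c0 addr0.
by rewrite sumsA [S :+: A]sumsC.
Qed.

Lemma subspace_compl A : is_subspace A -> exists C, compl A C.
Proof.
move=> sA; have [|C _ cC] := compl_extend subspace_set0 sA; last by exists C.
exact: subIsetl.
Qed.

Lemma avoid2 A B : is_subspace A -> is_subspace B -> A <> setT -> B <> setT ->
  exists x, ~ A x /\ ~ B x.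
Proof.
move=> sA sB nA nB.
have out W : W <> setT -> exists x, ~ W x.
  move=> nW; apply: contra_notP nW => nW; apply/seteqP; split=> // x _.
  by apply: contrapT => Wx; apply: nW; exists x.
have [x nAx] := out _ nA; have [y nBy] := out _ nB.
have [Bx|] := pselect (B x); last by exists x.
have [Ay|] := pselect (A y); last by exists y.
exists (x + y); split=> [h|h].
  by apply: nAx; rewrite -(addrK y x); exact: subspaceB.
by apply: nBy; rewrite -(addKr x y); apply: subspaceD => //; exact: subspaceN.
Qed.

Lemma dimv_cons A x : is_subspace A -> ~ A x ->
  dimv (A :+: lc [:: x]) = (dimv A).+1.
Proof.
move=> /dimv_basis[s [<- fs <-]] nx.
have fx : free (x :: s) by [].
by rewrite sumsC -lc_cons (dimv_lc fx).
Qed.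

(* A subspace maximal among those meeting S and T trivially is a complement of
   both, because V is not the union of two proper subspaces. *)
Lemma common_compl S T : is_subspace S -> is_subspace T -> dimv S = dimv T ->
  exists U, compl S U /\ compl T U.
Proof.
move=> sS sT dST.
suff H : forall m A, is_subspace A -> (n - dimv A < m)%N ->
    A `&` S `<=` [set 0] -> A `&` T `<=` [set 0] ->
    exists U, compl S U /\ compl T U.
  by apply: (H n.+1 [set 0]); rewrite ?ltnS ?leq_subr //; exact: subIsetl.
elim=> // m IHm A sA lm IS IT.
have dS := dimv_sum sA sS IS; have dT := dimv_sum sA sT IT.
have [ST|nST] := pselect (A :+: S = setT).
  exists A; split; apply/complC; split=> //.
  apply: dimv_eq => //; first exact: subspace_sums.
  by rewrite dT -dST -dS ST.
have nTT : A :+: T <> setT.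
  move=> TT; apply: nST; apply: dimv_eq => //; first exact: subspace_sums.
  by rewrite dS dST -dT TT.
have [x [nSx nTx]] :=
  avoid2 (subspace_sums sA sS) (subspace_sums sA sT) nST nTT.
have aux W : is_subspace W -> ~ (A :+: W) x -> A `&` W `<=` [set 0] ->
    (A :+: lc [:: x]) `&` W `<=` [set 0].
  move=> sW nx I _ [[y Ay [_ /lc1P[c ->] <-]] Wv].
  have [c0|c0] := eqVneq c 0.
    by rewrite c0 scale0r addr0 in Wv *; exact: I.
  case: nx; apply: (scaleI (subspace_sums sA sW) c0).
  rewrite -(addKr y (c *: x)); apply: sums_intro => //; exact: subspaceN.
apply: (IHm (A :+: lc [:: x])); [exact: subspace_sums| |exact: aux..].
have nAx : ~ A x by move=> Ax; apply: nSx; exact: sums_subl.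
rewrite dimv_cons //.
have := dimv_le_n (subspace_sums sA (subspace_lc [:: x])).
by rewrite dimv_cons //; lia.
Qed.

(** Dependent vectors are pruned from the list; if no length is lost, nothing was pruned and the
    list was already free. *)
Lemma spanning_free_aux s :
  exists t, [/\ free t, lc t = lc s, (size t <= size s)%N &
    size t = size s -> free s].
Proof.
elim: s => [|x s [t [ft ts le eq]]]; first by exists [::].
have [sx|nx] := pselect (lc s x).
  exists t; split=> //; last by move=> e; move: le; rewrite e ltnn.
    rewrite ts; apply/seteqP; split.
      by apply: lc_subset => y ys; rewrite inE ys orbT.
    by apply: lc_sub => // y; rewrite inE => /orP[/eqP->//|/lc_mem].
  exact: leqW.
exists (x :: t); split=> //; first by split=> //; rewrite ts.
  by rewrite lc_cons ts -lc_cons.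
by move=> -[/eq fs].
Qed.

Lemma spanning_free s : size s = n -> lc s = setT -> free s.
Proof.
move=> sz sT; have [t [ft tE _ eq]] := spanning_free_aux s; apply: eq.
by rewrite sz -(dimv_lc ft) tE sT dimvT.
Qed.

Lemma free_spanning s : size s = n -> free s -> lc s = setT.
Proof.
move=> sz fs; apply: dimv_eq => //.
by rewrite dimvT dimv_lc // sz.
Qed.

Lemma basis_seq s : size s = n -> lc s = setT ->
  is_basis setT (fun i : 'I_n => nth 0 s i).
Proof.
move=> sz sT; split; last by rewrite span_range map_nth_ord.
by apply/lin_indep_free; rewrite map_nth_ord //; exact: spanning_free.
Qed.

Lemma basis_spanning (b : 'I_n -> V) :
  (forall x W, is_subspace W -> (forall i, W (b i)) -> W x) -> is_basis setT b.
Proof.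
move=> bT; have bT' : lc [seq b i | i <- enum 'I_n] = setT.
  apply/seteqP; split=> // x _; apply: bT => // i.
  by apply/lc_mem/map_f; rewrite mem_enum.
split; last by rewrite span_range.
by apply/lin_indep_free/spanning_free; rewrite // size_map size_enum_ord.
Qed.

(** * Projections of direct decompositions *)

Definition pr (p : set V * set V) x : V :=
  xget 0 [set y | p.1 y /\ p.2 (x - y)].

Section Projection.
Variable (p : set V * set V).
Hypothesis cp : compl p.1 p.2.
Let sp1 : is_subspace p.1. Proof. by case: cp. Qed.
Let sp2 : is_subspace p.2. Proof. by case: cp. Qed.

Lemma pr_spec x : p.1 (pr p x) /\ p.2 (x - pr p x).
Proof.
have [y [z [y1 z2 xE]]] := compl_decomp x cp.
have h : [set y | p.1 y /\ p.2 (x - y)] y by rewrite /= xE addrC addKr.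
exact: (xgetI 0 h).
Qed.

Lemma pr_in1 x : p.1 (pr p x). Proof. by case: (pr_spec x). Qed.

Lemma pr_in2 x : p.2 (x - pr p x). Proof. by case: (pr_spec x). Qed.

Lemma pr_uniq x y : p.1 y -> p.2 (x - y) -> pr p x = y.
Proof.
move=> y1 y2; apply/eqP; rewrite -subr_eq0; apply/eqP/(compl_in0 cp).
  by apply: subspaceB => //; exact: pr_in1.
rewrite (_ : pr p x - y = (x - y) - (x - pr p x)).
  by apply: subspaceB => //; exact: pr_in2.
by rewrite opprB [RHS]addrC subrKA.
Qed.

Lemma pr_id x : p.1 x -> pr p x = x.
Proof. by move=> x1; apply: pr_uniq; rewrite ?subrr //; exact: subspace0. Qed.

Lemma pr_0 x : p.2 x -> pr p x = 0.
Proof. by move=> x2; apply: pr_uniq; rewrite ?subr0 //; exact: subspace0. Qed.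

Lemma pr_fix x : pr p x = x <-> p.1 x.
Proof. by split=> [<-|/pr_id //]; exact: pr_in1. Qed.

Lemma pr_ker x : pr p x = 0 <-> p.2 x.
Proof. by split=> [x0|/pr_0 //]; have := pr_in2 x; rewrite x0 subr0. Qed.

Lemma pr_idem x : pr p (pr p x) = pr p x.
Proof. by apply/pr_fix/pr_in1. Qed.

Lemma prD x y : pr p (x + y) = pr p x + pr p y.
Proof.
apply: pr_uniq; first by apply: subspaceD => //; exact: pr_in1.
by rewrite opprD addrACA; apply: subspaceD => //; exact: pr_in2.
Qed.

Lemma prZ a x : pr p (a *: x) = a *: pr p x.
Proof.
apply: pr_uniq; first by apply: subspaceZ => //; exact: pr_in1.
by rewrite -scalerBr; apply: subspaceZ => //; exact: pr_in2.
Qed.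

Lemma prN x : pr p (- x) = - pr p x.
Proof. by rewrite -scaleN1r prZ scaleN1r. Qed.

Lemma prB x y : pr p (x - y) = pr p x - pr p y.
Proof. by rewrite prD prN. Qed.

Lemma pr_sum (I : finType) (P : pred I) (F : I -> V) :
  pr p (\sum_(i | P i) F i) = \sum_(i | P i) pr p (F i).
Proof. by apply: (big_morph (pr p) prD); apply: pr_id; exact: (subspace0 sp1). Qed.

End Projection.

Lemma compl_sub_eq p q : compl p.1 p.2 -> compl q.1 q.2 ->
  p.1 `<=` q.1 -> p.2 `<=` q.2 -> p = q.
Proof.
move=> cp cq s1 s2; case: p q cp cq s1 s2 => [S U] [S' U'] /= cp cq s1 s2.
have [sS' sU' _ _] := cq.
congr pair; apply/seteqP; split=> // x xq; have [y [z [Sy Uz xE]]] := compl_decomp x cp.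
  suff -> : x = y by [].
  suff z0 : z = 0 by rewrite xE z0 addr0.
  apply: (compl_in0 cq); last exact: s2.
  by rewrite -(addKr y z) -xE addrC; apply: subspaceB => //; exact: s1.
suff -> : x = z by [].
suff y0 : y = 0 by rewrite xE y0 add0r.
apply: (compl_in0 cq); first exact: s1.
by rewrite -(addrK z y) -xE; apply: subspaceB => //; exact: s2.
Qed.

Lemma pr_eq p q : compl p.1 p.2 -> compl q.1 q.2 ->
  (forall x, pr p x = pr q x) -> p = q.
Proof.
move=> cp cq e; apply: compl_sub_eq => // x.
  by move/(pr_id cp); rewrite e => /(pr_fix cq).
by move/(pr_0 cp); rewrite e => /(pr_ker cq).
Qed.

(** * Coordinates and coordinate pairs of a frame *)

Definition co (b : 'I_n -> V) (i : 'I_n) x : R :=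
  (xget 0 [set a : 'rV[R]_n | x = \sum_j a 0 j *: b j]) 0 i.

Section Coordinates.
Variable b : 'I_n -> V.
Hypothesis bb : is_basis setT b.

Lemma co_sum x : x = \sum_i co b i x *: b i.
Proof.
have [_ bT] := bb; have : lc [seq b i | i <- enum 'I_n] x.
  by rewrite -span_range bT.
case/lc_enum=> a xE.
have h : [set a : 'rV[R]_n | x = \sum_j a 0 j *: b j] (\row_j a j).
  by rewrite /= xE; apply: eq_bigr => j _; rewrite mxE.
exact: (xgetI 0 h).
Qed.

Lemma co_uniq (a : 'I_n -> R) i : co b i (\sum_j a j *: b j) = a i.
Proof.
have [bi _] := bb; set x := \sum_j _.
apply/eqP; rewrite -subr_eq0; apply/eqP.
apply: (bi (fun i => co b i x - a i)).
under eq_bigr do rewrite scalerBl.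
by rewrite sumrB -co_sum subrr.
Qed.

Lemma co_ext x y : (forall i, co b i x = co b i y) -> x = y.
Proof.
move=> e; rewrite [x]co_sum [y]co_sum.
by apply: eq_bigr => i _; rewrite e.
Qed.

Lemma coD i x y : co b i (x + y) = co b i x + co b i y.
Proof.
rewrite {1}[x]co_sum {1}[y]co_sum -big_split /=.
under eq_bigr do rewrite -scalerDl.
exact: co_uniq.
Qed.

Lemma coZ i a x : co b i (a *: x) = a * co b i x.
Proof.
rewrite {1}[x]co_sum scaler_sumr.
under eq_bigr do rewrite scalerA.
exact: co_uniq.
Qed.

Lemma co_linear i : scalar (co b i).
Proof. by move=> a x y; rewrite coD coZ. Qed.

Lemma co0 i : co b i 0 = 0.
Proof. by rewrite -(scale0r 0) coZ mul0r. Qed.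

Lemma coN i x : co b i (- x) = - co b i x.
Proof. by rewrite -scaleN1r coZ mulN1r. Qed.

Lemma coB i x y : co b i (x - y) = co b i x - co b i y.
Proof. by rewrite coD coN. Qed.

Lemma co_b i j : co b i (b j) = (i == j)%:R.
Proof.
rewrite (_ : b j = \sum_l (l == j)%:R *: b l); first exact: co_uniq.
rewrite (bigD1 j) //= eqxx scale1r big1 ?addr0 // => l /negPf->.
by rewrite scale0r.
Qed.

Lemma basis_neq0 i : b i <> 0.
Proof.
by move=> b0; have /eqP := co_b i i; rewrite b0 co0 eqxx eq_sym oner_eq0.
Qed.

(** Defined by vanishing coordinates rather than as a span, so that sums and intersections are read
    off the index sets. By [base_subset_ofP] the base subset of a frame consists of the pairs [pt]
    of its index sets of size [k]. *)
Definition sp (A : {set 'I_n}) : set V :=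
  [set x | forall i, i \notin A -> co b i x = 0].
Definition pt (A : {set 'I_n}) : set V * set V := (sp A, sp (~: A)).

Lemma subspace_sp (A : {set 'I_n}) : is_subspace (sp A).
Proof.
apply/subspaceP; split=> [i _|a u v Au Av i iA]; first exact: co0.
by rewrite coD coZ Au // Av // mulr0 addr0.
Qed.
Hint Resolve subspace_sp : core.

Lemma sp_b (A : {set 'I_n}) i : sp A (b i) <-> i \in A.
Proof.
split=> [Ab|iA j]; last first.
  by rewrite co_b; case: eqP => // -> /negP[].
apply: contraT => iA; have /eqP := Ab _ iA.
by rewrite co_b eqxx oner_eq0.
Qed.

Lemma sp_sub (A : {set 'I_n}) W : is_subspace W -> (forall i, i \in A -> W (b i)) ->
  sp A `<=` W.
Proof.
move=> sW Wb x Ax; rewrite [x]co_sum; apply: subspace_sum => // i _.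
have [iA|iA] := boolP (i \in A); first by apply: subspaceZ => //; exact: Wb.
by rewrite Ax // scale0r; exact: subspace0.
Qed.

Lemma spS (A B : {set 'I_n}) : A \subset B -> sp A `<=` sp B.
Proof.
by move=> /fintype.subsetP AB; apply: sp_sub => // i /AB /sp_b.
Qed.

Lemma spSP (A B : {set 'I_n}) : sp A `<=` sp B <-> A \subset B.
Proof.
split=> [s|]; last exact: spS.
by apply/fintype.subsetP => i /sp_b /s /sp_b.
Qed.

Lemma sp_inj : injective sp.
Proof.
by move=> A B e; apply/eqP; rewrite finset.eqEsubset; apply/andP; split; apply/spSP; rewrite e.
Qed.

Lemma sp_setT : sp [set: 'I_n] = setT.
Proof. by apply/seteqP; split=> // x _ i; rewrite inE. Qed.

Lemma free_map_basis (r : seq 'I_n) : uniq r -> free [seq b i | i <- r].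
Proof.
elim: r => //= i r IHr /andP[ir /IHr fr]; split=> // h.
have : sp (~: [set i]) (b i).
  apply: (lc_sub _ _ h) => // _ /mapP[j jr ->]; apply/sp_b.
  by rewrite !inE; apply: contraNneq ir => <-.
by move/sp_b; rewrite !inE eqxx.
Qed.

Lemma lc_sp (A : {set 'I_n}) : lc [seq b i | i <- enum A] = sp A.
Proof.
apply/seteqP; split.
  by apply: lc_sub => // _ /mapP[i iA ->]; apply/sp_b; rewrite mem_enum in iA.
by apply: sp_sub => // i iA; apply/lc_mem/map_f; rewrite mem_enum.
Qed.

Lemma dimv_sp (A : {set 'I_n}) : dimv (sp A) = #|A|.
Proof.
by rewrite -lc_sp dimv_lc ?size_map -?cardE //; apply/free_map_basis/enum_uniq.
Qed.

Lemma spI (A B : {set 'I_n}) : sp A `&` sp B = sp (A :&: B).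
Proof.
apply/seteqP; split=> [x [Ax Bx] i|].
  by rewrite inE negb_and => /orP[]; [exact: Ax|exact: Bx].
by move=> x ABx; split; apply: spS ABx; rewrite ?finset.subsetIl ?finset.subsetIr.
Qed.

Lemma spU (A B : {set 'I_n}) : sp A :+: sp B = sp (A :|: B).
Proof.
apply/seteqP; split.
  by apply: sums_sub => //; apply: spS; rewrite ?finset.subsetUl ?finset.subsetUr.
apply: sp_sub; first exact: subspace_sums.
move=> i; rewrite inE => /orP[/sp_b|/sp_b]; [exact: sums_subl|exact: sums_subr].
Qed.

Lemma sp_set0 : sp finset.set0 = [set 0].
Proof.
apply/seteqP; split; first by apply: sp_sub => // i; rewrite inE.
by move=> _ ->; exact: subspace0.
Qed.

Lemma compl_pt (A : {set 'I_n}) : compl (sp A) (sp (~: A)).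
Proof.
split=> //; first by rewrite spI finset.setICr sp_set0.
by rewrite spU finset.setUCr sp_setT.
Qed.

Lemma pr_pt (A : {set 'I_n}) x i :
  co b i (pr (pt A) x) = if i \in A then co b i x else 0.
Proof.
have c := compl_pt A.
have [h1 h2] := pr_spec (p := pt A) c x.
case: ifPn => [iA|iA]; last exact: h1.
have /h2/eqP : i \notin ~: A by rewrite inE negbK.
by rewrite coB subr_eq0 => /eqP.
Qed.

Lemma pr_pt_sum (A : {set 'I_n}) x :
  pr (pt A) x = \sum_(i in A) co b i x *: b i.
Proof.
apply: co_ext => i; rewrite pr_pt.
have -> : \sum_(j in A) co b j x *: b j =
    \sum_j (if j \in A then co b j x else 0) *: b j.
  by rewrite big_mkcond; apply: eq_bigr => j _; case: ifP => //; rewrite scale0r.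
by rewrite co_uniq.
Qed.

Lemma sub_pr_pt (A : {set 'I_n}) x :
  x - pr (pt A) x = \sum_(i in ~: A) co b i x *: b i.
Proof.
rewrite pr_pt_sum {1}[x]co_sum (bigID (mem A)) /= [X in X - _]addrC addrK.
by apply: eq_bigl => i; rewrite inE.
Qed.

Lemma pt_compl_pairs k (A : {set 'I_n}) : #|A| = k -> compl_pairs n k (pt A).
Proof.
move=> Ak; have kn : (k <= n)%N by rewrite -Ak -[X in (_ <= X)%N]card_ord max_card.
by apply/compl_pairsP => //=; split; [exact: compl_pt|rewrite dimv_sp].
Qed.

Lemma span_part (X : set V) : X `<=` range b ->
  span_set X = sp [set i | `[< X (b i) >]].
Proof.
move=> Xb; apply/seteqP; split.
  apply: span_set_min => // x Xx; have [i _ bi] := Xb _ Xx.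
  by rewrite -bi in Xx *; apply/sp_b; rewrite inE; exact/asboolP.
apply: sp_sub; first exact: subspace_span.
by move=> i; rewrite inE => /asboolP; exact: sub_gen_smallest.
Qed.

Lemma spanned_by_partP W :
  spanned_by_part_of (range b) W <->
  exists A : {set 'I_n}, W = sp A.
Proof.
split=> [[X Xb ->]|[A ->]]; first by eexists; exact: span_part.
exists [set b i | i in [set i | i \in A]].
  by move=> _ [i _ <-]; exists i.
rewrite span_part; last by move=> _ [i _ <-]; exists i.
congr sp; apply/setP => i; rewrite inE; apply/idP/asboolP => [iA|[j /= jA]].
  by exists i.
by move=> /(congr1 (co b i)); rewrite !co_b eqxx; case: eqP => [->//|_ /esym/eqP]; rewrite oner_eq0.
Qed.

(** The two index sets are complementary: a common index would put a basis vector in both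
    components, and an index missed by both would keep that vector out of their sum. *)
Lemma base_subset_ofP k p :
  base_subset_of n k (range b) p <->
  exists2 A : {set 'I_n}, #|A| = k & p = pt A.
Proof.
split=> [[cp /spanned_by_partP[A p1] /spanned_by_partP[B p2]]|[A Ak ->]]; last first.
  split; first exact: pt_compl_pairs.
    by apply/spanned_by_partP; exists A.
  by apply/spanned_by_partP; exists (~: A).
have kn : (k <= n)%N.
  have [/grassmannianP[sp1 <-] _ _] := cp; exact: dimv_le_n.
have [c d] := (compl_pairsP p kn).1 cp.
exists A; first by rewrite -dimv_sp -p1.
rewrite /pt -p1; case: p => [S U] /= in cp p1 p2 c d *; congr pair.
rewrite p2; congr sp; apply/setP => i; rewrite inE.
apply/idP/idP => [iB|iA].
  apply/negP => iA; apply: (@basis_neq0 i); apply: (compl_in0 c).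
    by rewrite p1; apply/sp_b.
  by rewrite p2; apply/sp_b.
have : sp (A :|: B) (b i).
  by rewrite -spU -p1 -p2; case: c => _ _ _ ->.
by move/sp_b; rewrite inE (negPf iA).
Qed.

End Coordinates.
(** * Commuting pairs and base subsets *)

Definition swap (p : set V * set V) := (p.2, p.1).

Lemma swapK : involutive swap. Proof. by case. Qed.

Definition comm p q : Prop := forall x, pr p (pr q x) = pr q (pr p x).

Lemma commC p q : comm p q -> comm q p.
Proof. by move=> c x. Qed.

Lemma pr_swap p x : compl p.1 p.2 -> pr (swap p) x = x - pr p x.
Proof.
move=> cp; apply: pr_uniq; first exact: complC.
  exact: pr_in2.
by rewrite subKr; exact: pr_in1.
Qed.

Lemma comm_swap p q : compl p.1 p.2 -> compl q.1 q.2 ->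
  comm p q -> comm (swap p) (swap q).
Proof.
move=> cp cq c x; rewrite !pr_swap // !prB // c.
by rewrite !opprB [LHS]addrACA [RHS]addrACA [in LHS](addrC (- _)).
Qed.

Definition cb k (p q : set V * set V) : Prop :=
  exists X, [/\ base_subset n k X, X p & X q].

Lemma seq_part s : size s = n -> lc s = setT -> forall t, {subset t <= s} ->
  spanned_by_part_of (range (fun i : 'I_n => nth 0 s i)) (lc t).
Proof.
move=> sz sT t ts; exists [set x | x \in t].
  move=> x /= xt; have xs := ts _ xt.
  have xn : (index x s < n)%N by rewrite -sz index_mem.
  by exists (Ordinal xn) => //=; rewrite nth_index.
apply/seteqP; split.
  apply: lc_sub; first exact: subspace_span.
  by move=> x xt; apply: sub_gen_smallest.
by apply: span_set_min => // x; exact: lc_mem.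
Qed.

(** [pr q] maps [p.1] into itself, so [x] and [pr q x] differ by a vector of [p.1] as well. *)
Lemma comm_split p q : compl p.1 p.2 -> compl q.1 q.2 -> comm p q ->
  p.1 = (p.1 `&` q.1) :+: (p.1 `&` q.2).
Proof.
move=> cp cq c; have [sp1 sp2 _ _] := cp; apply/seteqP; split; last first.
  by apply: sums_sub => //; exact: subIsetl.
move=> x px; have pqx : p.1 (pr q x).
  by apply/(pr_fix cp); rewrite c (pr_id cp).
rewrite -[x](subrK (pr q x)) addrC; apply: sums_intro.
  by split=> //; exact: pr_in1.
by split; [exact: subspaceB|exact: pr_in2].
Qed.

(** Commuting projections cut [V] into the four intersections of their images and kernels, and bases
    of these pieces together form one frame for both pairs. Conversely, the coordinate projections
    of one frame commute. *)
Lemma cbP k p q : compl_pairs n k p -> compl_pairs n k q ->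
  cb k p q <-> comm p q.
Proof.
move=> pk qk.
have kn : (k <= n)%N.
  by have [/grassmannianP[sp1 <-] _ _] := pk; exact: dimv_le_n.
have [cp dp] := (compl_pairsP p kn).1 pk; have [cq dq] := (compl_pairsP q kn).1 qk.
split.
  case=> X [[b bb ->] /(base_subset_ofP bb)[A _ ->] /(base_subset_ofP bb)[B _ ->]] x.
  apply: (co_ext bb) => i; rewrite !(pr_pt bb).
  by case: ifP; case: ifP.
move=> c; have c' := comm_swap cp cq c.
have [sp1 sp2 _ _] := cp; have [sq1 sq2 _ _] := cq.
have p1E := comm_split cp cq c.
have p2E := @comm_split (swap p) (swap q) (complC cp) (complC cq) c'.
have q1E := comm_split cq cp (commC c).
have q2E := @comm_split (swap q) (swap p) (complC cq) (complC cp) (commC c').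
rewrite /= in p2E q2E.
have [s1 [z1 f1 e1]] := dimv_basis (subspaceI sp1 sq1).
have [s2 [z2 f2 e2]] := dimv_basis (subspaceI sp1 sq2).
have [s3 [z3 f3 e3]] := dimv_basis (subspaceI sp2 sq1).
have [s4 [z4 f4 e4]] := dimv_basis (subspaceI sp2 sq2).
have P1 : p.1 = lc (s1 ++ s2) by rewrite lc_cat e1 e2.
have P2 : p.2 = lc (s3 ++ s4) by rewrite lc_cat e3 e4 sumsC.
have Q1 : q.1 = lc (s1 ++ s3) by rewrite lc_cat e1 e3 setIC [p.2 `&` _]setIC.
have Q2 : q.2 = lc (s2 ++ s4).
  by rewrite lc_cat e2 e4 [p.1 `&` _]setIC [p.2 `&` _]setIC sumsC.
have sT : lc ((s1 ++ s2) ++ (s3 ++ s4)) = setT.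
  by rewrite lc_cat -P1 -P2; case: cp.
have sz : size ((s1 ++ s2) ++ (s3 ++ s4)) = n.
  rewrite -(compl_dim cp) P1 P2 !dimv_lc ?size_cat //.
    apply: free_cat => //; rewrite e3 e4 => x [[_ q1] [_ q2]].
    exact: compl_in0 cq q1 q2.
  apply: free_cat => //; rewrite e1 e2 => x [[_ q1] [_ q2]].
  exact: compl_in0 cq q1 q2.
have sub := seq_part sz sT; have := basis_seq sz sT.
set b := fun i => _ in sub *; move=> bb.
exists (base_subset_of n k (range b)); split; first by exists b.
- split=> //; rewrite ?P1 ?P2; apply: sub => x;
    by rewrite !mem_cat => /orP[] ->; rewrite ?orbT.
- split=> //; rewrite ?Q1 ?Q2; apply: sub => x;
    by rewrite !mem_cat => /orP[] ->; rewrite ?orbT.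
Qed.

(** * Separating frame indices by subsets of size k *)

Section Combinatorics.
Local Open Scope set_scope.

Lemma ex_subset k (B C : {set 'I_n}) : B \subset C -> (#|B| <= k <= #|C|)%N ->
  exists A : {set 'I_n}, [/\ B \subset A, A \subset C & #|A| = k].
Proof.
have [m] := ubnP (k - #|B|); elim: m B => // m IHm B lm BC /andP[Bk kC].
move: Bk; rewrite leq_eqVlt => /orP[/eqP<-|Bk]; first by exists B.
have /properP[_ [x xC xB]] : B \proper C.
  by rewrite properEcard BC (leq_trans Bk).
have [|||A [BA AC Ak]] := IHm (x |: B).
- by rewrite cardsU1 xB; lia.
- by rewrite finset.subUset finset.sub1set xC.
- by rewrite cardsU1 xB kC andbT; lia.
by exists A; split=> //; apply: fintype.subset_trans BA; exact: finset.subsetUr.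
Qed.

(** The condition [n <> 2 * k] matters: for n = 4 and k = 2, no 2-subset treats [i] and [j] alike
    and separates the two remaining indices. *)
Lemma separating_subset k (i j m m' : 'I_n) :
  (0 < k < n)%N -> n <> (2 * k)%N -> i != j -> m != m' ->
  [set m; m'] != [set i; j] ->
  exists A : {set 'I_n}, [/\ #|A| = k, (i \in A) = (j \in A) & (m \in A) = (m' \notin A)].
Proof.
move=> /andP[k0 kn] n2k ij mm' mij.
(* Passing to the complement replaces [k] by [n - k] and respects both conditions on [A]. *)
wlog lt : k k0 kn n2k / (2 * k < n)%N.
  move=> H; have [lt|nlt] := boolP (2 * k < n)%N; first exact: H.
  have [||||A [Ak iA mA]] := H (n - k)%N; try lia.
  exists (~: A); split; first by rewrite cardsCs finset.setCK card_ord Ak; lia.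
    by rewrite !inE iA.
  by rewrite !inE mA.
wlog mN : m m' mm' mij / m \notin [set i; j].
  move=> H; have [mI|mN] := boolP (m \in [set i; j]); last exact: H.
  have [|||A [Ak iA mA]] := H m' m.
  - by rewrite eq_sym.
  - by rewrite [[set m'; m]]finset.setUC.
  - apply: contra mij => m'I; rewrite finset.eqEcard !cards2 mm' ij leqnn andbT.
    by apply/fintype.subsetP => x; rewrite !inE => /orP[]/eqP->; rewrite ?inE in mI m'I *.
  exists A; split=> //.
  by rewrite mA negbK.
(* [A] contains [m] and avoids [i], [j], [m']. There is room: if the four indices are distinct then
   [n >= 4], and together with [2 * k < n] this gives [k <= n - 3]. *)
have [||A [mA AC Ak]] := @ex_subset k [set m] (~: [set i; j; m']).
- by move: mN; rewrite finset.sub1set !inE !negb_or => /andP[-> ->].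
- rewrite cards1 k0 /= cardsCs finset.setCK card_ord.
  have [m'I|m'N] := boolP (m' \in [set i; j]).
    rewrite (_ : [set i; j; m'] = [set i; j]); first by rewrite cards2 ij; lia.
    by apply/finset.setUidPl; rewrite finset.sub1set.
  have c4 : (#|[set i; j; m'] :|: [set m]| <= n)%N.
    by rewrite -[X in (_ <= X)%N]card_ord max_card.
  move: c4; rewrite finset.setUC cardsU1 [[set i; j; m']]finset.setUC cardsU1.
  move: mN m'N; rewrite cards2 ij !inE.
  by move: mm' => /negPf -> /norP[/negPf-> /negPf->] /norP[/negPf-> /negPf->] /=; lia.
have nA x : x \in [set i; j; m'] -> x \in A = false.
  move=> xI; apply/negbTE/negP => /(fintype.subsetP AC).
  by rewrite inE xI.
exists A; split=> //; first by rewrite !nA // !inE eqxx ?orbT.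
have -> : m \in A by apply: (fintype.subsetP mA); rewrite inE.
by rewrite (nA m') // !inE eqxx !orbT.
Qed.

Lemma ex_splitting k (i j : 'I_n) : (0 < k < n)%N -> i != j ->
  exists A : {set 'I_n}, [/\ #|A| = k, i \notin A & j \in A].
Proof.
move=> kn ij; have [||A [jA AC Ak]] := @ex_subset k [set j] (~: [set i]).
- by rewrite finset.sub1set !inE eq_sym.
- by rewrite cards1 cardsCs finset.setCK card_ord cards1; lia.
exists A; split=> //.
  by apply/negP => /(fintype.subsetP AC); rewrite !inE eqxx.
by apply: (fintype.subsetP jA); rewrite inE.
Qed.

End Combinatorics.

(** * Comparison of two frames *)

Section TwoBases.
Variables (b c : 'I_n -> V) (k : nat).
Hypotheses (bb : is_basis setT b) (cc : is_basis setT c).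

Lemma line_coord x i : (forall j, j != i -> co b j x = 0) -> x = co b i x *: b i.
Proof.
move=> x0; rewrite {1}[x](co_sum bb) (bigD1 i) //= big1 ?addr0 // => j ji.
by rewrite x0 // scale0r.
Qed.

Lemma scaled_basis_sub :
  (forall l, exists i a, c l = a *: b i) ->
  base_subset_of n k (range c) `<=` base_subset_of n k (range b).
Proof.
move=> /choice[pi /choice[a cE]] p [pk p1 p2].
have aux (A : {set 'I_n}) : exists B : {set 'I_n}, sp c A = sp b B.
  exists [set pi l | l in A]%SET; apply/seteqP; split.
    apply: (sp_sub cc); first exact: (subspace_sp bb).
    by move=> l lA; rewrite cE; apply: (subspaceZ _ (subspace_sp bb _)); apply/(sp_b bb); exact: imset_f.
  apply: (sp_sub bb); first exact: (subspace_sp cc).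
  move=> _ /imsetP[l lA ->]; apply: (scaleI (subspace_sp cc A) (a := a l)).
    by apply/eqP => a0; apply: (basis_neq0 cc (i := l)); rewrite cE a0 scale0r.
  by rewrite -cE; apply/(sp_b cc).
split=> //; apply/(spanned_by_partP bb).
  by have [A ->] := (spanned_by_partP cc _).1 p1; have [B ->] := aux A; exists B.
by have [A ->] := (spanned_by_partP cc _).1 p2; have [B ->] := aux A; exists B.
Qed.

(** The index map is injective, since two vectors of [c] on one line would be dependent; being a
    self-map of a finite set, it is onto. *)
Lemma scaled_basis_sym :
  (forall l, exists i a, c l = a *: b i) -> forall i, exists l a, b i = a *: c l.
Proof.
move=> /choice[pi /choice[a cE]] i.
have a0 l : a l != 0.
  by apply/eqP => al; apply: (basis_neq0 cc (i := l)); rewrite cE al scale0r.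
have bE l : b (pi l) = (a l)^-1 *: c l.
  by rewrite cE scalerA mulVr ?scale1r //; exact: hR.
have pi_inj : injective pi.
  move=> l l' e; apply/eqP/negP => ll'.
  have := cE l'; rewrite -e bE scalerA => /(congr1 (co c l')).
  rewrite (coZ cc) !(co_b cc) eqxx; case: eqP => [ll|_]; first by case: ll'; rewrite ll.
  by rewrite mulr0 => /eqP; rewrite oner_eq0.
have /codomP[l ->] : i \in codom pi by apply: injF_onto.
by exists l, (a l)^-1.
Qed.

End TwoBases.

Lemma scaled_basis_eq (b c : 'I_n -> V) k : is_basis setT b -> is_basis setT c ->
  (forall l, exists i a, c l = a *: b i) ->
  base_subset_of n k (range b) = base_subset_of n k (range c).
Proof.
move=> bb cc h; apply/seteqP; split; last exact: scaled_basis_sub.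
by apply: scaled_basis_sub => //; exact: scaled_basis_sym.
Qed.

(* Otherwise the members of the common pairs cut out every line of the frame [b],
   so that [c] consists of multiples of the vectors of [b]. *)
Lemma unseparated_pair (b c : 'I_n -> V) k : is_basis setT b -> is_basis setT c ->
  base_subset_of n k (range b) <> base_subset_of n k (range c) ->
  exists i j, i != j /\ forall A : {set 'I_n}, #|A| = k ->
    base_subset_of n k (range c) (pt b A) -> (i \in A) = (j \in A).
Proof.
move=> bb cc; apply: contra_notP => h; apply: scaled_basis_eq => // l.
have [i ci] : exists i, co b i (c l) != 0.
  apply: contrapT => /forallNP c0; apply: (basis_neq0 cc (i := l)).
  apply: (co_ext bb) => i; rewrite (co0 bb); apply/eqP/negPn/negP; exact: c0.
exists i, (co b i (c l)); apply: line_coord => // j ji; apply: contrapT => cj.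
apply: h; exists i, j; split; first by rewrite eq_sym.
move=> A Ak /(base_subset_ofP cc)[B _ [e1 e2]].
(* A pair common to both frames is a coordinate pair of [c] too, so [c l] lies in one of its
   components; if the pair separated [i] from [j], then [c l] could not have both coordinates
   nonzero. *)
have cA : sp b A (c l) \/ sp b (~: A) (c l).
  rewrite e1 e2; have [lB|lB] := boolP (l \in B); [left|right]; apply/sp_b => //.
  by rewrite inE.
case: cA => cA.
  have [iA|iA] := boolP (i \in A); last by rewrite cA ?eqxx in ci.
  by have [//|jA] := boolP (j \in A); have := cA _ jA.
have [iA|iA] := boolP (i \in A); first by rewrite cA ?eqxx ?inE ?negbK in ci.
by have [jA|//] := boolP (j \in A); case: cj; apply: cA; rewrite inE negbK.
Qed.

Section Elementary.
Variables (b : 'I_n -> V) (i j : 'I_n) (a : R).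
Hypotheses (bb : is_basis setT b) (ij : i != j).

(** Only [b j] moves, inside the plane of [b i] and [b j]: coordinate pairs that do not separate [i]
    from [j] stay the same, the others change when [a] is nonzero. *)
Definition elem_basis (m : 'I_n) : V := if m == j then b j + a *: b i else b m.

Lemma elem_basisP : is_basis setT elem_basis.
Proof.
have bi : elem_basis i = b i by rewrite /elem_basis (negPf ij).
apply: basis_spanning => x W sW cW; rewrite [x](co_sum bb).
apply: subspace_sum => // m _; apply: subspaceZ => //.
have [->|mj] := eqVneq m j; last by have := cW m; rewrite /elem_basis (negPf mj).
rewrite -(addrK (a *: b i) (b j)); apply: subspaceB => //.
  by have := cW j; rewrite /elem_basis eqxx.
by apply: subspaceZ => //; rewrite -bi; exact: cW.
Qed.

Lemma sp_elem (A : {set 'I_n}) : (i \in A) = (j \in A) -> sp elem_basis A = sp b A.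
Proof.
move=> ijA; apply: dimv_eq; [exact: subspace_sp elem_basisP _|exact: subspace_sp| |].
  apply: (sp_sub elem_basisP); first exact: subspace_sp.
  move=> m mA; rewrite /elem_basis; case: eqP => [mj|_]; last exact/sp_b.
  rewrite mj in mA; apply: (subspaceD (subspace_sp bb _)); first exact/sp_b.
  by apply: (subspaceZ _ (subspace_sp bb _)); apply/sp_b => //; rewrite ijA.
by rewrite (dimv_sp bb) (dimv_sp elem_basisP).
Qed.

Lemma pt_elem (A : {set 'I_n}) : (i \in A) = (j \in A) -> pt elem_basis A = pt b A.
Proof. by move=> ijA; rewrite /pt !sp_elem // !inE ijA. Qed.

Lemma elem_basis_neq k : (0 < k < n)%N -> a != 0 ->
  base_subset_of n k (range b) <> base_subset_of n k (range elem_basis).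
Proof.
move=> kn a0 e; have [A [Ak iA jA]] := ex_splitting kn ij.
have : base_subset_of n k (range b) (pt elem_basis A).
  by rewrite e; apply/(base_subset_ofP elem_basisP); exists A.
case/(base_subset_ofP bb)=> C _ [e1 e2].
have : sp b C (b j + a *: b i).
  by rewrite -e1; have /(sp_b elem_basisP) := jA; rewrite /elem_basis eqxx.
have : sp b (~: C) (b i).
  rewrite -e2; have : i \in ~: A by rewrite inE.
  by move/(sp_b elem_basisP); rewrite /elem_basis (negPf ij).
move/(sp_b bb); rewrite inE => iC /(_ i iC)/eqP.
by rewrite (coD bb) (coZ bb) !(co_b bb) (negPf ij) eqxx add0r mulr1 (negPf a0).
Qed.

End Elementary.
(** * Adjacent pairs *)

Lemma scaler_eq0_div (a : R) (x : V) : a *: x = 0 -> x != 0 -> a = 0.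
Proof.
move=> ax x0; apply/eqP; apply: contraNT x0 => a0.
by rewrite -[x]scale1r -(mulVr (hR a0)) -scalerA ax scaler0.
Qed.

Lemma scaler_inj (a b : R) (x : V) : x != 0 -> a *: x = b *: x -> a = b.
Proof.
move=> x0 /eqP; rewrite -subr_eq0 -scalerBl => /eqP /scaler_eq0_div => /(_ x0).
by move/eqP; rewrite subr_eq0 => /eqP.
Qed.

Lemma idem01 (c : R) : c * c = c -> c = 0 \/ c = 1.
Proof.
move=> cc; have [->|c0] := eqVneq c 0; [by left|right].
by apply: (mulrI (hR c0)); rewrite mulr1.
Qed.

(* The image of [a] under the transvection x |-> x + phi(x) t, for phi vanishing on
   [a.1] and t in [a.1]. *)
Definition shear (a : set V * set V) (phi : {scalar V}) (t : V) :=
  (a.1, [set x | pr a x = phi x *: t]).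

Section Shear.
Variables (a : set V * set V) (phi : {scalar V}) (t : V).
Hypotheses (ca : compl a.1 a.2) (phi0 : forall x, a.1 x -> phi x = 0).
Hypothesis ta : a.1 t.

Lemma phi_pr x : phi (x - pr a x) = phi x.
Proof. by rewrite linearB /= (phi0 (pr_in1 ca x)) subr0. Qed.

Lemma shear_compl : compl (shear a phi t).1 (shear a phi t).2.
Proof.
have [s1 s2 _ _] := ca; split=> //=.
- apply/subspaceP; split; first by rewrite /= pr_id ?linear0 ?scale0r //; exact: subspace0.
  move=> c u v /= uE vE; rewrite prD // prZ // uE vE linearP.
  by rewrite scalerDl scalerA.
- by move=> x [x1]; rewrite /= (pr_id ca x1) (phi0 x1) scale0r.
apply/seteqP; split=> // x _; rewrite -(subrK (pr a x - phi x *: t) x) addrC.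
have st : a.1 (pr a x - phi x *: t).
  by apply: subspaceB => //; [exact: pr_in1|exact: subspaceZ].
apply: sums_intro => //=; rewrite prB // (pr_id ca st) subKr.
by rewrite linearB /= (phi0 st) subr0.
Qed.

Lemma pr_shear x : pr (shear a phi t) x = pr a x - phi x *: t.
Proof.
have [s1 s2 _ _] := ca.
have st : a.1 (pr a x - phi x *: t).
  by apply: subspaceB => //; [exact: pr_in1|exact: subspaceZ].
apply: pr_uniq => //=; first exact: shear_compl.
by rewrite prB // (pr_id ca st) subKr linearB /= (phi0 st) subr0.
Qed.

Lemma shear_pairs k : compl_pairs n k a -> compl_pairs n k (shear a phi t).
Proof.
move=> ak; have kn : (k <= n)%N.
  by have [/grassmannianP[sp1 <-] _ _] := ak; exact: dimv_le_n.
apply/compl_pairsP => //; split; first exact: shear_compl.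
by have [_ <-] := (compl_pairsP a kn).1 ak.
Qed.

(** By [pr_shear] the new projection is [pr a] minus the rank-one map v |-> phi(v) t, so what
    remains is commutation with that map. *)
Lemma comm_shear x : compl x.1 x.2 -> comm x a ->
  comm x (shear a phi t) <-> forall v, phi (pr x v) *: t = phi v *: pr x t.
Proof.
move=> cx xa; split=> [h v|h v]; last first.
  by rewrite !pr_shear prB // prZ // xa h.
have := h v; rewrite !pr_shear prB // prZ // xa.
by move/addrI/oppr_inj ->.
Qed.

Hypotheses (phiN0 : exists v, phi v != 0) (t0 : t != 0).

Lemma shear_normal : exists2 u, a.2 u & phi u = 1.
Proof.
have [s1 s2 _ _] := ca; have [v v0] := phiN0.
exists ((phi v)^-1 *: (v - pr a v)).
  by apply: subspaceZ => //; exact: pr_in2.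
by rewrite linearZ /= phi_pr mulVr //; exact: hR.
Qed.

Lemma shear_neq : shear a phi t <> a.
Proof.
move=> e; have [u u2 phiu] := shear_normal.
have : (shear a phi t).2 u by rewrite e.
by rewrite /= pr_0 // phiu scale1r => /esym/eqP; exact/negP.
Qed.

Lemma shear_not_comm : ~ comm a (shear a phi t).
Proof.
move=> h; apply: shear_neq; apply: pr_eq => //; first exact: shear_compl.
have [s1 s2 _ _] := ca; have cs := shear_compl.
move=> x; have := h x; rewrite (pr_id ca); last exact: (pr_in1 cs x).
by move=> ->; rewrite (pr_id cs) //; exact: (pr_in1 ca x).
Qed.

End Shear.

Lemma shear0 a (phi : {scalar V}) : compl a.1 a.2 -> shear a phi 0 = a.
Proof.
move=> ca; case: a ca => S U ca; congr pair; apply/seteqP; split=> x /=.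
  by rewrite scaler0 => /(pr_ker ca).
by rewrite scaler0 => /(pr_ker ca).
Qed.

(** Commutation makes [t] an eigenvector of [pr x]. Its eigenvalue is idempotent, hence 0 or 1 and
    central, and so passes through the scalar [c]. *)
Lemma comm_shear_scale a (phi : {scalar V}) (t : V) x c : compl a.1 a.2 ->
  (forall x, a.1 x -> phi x = 0) -> a.1 t -> (exists v, phi v != 0) -> t != 0 ->
  compl x.1 x.2 -> comm x a -> comm x (shear a phi t) ->
  comm x (shear a phi (c *: t)).
Proof.
move=> ca phi0 ta phiN0 t0 cx xa /(comm_shear ca phi0 ta cx xa) h.
have [s1 s2 _ _] := ca.
apply/(comm_shear ca phi0 (subspaceZ _ s1 ta) cx xa) => v.
have [u u2 phiu] := shear_normal ca phi0 phiN0.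
have := h u; rewrite phiu scale1r; set g := phi _ => gt.
have : g = 0 \/ g = 1.
  apply: idem01; apply: (@scaler_inj _ _ t) => //.
  by rewrite -scalerA gt -prZ // gt pr_idem.
have hv : phi (pr x v) = phi v * g.
  by apply: (@scaler_inj _ _ t) => //; rewrite h -gt scalerA.
rewrite hv (prZ cx) -gt !scalerA.
by case=> ->; rewrite ?(mulr0, mul0r, mulr1).
Qed.

(** Adjacency with a common first component: the second components are distinct and meet in the
    hyperplane of [a.2] cut out by [phi]. *)
Definition E1 a b : Prop :=
  exists (phi : {scalar V}) (t : V), [/\ exists v, phi v != 0, t != 0,
    forall x, a.1 x -> phi x = 0, a.1 t & b = shear a phi t].

Definition E2 a b : Prop := E1 (swap a) (swap b).

(* The double commutant of {a, b}. *)
Definition dcl k a b c : Prop := compl_pairs n k c /\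
  forall x, compl_pairs n k x -> cb k x a -> cb k x b -> cb k x c.

(* X and Y meet in a maximal one among the intersections of X with another base
   subset, which means that their frames differ in a single plane. *)
Definition neighbour k (a b : set V * set V) : Prop :=
  exists X Y, [/\ base_subset n k X, base_subset n k Y, X a, Y b & X <> Y /\
    forall Z, base_subset n k Z -> Z <> X -> X `&` Y `<=` Z -> X `&` Z `<=` Y].

(** All clauses speak of base subsets only, so [f] preserves them. The last one is an exchange
    property: any [c] in the double commutant that does not commute with [a] must, together with
    [a], recover [b]. *)
Definition adjrel k a b : Prop := [/\ neighbour k a b, ~ cb k a b &
  forall c, dcl k a b c -> ~ cb k a c -> dcl k a c b].

(** Take [A] separating [m] from [m'] but not [i] from [j]: commutation with [pt b A] kills the
    matrix entry of [pr y] from [m] to [m']. Off the diagonal only the two entries between [i] and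
    [j] survive. *)
Lemma commuting_coord k (b : 'I_n -> V) (i j : 'I_n) y :
  (0 < k < n)%N -> n <> (2 * k)%N ->
  is_basis setT b -> i != j -> compl y.1 y.2 ->
  (forall A : {set 'I_n}, #|A| = k -> (i \in A) = (j \in A) -> comm (pt b A) y) ->
  forall m m', m != m' -> [set m; m']%SET != [set i; j]%SET ->
    co b m' (pr y (b m)) = 0.
Proof.
move=> kn n2k bb ij cy h m m' mm' mij.
have [A [Ak iA mA]] := separating_subset kn n2k ij mm' mij.
have c := h A Ak iA (b m); have cp := compl_pt bb A.
have [mIA|mNA] := boolP (m \in A).
  have : pr (pt b A) (pr y (b m)) = pr y (b m).
    by rewrite c (pr_id (p := pt b A) cp) //; apply/sp_b.
  move/(pr_fix (p := pt b A) cp)/(_ m'); apply.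
  by rewrite -mA.
have : pr (pt b A) (pr y (b m)) = 0.
  rewrite c (pr_0 (p := pt b A) cp); last by apply/(sp_b bb); rewrite inE.
  by apply: pr_id => //; apply: subspace0; case: cy.
move/(pr_ker (p := pt b A) cp)/(_ m'); apply.
by rewrite inE negbK -[_ \in _]negbK -mA.
Qed.

Section AdaptedBasis.
Variables (a : set V * set V) (phi : {scalar V}) (t u : V) (k : nat).
Hypotheses (kn : (0 < k < n)%N) (ak : compl_pairs n k a).
Hypotheses (phi0 : forall x, a.1 x -> phi x = 0) (ta : a.1 t).
Hypotheses (ua : a.2 u) (phiu : phi u = 1).

Let k_le_n : (k <= n)%N. Proof. by case/andP: kn => _ /ltnW. Qed.
Let ca : compl a.1 a.2. Proof. by case/(compl_pairsP _ k_le_n): ak. Qed.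
Let sa1 : is_subspace a.1. Proof. by case: ca. Qed.
Let sa2 : is_subspace a.2. Proof. by case: ca. Qed.
Let M : set V := a.2 `&` [set x | phi x = 0].

Lemma subspace_ker : is_subspace M.
Proof.
apply: subspaceI => //; apply/subspaceP; split; first exact: linear0.
by move=> c x y /= x0 y0; rewrite linearP x0 y0 mulr0 addr0.
Qed.

Lemma ker_sum : M :+: lc [:: u] = a.2.
Proof.
apply/seteqP; split.
  by apply: sums_sub => //; [exact: subIsetl|apply: lc_sub => // x; rewrite inE => /eqP->].
move=> x x2; rewrite -(subrK (phi x *: u) x); apply: sums_intro; last by apply/lc1P; eexists.
split; first by apply: subspaceB => //; exact: subspaceZ.
by rewrite /= linearB linearZ /= phiu mulr1 subrr.
Qed.

Lemma dimv_ker : (dimv M).+1 = (n - k)%N.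
Proof.
have [_ d1] := (compl_pairsP a k_le_n).1 ak.
have nMu : ~ M u by case=> _ /=; rewrite phiu => /eqP; rewrite oner_eq0.
have := compl_dim ca; rewrite d1 -ker_sum dimv_cons //; last exact: subspace_ker.
by move=> <-; rewrite addKn.
Qed.

(** Positions 0 and 1 carry [t] and [u]; then come completions of [t :: s] to a basis of [a.1] and
    of [m] to one of [M]. The lists [s] and [m] allow any chosen vector to be made a frame vector,
    on which projections can be controlled. *)
Lemma adapted_basis (s m : seq V) : free (t :: s) -> lc s `<=` a.1 -> free m -> lc m `<=` M ->
  exists (b : 'I_n -> V) (i j : 'I_n), [/\ is_basis setT b, i != j,
    b i = t, b j = u & [/\ forall l, a.1 (b l) \/ a.2 (b l),
      forall l, l != j -> phi (b l) = 0 &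
      forall x, x \in s ++ m -> exists l, [/\ l != i, l != j & b l = x]]].
Proof.
move=> fs sS fm mM; have [_ d1] := (compl_pairsP a k_le_n).1 ak.
have ts : lc (t :: s) `<=` a.1.
  by apply: lc_sub => // x; rewrite inE => /orP[/eqP->//|/lc_mem]; exact: sS.
have [s' fs' s'E] := free_extend sa1 fs ts.
have [m' fm' m'E] := free_extend subspace_ker fm mM.
pose r := s' ++ s ++ m' ++ m; pose L := t :: u :: r.
have LT : lc L = setT.
  have [_ _ _ cT] := ca; apply/seteqP; split=> //; rewrite -cT -ker_sum -s'E -m'E.
  apply: sums_sub => //; last apply: sums_sub => //; apply: lc_subset => x;
    rewrite !inE !mem_cat ?inE.
  - by move=> /or3P[] ->; rewrite ?orbT.
  - by move=> /orP[] ->; rewrite ?orbT.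
  - by move=> ->; rewrite orbT.
have sz : size L = n.
  have := dimv_ker; rewrite -m'E (dimv_lc fm') -d1 -s'E (dimv_lc fs') /L /r /= !size_cat /=.
  by have := kn; rewrite -d1 -s'E (dimv_lc fs') size_cat /=; lia.
have bb := basis_seq sz LT; set b := fun i => _ in bb.
have n2 : (1 < n)%N by rewrite -sz.
have LSU x : x \in L -> a.1 x \/ a.2 x.
  rewrite !inE !mem_cat => /or4P[/eqP->|/eqP->|xs'|]; [by left|by right| |].
    by left; rewrite -s'E lc_cat; apply: sums_subl => //; exact: lc_mem.
  move=> /or3P[xs|xm|xm]; first by left; exact/sS/lc_mem.
    by right; suff [] : M x by []; rewrite -m'E; apply: lc_mem; rewrite mem_cat xm.
  by right; suff [] : M x by []; rewrite -m'E; apply: lc_mem; rewrite mem_cat xm orbT.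
have rphi x : x \in r -> phi x = 0.
  rewrite !mem_cat => /or4P[xs'|xs|xm|xm].
  - by apply: phi0; rewrite -s'E; apply: lc_mem; rewrite mem_cat xs'.
  - by apply/phi0/sS/lc_mem.
  - by suff [] : M x by []; rewrite -m'E; apply: lc_mem; rewrite mem_cat xm.
  - by suff [] : M x by []; rewrite -m'E; apply: lc_mem; rewrite mem_cat xm orbT.
exists b, (Ordinal (ltnW n2)), (Ordinal n2); split=> //; split.
- by move=> l; apply: LSU; apply: mem_nth; rewrite sz.
- case=> [[|[|l]]] lt //= _; first exact: phi0.
  by apply: rphi; apply: mem_nth; move: (lt); rewrite -[X in (_ < X)%N]sz.
move=> x xsm; have xr : x \in r.
  by move: xsm; rewrite !mem_cat => /orP[] ->; rewrite ?orbT.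
have ln : ((index x r).+2 < n)%N by rewrite -sz /= !ltnS index_mem.
exists (Ordinal ln); split=> //; by rewrite /b /= nth_index.
Qed.

End AdaptedBasis.
Lemma pr_eigen p x c : compl p.1 p.2 -> x != 0 -> pr p x = c *: x ->
  c = 0 \/ c = 1.
Proof.
move=> cp x0 xE; apply: idem01; apply: (scaler_inj x0).
by have := pr_idem cp x; rewrite xE prZ // xE scalerA.
Qed.

(** * The double commutant of a pair and one of its shears *)

Section Pencil.
Variables (a : set V * set V) (phi : {scalar V}) (t : V) (k : nat).
Hypotheses (kn : (0 < k < n)%N) (n2k : n <> (2 * k)%N) (n3 : (2 < n)%N).
Hypothesis ak : compl_pairs n k a.
Hypotheses (phi0 : forall x, a.1 x -> phi x = 0) (ta : a.1 t) (t0 : t != 0).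
Hypothesis phiN0 : exists v, phi v != 0.

Let k_le_n : (k <= n)%N. Proof. by case/andP: kn => _ /ltnW. Qed.
Let ca : compl a.1 a.2. Proof. by case/(compl_pairsP _ k_le_n): ak. Qed.
Let da : dimv a.1 = k. Proof. by case/(compl_pairsP _ k_le_n): ak. Qed.
Let sa1 : is_subspace a.1. Proof. by case: ca. Qed.
Let sa2 : is_subspace a.2. Proof. by case: ca. Qed.

(** The shear replaces [b j] by [b j + t] and fixes the other frame vectors, so both pairs have the
    same index set in frames that differ by an elementary change. *)
Lemma adapted_pt (b : 'I_n -> V) (i j : 'I_n) : is_basis setT b -> i != j ->
  b i = t -> phi (b j) = 1 -> (forall l, a.1 (b l) \/ a.2 (b l)) ->
  (forall l, l != j -> phi (b l) = 0) ->
  exists A0 : {set 'I_n}, [/\ #|A0| = k, i \in A0, j \notin A0, a = pt b A0 &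
    shear a phi t = pt (elem_basis b i j 1) A0].
Proof.
move=> bb ij bi bj bSU bphi.
pose A0 := [set l | `[< a.1 (b l) >]]%SET.
have b1 l : l \in A0 -> a.1 (b l) by rewrite inE => /asboolP.
have b2 l : l \notin A0 -> a.2 (b l) by rewrite inE => /asboolP; case: (bSU l).
have jA : j \notin A0.
  apply/negP => /b1 /phi0; rewrite bj => /eqP; by rewrite oner_eq0.
have iA : i \in A0 by rewrite inE bi; exact/asboolP.
have aE : pt b A0 = a.
  apply: compl_sub_eq => //; first exact: (compl_pt bb).
    by apply: (sp_sub bb).
  by apply: (sp_sub bb) => // l; rewrite inE => /b2.
exists A0; split=> //; first by rewrite -(dimv_sp bb) -da -aE.
apply/esym; have eb := elem_basisP 1 bb ij.
have [s1 s2 _ _] := shear_compl ca phi0 ta.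
apply: compl_sub_eq; [exact: (compl_pt eb)|exact: shear_compl| |].
  apply: (sp_sub eb) => // l lA; rewrite /elem_basis; case: eqP => [lj|_].
    by rewrite lj (negPf jA) in lA.
  exact: b1.
apply: (sp_sub eb) => // l; rewrite inE => lA; rewrite /elem_basis /=.
case: eqP => [lj|/eqP lj].
  rewrite prD // scale1r bi (pr_id ca ta) (pr_0 ca) ?add0r; last exact: b2.
  by rewrite linearD /= bj (phi0 ta) addr0 scale1r.
by rewrite (pr_0 ca (b2 _ lA)) bphi // scale0r.
Qed.

Variable y : set V * set V.
Hypothesis ydcl : dcl k a (shear a phi t) y.

Let yk : compl_pairs n k y. Proof. by case: ydcl. Qed.
Let cy : compl y.1 y.2. Proof. by case/(compl_pairsP _ k_le_n): yk. Qed.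
Let dy : dimv y.1 = k. Proof. by case/(compl_pairsP _ k_le_n): yk. Qed.

(** Coordinate pairs that do not separate [i] from [j] belong to both frames of [adapted_pt], hence
    commute with [a] and its shear, and therefore with [y]. *)
Lemma dcl_coord (b : 'I_n -> V) (i j : 'I_n) : is_basis setT b -> i != j ->
  b i = t -> phi (b j) = 1 -> (forall l, a.1 (b l) \/ a.2 (b l)) ->
  (forall l, l != j -> phi (b l) = 0) ->
  forall m m', m != m' -> [set m; m']%SET != [set i; j]%SET ->
    co b m' (pr y (b m)) = 0.
Proof.
move=> bb ij bi bj bSU bphi.
have [A0 [A0k iA jA aE bE]] := adapted_pt bb ij bi bj bSU bphi.
apply: (commuting_coord kn n2k bb ij cy) => A Ak ijA.
apply/(cbP (pt_compl_pairs bb Ak) yk).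
have eb := elem_basisP 1 bb ij.
case: ydcl => _; apply; first exact: pt_compl_pairs.
  exists (base_subset_of n k (range b)); split; first by exists b.
    by apply/(base_subset_ofP bb); exists A.
  by apply/(base_subset_ofP bb); exists A0.
exists (base_subset_of n k (range (elem_basis b i j 1))); split.
- by exists (elem_basis b i j 1).
- by apply/(base_subset_ofP eb); exists A => //; rewrite (pt_elem _ bb ij).
- by apply/(base_subset_ofP eb); exists A0.
Qed.

(** A frame vector other than [t] and [u] has no partner index for an off-diagonal entry, so it is
    an eigenvector of [pr y]. *)
Lemma dcl_line u s m x : a.2 u -> phi u = 1 -> free (t :: s) -> lc s `<=` a.1 ->
  free m -> lc m `<=` a.2 `&` [set x | phi x = 0] -> x \in s ++ m ->
  exists2 c, c = 0 \/ c = 1 & pr y x = c *: x.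
Proof.
move=> u2 phiu fs sS fm mM xsm.
have [b [i [j [bb ij bi bj [bSU bphi bx]]]]] :=
  adapted_basis kn ak phi0 ta u2 phiu fs sS fm mM.
have [l [li lj bl]] := bx _ xsm.
have phib : phi (b j) = 1 by rewrite bj.
have h := dcl_coord bb ij bi phib bSU bphi.
have prx : pr y x = co b l (pr y x) *: x.
  rewrite -{3}bl; apply: (line_coord bb) => j' jl; rewrite -bl; apply: h.
    by rewrite eq_sym.
  apply/negP => /eqP/setP/(_ l); rewrite !inE eqxx (negPf li) (negPf lj).
  by [].
exists (co b l (pr y x)) => //; apply: pr_eigen prx => //.
by rewrite -bl; apply/eqP/(basis_neq0 bb).
Qed.

Lemma dcl_plane u z : a.2 u -> phi u = 1 -> z = t \/ z = u ->
  exists c d, pr y z = c *: t + d *: u.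
Proof.
move=> u2 phiu zE.
have ft : free [:: t] by split=> // /eqP; exact/negP.
have s0 : lc [::] `<=` a.1 by move=> _ ->; exact: subspace0.
have m0 : lc [::] `<=` a.2 `&` [set x | phi x = 0].
  by move=> _ ->; split; [exact: subspace0|exact: linear0].
have [b [i [j [bb ij bi bj [bSU bphi _]]]]] :=
  adapted_basis kn ak phi0 ta u2 phiu ft s0 (I : free [::]) m0.
have phib : phi (b j) = 1 by rewrite bj.
have h := dcl_coord bb ij bi phib bSU bphi.
have [z' [z'ij zE']] : exists l, (l == i) || (l == j) /\ b l = z.
  by case: zE => ->; [exists i|exists j]; rewrite ?eqxx ?orbT.
exists (co b i (pr y z)), (co b j (pr y z)).
rewrite {1}[pr y z](co_sum bb) (bigD1 i) //= (bigD1 j) 1?eq_sym //=.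
rewrite bi bj big1 ?addr0 // => l /andP[li lj]; rewrite -zE' h ?scale0r //.
  by case/orP: z'ij => /eqP->; rewrite eq_sym.
apply/negP => /eqP/setP/(_ l).
by rewrite !inE eqxx (negPf li) (negPf lj) orbT.
Qed.

Lemma dcl_vec (u s : V) : a.2 u -> phi u = 1 -> a.1 s -> ~ lc [:: t] s ->
  exists2 c, c = 0 \/ c = 1 & pr y s = c *: s.
Proof.
move=> u2 phiu sS st.
have fs : free [:: t; s].
  split; last by split=> // s0; apply: st; rewrite s0; exact: subspace0.
  case/lc1P=> e te; apply: st; apply/lc1P; exists e^-1.
  have e0 : e != 0 by apply: contraNneq t0 => e0; rewrite te e0 scale0r.
  by rewrite te scalerA mulVr ?scale1r //; exact: hR.
have sS' : lc [:: s] `<=` a.1 by apply: lc_sub => // x; rewrite inE => /eqP->.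
have m0 : lc [::] `<=` a.2 `&` [set x | phi x = 0].
  by move=> _ ->; split; [exact: subspace0|exact: linear0].
exact: (dcl_line u2 phiu fs sS' (I : free [::]) m0 (mem_head _ _)).
Qed.

Lemma notin_line_addr (s : V) : ~ lc [:: t] s -> ~ lc [:: t] (s + t).
Proof.
move=> st h; apply: st; rewrite -(addrK t s).
by apply: subspaceB => //; apply: lc_mem; rewrite inE.
Qed.

(** A priori [pr y t] also has a component along [u]. It is removed by varying the adapted frame,
    and [n >= 3] leaves room for that. *)
Lemma pencil_axis u : a.2 u -> phi u = 1 ->
  exists2 d, d = 0 \/ d = 1 & pr y t = d *: t.
Proof.
move=> u2 phiu.
suff [d tE] : exists d, pr y t = d *: t.
  by exists d => //; apply: pr_eigen tE.
have [c [d tE]] := dcl_plane u2 phiu (or_introl erefl).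
exists c; suff d0 : d = 0 by rewrite tE d0 scale0r addr0.
have phit := phi0 ta.
have prau : pr a u = 0 by exact: pr_0.
have prat : pr a t = t by exact: pr_id.
(* If [a.2] is the line of [u], then [k >= 2]: some [s] of [a.1] is off the line of [t], both [s]
   and [s + t] are eigenvectors, and their difference shows that [phi] kills [pr y t]. *)
have [dM|dM] := posnP (dimv (a.2 `&` [set x | phi x = 0])).
  have k2 : (1 < k)%N by have := dimv_ker kn ak u2 phiu; lia.
  have [s sS st] : exists2 s, a.1 s & ~ lc [:: t] s.
    apply: contrapT => h; have : a.1 `<=` lc [:: t].
      by move=> x x1; apply: contrapT => nx; apply: h; exists x.
    move/(dimv_le sa1 (subspace_lc _)); rewrite da.
    rewrite dimv_lc /=; first by lia.
    by split=> // /eqP; exact/negP.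
  have [c1 _ e1] := dcl_vec u2 phiu sS st.
  have [c2 _ e2] := dcl_vec u2 phiu (subspaceD sa1 sS ta) (notin_line_addr st).
  have : phi (pr y t) = 0.
    rewrite -[t in pr y t](addKr s) prD // prN // e2 e1.
    by rewrite linearD linearN !linearZ linearD /= (phi0 sS) phit !addr0 !mulr0 oppr0 addr0.
  by rewrite tE linearD !linearZ /= phit phiu mulr0 add0r mulr1.
have sM := subspace_ker phi kn ak.
have [m [m2 phim] m0] : exists2 m, (a.2 `&` [set x | phi x = 0]) m & m != 0.
  apply: contrapT => h; move: dM; suff -> : a.2 `&` [set x | phi x = 0] = lc [::].
    by rewrite dimv_lc.
  apply/seteqP; split=> [x Mx|_ ->]; last exact: subspace0.
  by apply: contrapT => x0; apply: h; exists x => //; apply/eqP.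
(* Both [u] and [u + m] may serve as normal vector; comparing the two expressions for [pr y t]
   leaves [d *: m = 0]. *)
have um2 : a.2 (u + m) by exact: subspaceD.
have phium : phi (u + m) = 1 by rewrite linearD /= phiu phim addr0.
have [c' [d' tE']] := dcl_plane um2 phium (or_introl erefl).
have dd : d = d'.
  have := congr1 phi tE; rewrite tE' !linearD !linearZ /= !linearD /= phit phiu phim.
  by rewrite !mulr0 !add0r addr0 !mulr1.
have cc : c *: t = c' *: t.
  have := congr1 (pr a) tE; rewrite tE' !prD // !prZ // prD // prau prat (pr_0 ca m2).
  by rewrite addr0 !scaler0 !addr0.
move: tE'; rewrite tE cc -dd => /addrI; rewrite scalerDr.
move=> /esym/eqP; rewrite -subr_eq0 addrC addKr => /eqP.
by move/scaler_eq0_div; exact.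
Qed.

(** The projection [pr y] is a scalar [d] on [a.1], a scalar [e] on the kernel of [phi] in [a.2],
    and sends [u] to [al *: t + e *: u]. As [d] and [e] are 0 or 1, four cases remain; only [d = 1],
    [e = 0] has the right dimension. *)
Lemma pencil : exists c, y = shear a phi (c *: t).
Proof.
have [u u2 phiu] := shear_normal ca phi0 phiN0.
have [d d01 tE] := pencil_axis u2 phiu.
have phit := phi0 ta.
have prau : pr a u = 0 by exact: pr_0.
have dC c : c * d = d * c by case: d01 => ->; rewrite ?(mulr0, mul0r, mulr1, mul1r).
(* For [s] off the line of [t], the vectors [s], [t] and [s + t] are all eigenvectors, which forces
   a common eigenvalue. *)
have sE (s : V) : a.1 s -> pr y s = d *: s.
  move=> sS; have [/lc1P[e ->]|st] := pselect (lc [:: t] s).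
    by rewrite prZ // tE !scalerA dC.
  have [c1 _ e1] := dcl_vec u2 phiu sS st.
  have [c2 _ e2] := dcl_vec u2 phiu (subspaceD sa1 sS ta) (notin_line_addr st).
  have : (c1 - c2) *: s = (c2 - d) *: t.
    move: e2; rewrite prD // e1 tE scalerDr !scalerBl => e2.
    by apply/eqP; rewrite subr_eq addrAC eq_sym subr_eq e2 addrC.
  have [c12|c12] := eqVneq (c1 - c2) 0.
    rewrite c12 scale0r => /esym/scaler_eq0_div/(_ t0)/eqP.
    rewrite subr_eq0 => /eqP <-; move/eqP: c12; rewrite subr_eq0 => /eqP <- //.
  move=> cst; case: st; apply: (scaleI (subspace_lc [:: t]) c12).
  by rewrite cst; apply/lc1P; eexists.
have [al [e uE]] := dcl_plane u2 phiu (or_intror erefl).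
have phiE : phi (pr y u) = e.
  by rewrite uE linearD !linearZ /= phit phiu mulr0 add0r mulr1.
have e01 : e = 0 \/ e = 1.
  apply: idem01; rewrite -{3}phiE -(pr_idem cy) uE prD // !prZ // tE uE.
  rewrite linearD !linearZ /= linearD !linearZ /= phit phiu.
  by rewrite !mulr0 !add0r mulr1.
(* [u + m] is another admissible normal vector, so its image again has the form of [dcl_plane]; this
   forces the eigenvalue [e] on [m]. *)
have mE m : a.2 m -> phi m = 0 -> pr y m = e *: m.
  move=> m2 phim; have [->|m0] := eqVneq m 0.
    by rewrite scaler0 -(scale0r 0) prZ // !scale0r.
  have um2 : a.2 (u + m) by exact: subspaceD.
  have phium : phi (u + m) = 1 by rewrite linearD /= phiu phim addr0.
  have [al' [e' uE']] := dcl_plane um2 phium (or_intror erefl).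
  have ft : free [:: t] by split=> // /eqP; exact/negP.
  have s0 : lc [::] `<=` a.1 by move=> _ ->; exact: subspace0.
  have fm : free [:: m] by split=> // /eqP; exact/negP.
  have mM : lc [:: m] `<=` a.2 `&` [set x | phi x = 0].
    by apply: lc_sub; [exact: (subspace_ker phi kn ak)|move=> x; rewrite inE => /eqP->].
  have [c _ mc] := dcl_line u2 phiu ft s0 fm mM (mem_head _ _).
  move: uE'; rewrite prD // uE mc => e1.
  have ee : e = e'.
    move: (congr1 phi e1); rewrite !linearD !linearZ /= !linearD /= phit phiu phim.
    by rewrite !mulr0 !add0r !addr0 !mulr1.
  have aa : al *: t = al' *: t.
    move: (congr1 (pr a) e1); rewrite !prD // !prZ // prD //.
    by rewrite prau (pr_id ca ta) (pr_0 ca m2) addr0 !scaler0 !addr0.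
  by move: e1; rewrite aa -ee -addrA scalerDr => /addrI/addrI ->.
have yE x : pr y x = d *: pr a x + (phi x * al) *: t + e *: (x - pr a x).
  have x2 : a.2 (x - pr a x) by exact: pr_in2.
  have w2 : a.2 (x - pr a x - phi x *: u).
    by apply: subspaceB => //; exact: subspaceZ.
  have wphi : phi (x - pr a x - phi x *: u) = 0.
    by rewrite linearB linearZ /= phi_pr // phiu mulr1 subrr.
  have := mE _ w2 wphi; rewrite prB // prZ // prB // (sE _ (pr_in1 ca x)) uE.
  rewrite [e *: (_ - _ *: u)]scalerBr => /eqP; rewrite subr_eq subr_eq => /eqP ->.
  rewrite (scalerDr (phi x)) !scalerA (_ : phi x * e = e * phi x); last first.
    by case: e01 => ->; rewrite ?(mulr0, mul0r, mulr1, mul1r).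
  rewrite [(_ * _ *: t) + _]addrC addrA subrK.
  by rewrite [LHS]addrC [in LHS](addrC (e *: _)) addrA.
have [sy1 sy2 _ _] := cy.
have sct c : a.1 (c *: t) by exact: subspaceZ.
case: d01 => dE; case: e01 => eE.
(* Case [d = e = 0]: the map squares to zero and is idempotent, hence vanishes, against [k > 0]. *)
- have y0 x : pr y x = (phi x * al) *: t by rewrite yE dE eE !scale0r add0r addr0.
  have yt : al *: t = 0.
    have := y0 u; rewrite phiu mul1r => yu.
    by rewrite -yu -(pr_idem cy) yu y0 (phi0 (sct al)) mul0r scale0r.
  suff y10 : y.1 = lc [::].
    by move: dy kn; rewrite y10 dimv_lc //= => <-.
  apply/seteqP; split=> [x /(pr_id cy) <- /=|_ ->]; last exact: subspace0.
  by rewrite y0 -scalerA yt scaler0.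
(* Case [d = 0], [e = 1]: the complementary pair is a shear of [a], so [y.2] has dimension [k] and
   [n = 2 * k]. *)
- have yE' : swap y = shear a phi (al *: t).
    apply: pr_eq; [exact: complC|exact: shear_compl|].
    move=> x; rewrite pr_swap // pr_shear // yE dE eE scale0r add0r scale1r -scalerA.
    by rewrite opprD opprB addrCA (addrC x) subrK addrC.
  have : dimv y.2 = k by rewrite -da -[y.2]/((swap y).1) yE'.
  by have := compl_dim cy; rewrite dy; lia.
- exists (- al); apply: pr_eq => //; first exact: shear_compl.
  move=> x; rewrite pr_shear // yE dE eE scale1r scale0r addr0.
  by rewrite scaleNr scalerN opprK -scalerA.
(* Case [d = e = 1]: the second component is zero, against [k < n]. *)
suff y20 : y.2 = lc [::].
  by have := compl_dim cy; move: kn; rewrite y20 dimv_lc // dy /=; lia.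
apply/seteqP; split=> [x x2|_ ->]; last exact: subspace0.
have := pr_0 cy x2; rewrite yE dE eE !scale1r addrAC [pr a x + _]addrC subrK.
move=> xE; have x1 : a.1 x.
  by move/eqP: xE; rewrite addr_eq0 => /eqP->; rewrite -scalerN; apply: subspaceZ => //; exact: subspaceN.
by move: xE; rewrite (phi0 x1) mul0r scale0r addr0.
Qed.

End Pencil.
Implicit Types (p q : set V * set V) (X : set (set V * set V)).

Lemma compl_pairs_le k p : compl_pairs n k p -> (k <= n)%N.
Proof. by case=> /grassmannianP[sp1 <-] _ _; exact: dimv_le_n. Qed.

Lemma compl_pairs_compl k p : compl_pairs n k p -> compl p.1 p.2.
Proof. by move=> pk; case/(compl_pairsP p (compl_pairs_le pk)): (pk). Qed.

Lemma compl_pairs_dim k p : compl_pairs n k p -> dimv p.1 = k.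
Proof. by move=> pk; case/(compl_pairsP p (compl_pairs_le pk)): (pk). Qed.

Lemma cb_refl k p : compl_pairs n k p -> cb k p p.
Proof. by move=> pk; apply/(cbP pk pk). Qed.

Lemma compl_pairs_swap k p : compl_pairs n k p -> compl_pairs n (n - k) (swap p).
Proof.
move=> pk; have kn := compl_pairs_le pk; have cp := compl_pairs_compl pk.
apply/compl_pairsP; first exact: leq_subr.
split; first exact: complC.
by have := compl_dim cp; rewrite (compl_pairs_dim pk) /= => <-; rewrite addKn.
Qed.

Lemma base_subset_swap k X : (k <= n)%N ->
  base_subset n k X -> base_subset n (n - k) (swap @` X).
Proof.
move=> kn [b bb ->]; exists b => //; apply/seteqP; split.
  by move=> _ [p [pk p1 p2] <-]; split=> //; exact: compl_pairs_swap.
move=> p [pk p1 p2]; exists (swap p); last exact: swapK.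
by split=> //; rewrite -[k](subKn kn); exact: compl_pairs_swap.
Qed.

Lemma swap_imageK X : swap @` (swap @` X) = X.
Proof.
apply/seteqP; split; first by move=> _ [_ [p Xp <-] <-]; rewrite swapK.
by move=> p Xp; exists (swap p); [exists p|rewrite swapK].
Qed.

Lemma image_swapE X p : (swap @` X) p <-> X (swap p).
Proof.
split=> [[q Xq <-]|Xp]; first by rewrite swapK.
by exists (swap p) => //; rewrite swapK.
Qed.

Lemma cb_swap k p q : (k <= n)%N -> cb k p q -> cb (n - k) (swap p) (swap q).
Proof.
move=> kn [X [bX Xp Xq]]; exists (swap @` X).
by split; [exact: base_subset_swap|exists p|exists q].
Qed.

Lemma cb_swapP k p q : (k <= n)%N -> cb k p q <-> cb (n - k) (swap p) (swap q).
Proof.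
move=> kn; split; first exact: cb_swap.
by move/(cb_swap (leq_subr k n)); rewrite subKn // !swapK.
Qed.

Lemma dcl_swap k a b c : (k <= n)%N ->
  dcl k a b c -> dcl (n - k) (swap a) (swap b) (swap c).
Proof.
move=> kn [ck h]; split; first exact: compl_pairs_swap.
move=> x xk xa xb; rewrite -[x]swapK; apply: (cb_swap kn).
apply: h; first by rewrite -[k](subKn kn); exact: compl_pairs_swap.
  by apply/(cb_swapP _ _ kn); rewrite swapK.
by apply/(cb_swapP _ _ kn); rewrite swapK.
Qed.

Lemma adjrel_swap k a b : (k <= n)%N ->
  adjrel k a b -> adjrel (n - k) (swap a) (swap b).
Proof.
move=> kn [[X [Y [bX bY Xa Yb [XY h]]]] ab dab]; split.
- exists (swap @` X), (swap @` Y).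
  split; [exact: base_subset_swap..|by exists a|by exists b|].
  split=> [e|Z bZ ZX XYZ p [Xp Zp]].
    by apply: XY; rewrite -[X]swap_imageK e swap_imageK.
  apply/image_swapE; apply: (h (swap @` Z)).
  - by rewrite -[k](subKn kn); apply: base_subset_swap => //; exact: leq_subr.
  - by move=> e; apply: ZX; rewrite -e swap_imageK.
  - move=> q [Xq Yq]; apply/image_swapE; apply: XYZ.
    by split; apply/image_swapE; rewrite swapK.
  split; first exact/image_swapE.
  by apply/image_swapE; rewrite swapK.
- by move/(cb_swapP _ _ kn).
move=> c dc ac; rewrite -[c]swapK; apply: dcl_swap => //; apply: dab.
  by rewrite -[k](subKn kn) -[a]swapK -[b]swapK; apply: dcl_swap => //; exact: leq_subr.
by move/(cb_swapP _ _ kn); rewrite swapK.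
Qed.

(** * Adjacency in terms of base subsets *)

Section Adjacency.
Variable (k : nat).
Hypotheses (kn : (0 < k < n)%N) (n2k : n <> (2 * k)%N) (n3 : (2 < n)%N).

Lemma E1_adjrel (a b : set V * set V) : compl_pairs n k a -> E1 a b -> adjrel k a b.
Proof.
move=> ak [phi [t [phiN0 t0 phi0 ta ->]]].
have ca := compl_pairs_compl ak; have [sa1 sa2 _ _] := ca.
have bk := shear_pairs ca phi0 ta ak.
split.
- have [u u2 phiu] := shear_normal ca phi0 phiN0.
  have ft : free [:: t] by split=> // /eqP; exact/negP.
  have s0 : lc [::] `<=` a.1 by move=> _ ->; exact: subspace0.
  have m0 : lc [::] `<=` a.2 `&` [set x | phi x = 0].
    by move=> _ ->; split; [exact: subspace0|exact: linear0].
  have [b' [i [j [bb ij bi bj [bSU bphi _]]]]] :=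
    adapted_basis kn ak phi0 ta u2 phiu ft s0 (I : free [::]) m0.
  have phib : phi (b' j) = 1 by rewrite bj.
  have [A0 [A0k iA jA aE bE]] := adapted_pt kn ak phi0 ta bb ij bi phib bSU bphi.
  have eb := elem_basisP 1 bb ij.
  exists (base_subset_of n k (range b')).
  exists (base_subset_of n k (range (elem_basis b' i j 1))).
  split; [by exists b'|by exists (elem_basis b' i j 1)| | |].
  + by apply/(base_subset_ofP bb); exists A0.
  + by apply/(base_subset_ofP eb); exists A0.
  split; first by apply: elem_basis_neq => //; exact: oner_neq0.
  move=> _ [c cc ->] ZX XYZ.
  have [i' [j' [ij' h]]] := unseparated_pair bb cc (nesym ZX).
  (* Otherwise some [A] separates [i'] from [j'] but not [i] from [j]; then [pt b' A] is common to
     the two adapted frames, hence lies in the third base subset, which contradicts the choice of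
     [i'] and [j']. *)
  have ijE : [set i'; j']%SET = [set i; j]%SET.
    apply/eqP/negPn/negP => nij.
    have [A [Ak iA' jA']] := separating_subset kn n2k ij ij' nij.
    have : (i' \in A) = (j' \in A).
      apply: h => //; apply: XYZ; split.
        by apply/(base_subset_ofP bb); exists A.
      by apply/(base_subset_ofP eb); exists A => //; rewrite (pt_elem _ bb ij).
    by rewrite jA'; case: (j' \in A).
  move=> p [/(base_subset_ofP bb)[A Ak ->] cA].
  apply/(base_subset_ofP eb); exists A => //; rewrite (pt_elem _ bb ij) //.
  have ijA := h A Ak cA.
  have /setP ijE' := ijE.
  have := ijE' i; have := ijE' j; rewrite !inE !eqxx orbT /=.
  by case/orP=> /eqP->; case/orP=> /eqP->.
- by move/(cbP ak bk); exact: shear_not_comm.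
move=> c dc ac; have [l cE] := pencil kn n2k n3 ak phi0 ta t0 phiN0 dc.
have l0 : l != 0.
  apply: contra_notN ac => /eqP l0; rewrite cE l0 scale0r shear0 //; exact: cb_refl.
split=> // x xk xa xc.
have cx := compl_pairs_compl xk.
apply/(cbP xk bk).
(* [c] is the shear by [l *: t] with [l] nonzero; rescaling by [l^-1] leads back to the shear by
   [t]. *)
have -> : t = l^-1 *: (l *: t) by rewrite scalerA mulVr ?scale1r //; exact: hR.
apply: comm_shear_scale => //.
- exact: subspaceZ.
- by apply/eqP => lt; case/eqP: l0; exact: scaler_eq0_div lt t0.
- exact/(cbP xk ak).
by rewrite -cE; apply/(cbP xk _) => //; case: dc.
Qed.

(* The shear [c] below has projection e + e b (1 - e), with e and b the projections
   of the two pairs, so it commutes with whatever commutes with both; being in a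
   pencil with [a], it forces [b] into that pencil. *)
Lemma adjrel_E1 (a b : set V * set V) x : compl_pairs n k a -> compl_pairs n k b -> adjrel k a b ->
  pr a (pr b (x - pr a x)) != 0 -> E1 a b.
Proof.
move=> ak bk [[_ [_ [[b1 bb1 ->] [b2 bb2 ->] Xa Yb [XY hXY]]]] ab dab] x0.
have ca := compl_pairs_compl ak; have cb' := compl_pairs_compl bk.
have [sa1 sa2 _ _] := ca.
have [i0 [j0 [ij0 hij0]]] := unseparated_pair bb1 bb2 XY.
(* Maximality is applied to an elementary change of [b1] in the plane of the unseparated indices.
   Its base subset contains everything common to [b1] and [b2], so all that it shares with [b1]
   belongs to [b2] as well. *)
have hY (A : {set 'I_n}) : #|A| = k -> (i0 \in A) = (j0 \in A) ->
    base_subset_of n k (range b2) (pt b1 A).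
  move=> Ak ijA; have eb := elem_basisP 1 bb1 ij0.
  apply: (hXY (base_subset_of n k (range (elem_basis b1 i0 j0 1)))).
  - by exists (elem_basis b1 i0 j0 1).
  - by apply/nesym/elem_basis_neq => //; exact: oner_neq0.
  - move=> p [/(base_subset_ofP bb1)[B Bk ->] pY].
    apply/(base_subset_ofP eb); exists B => //.
    by rewrite (pt_elem _ bb1 ij0) //; exact: hij0.
  split; apply/base_subset_ofP => //; exists A => //.
  by rewrite (pt_elem _ bb1 ij0).
have [A0 A0k aE] := (base_subset_ofP bb1 k a).1 Xa.
have hc (A : {set 'I_n}) : #|A| = k -> (i0 \in A) = (j0 \in A) -> comm (pt b1 A) b.
  move=> Ak ijA; apply/(cbP (pt_compl_pairs bb1 Ak) bk).
  exists (base_subset_of n k (range b2)); split=> //; first by exists b2.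
  exact: hY.
(* Otherwise [a] itself would lie in the base subset of [b2], together with [b]. *)
have nijA : (i0 \in A0) != (j0 \in A0).
  apply/eqP => ijA; apply: ab; exists (base_subset_of n k (range b2)).
  by split=> //; [exists b2|rewrite aE; exact: hY].
wlog iA : i0 j0 ij0 {hij0 hY} hc nijA / i0 \in A0.
  move=> H; have [iA|iA] := boolP (i0 \in A0); first exact: (H i0 j0).
  apply: (H j0 i0); rewrite 1?eq_sym //.
    by move=> A Ak ijA; apply: hc.
  by move: nijA; rewrite (negPf iA); case: (_ \in _).
have jA : j0 \notin A0 by move: nijA; rewrite iA; case: (_ \in _).
have h := commuting_coord kn n2k bb1 ij0 cb' hc.
pose r := co b1 i0 (pr b (b1 j0)).
pose phi := mk_scalar (co_linear bb1 j0).
have phi0 z : a.1 z -> phi z = 0 by rewrite aE; apply.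
(* The block of [pr b] from [a.2] to [a.1] has the single entry [r], from [j0] to [i0], so it has
   rank at most one. *)
have prE z : pr a (pr b (z - pr a z)) = phi z *: (r *: b1 i0).
  have aux i : i \notin A0 -> pr a (pr b (b1 i)) = (if i == j0 then r else 0) *: b1 i0.
    move=> iN; rewrite aE.
    rewrite (pr_pt_sum bb1) (bigD1 i0) //= big1 ?addr0.
      case: eqP => [->//|/eqP ij]; congr (_ *: _); apply: h.
        by apply: contraNneq iN => ->.
      apply/negP => /eqP/setP/(_ i); rewrite !inE eqxx (negPf ij) orbF.
      by move/esym/eqP => iE; rewrite iE iA in iN.
    move=> l /andP[lA li]; rewrite h ?scale0r //.
      by apply: contraNneq iN => ->.
    apply/negP => /eqP/setP/(_ l); rewrite !inE eqxx (negPf li) orbT /=.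
    by move/esym/eqP => lE; rewrite lE (negPf jA) in lA.
  have -> : z - pr a z = \sum_(i in ~: A0) co b1 i z *: b1 i.
    by rewrite aE (sub_pr_pt bb1).
  rewrite !pr_sum //.
  under eq_bigr => i do rewrite !prZ //.
  rewrite (bigD1 j0) ?inE //= aux // eqxx big1 ?addr0 // => i.
  rewrite inE => /andP[iN ij]; rewrite aux // (negPf ij) scale0r scaler0 //.
have r0 : r *: b1 i0 != 0.
  by apply: contraNneq x0; rewrite prE => ->; rewrite scaler0.
have ri : a.1 (- (r *: b1 i0)).
  by apply: subspaceN => //; apply: subspaceZ => //; rewrite aE; apply/(sp_b bb1).
have phiN0 : exists v, phi v != 0.
  by exists (b1 j0); rewrite /= (co_b bb1) eqxx oner_neq0.
have nr0 : - (r *: b1 i0) != 0 by rewrite oppr_eq0.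
pose c := shear a phi (- (r *: b1 i0)).
have prc z : pr c z = pr a z + pr a (pr b (z - pr a z)).
  by rewrite pr_shear // prE scalerN opprK.
have ck : compl_pairs n k c by exact: shear_pairs.
have dc : dcl k a b c.
  split=> // y yk /(cbP yk ak) ya /(cbP yk bk) yb; apply/(cbP yk ck) => z.
  have cy := compl_pairs_compl yk.
  by rewrite !prc (prD cy) !ya yb (prB cy) ya.
have nac : ~ cb k a c by move/(cbP ak ck); exact: shear_not_comm.
have [l bE] := pencil kn n2k n3 ak phi0 ri nr0 phiN0 (dab c dc nac).
exists phi, (l *: - (r *: b1 i0)); split=> //; last exact: subspaceZ.
apply: contra_notN ab => /eqP l0; rewrite bE l0 shear0 //; exact: cb_refl.
Qed.

End Adjacency.

(** Let e and p be the projections of [a] and [b]. If e p (1 - e) and (1 - e) p e both vanish, then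
    e p = e p e = p e and the pairs commute. So one of them is nonzero, and the second becomes the
    first, up to sign, after [swap]. *)
Lemma adjrelP k (a b : set V * set V) : (0 < k < n)%N -> n <> (2 * k)%N -> (2 < n)%N ->
  compl_pairs n k a -> compl_pairs n k b ->
  E1 a b \/ E2 a b <-> adjrel k a b.
Proof.
move=> kn n2k n3 ak bk.
have kn' : (0 < n - k < n)%N by lia.
have n2k' : n <> (2 * (n - k))%N by lia.
have kle : (k <= n)%N by lia.
have ca := compl_pairs_compl ak; have cb' := compl_pairs_compl bk.
split=> [[|ab]|ab].
- exact: E1_adjrel.
- rewrite -[k](subKn kle) -[a]swapK -[b]swapK.
  apply: adjrel_swap; first exact: leq_subr.
  by apply: E1_adjrel => //; exact: compl_pairs_swap.
have [x0|h1] := pselect (exists x, pr a (pr b (x - pr a x)) != 0).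
  by left; case: x0 => x; exact: (adjrel_E1 kn n2k n3 ak bk ab).
have [x0|h2] := pselect (exists x, pr (swap a) (pr (swap b) (x - pr (swap a) x)) != 0).
  right; case: x0 => x; apply: (adjrel_E1 kn' n2k' n3 _ _ (adjrel_swap kle ab));
    exact: compl_pairs_swap.
case: ab => _ ab _; case: ab; apply/(cbP ak bk) => x.
have e1 : pr a (pr b (x - pr a x)) = 0.
  by apply/eqP/negPn/negP => h; apply: h1; exists x.
have e2 : pr (swap a) (pr (swap b) (x - pr (swap a) x)) = 0.
  by apply/eqP/negPn/negP => h; apply: h2; exists x.
move: e2; rewrite (pr_swap x ca) subKr (pr_swap _ cb') (pr_swap _ ca).
rewrite [pr a (_ - _)]prB // pr_idem // opprB addrC subrKA => /eqP.
rewrite subr_eq0 => /eqP <-.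
by move: e1; rewrite !prB // => /eqP; rewrite subr_eq0 => /eqP.
Qed.

Lemma E1_fst a b : E1 a b -> a.1 = b.1.
Proof. by case=> phi [t [_ _ _ _ ->]]. Qed.

Lemma E1_snd a b : compl a.1 a.2 -> E1 a b -> a.2 <> b.2.
Proof.
move=> ca [phi [t [phiN0 t0 phi0 ta ->]]] e.
apply: (shear_neq ca phi0 phiN0 t0).
by case: a e {ca phi0 ta} => S U /= {2}->.
Qed.

Lemma E1_pairs k a b : compl_pairs n k a -> E1 a b -> compl_pairs n k b.
Proof.
move=> ak [phi [t [_ _ phi0 ta ->]]]; apply: shear_pairs => //.
exact: compl_pairs_compl ak.
Qed.

Lemma E1_sym a b : compl a.1 a.2 -> E1 a b -> E1 b a.
Proof.
move=> ca [phi [t [phiN0 t0 phi0 ta ->]]]; have [sa1 _ _ _] := ca.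
exists phi, (- t); split=> //; first by rewrite oppr_eq0.
  exact: subspaceN.
rewrite /shear; case: a ca phi0 ta sa1 => S U /= ca phi0 ta sa1; congr pair.
apply/seteqP; split=> x /=; rewrite (@pr_shear (S, U)) // scalerN.
  by move/(@pr_0 (S, U)) => -> //; rewrite sub0r.
by rewrite -{2}[- _]add0r => /addIr/(@pr_ker (S, U)); apply.
Qed.

Definition adjacent a b : Prop := E1 a b \/ E2 a b.

Lemma adjacent_swap a b : adjacent a b -> adjacent (swap a) (swap b).
Proof. by case=> h; [right|left]; rewrite /E2 ?swapK. Qed.

(** Adjacent pairs share a component, whereas [b] differs from [a] in the second one and [d] in the
    first. This forbids triangles of mixed kind. *)
Lemma E1_E2_not_adjacent a b d : compl a.1 a.2 -> E1 a b -> E2 a d ->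
  ~ adjacent b d /\ b <> d.
Proof.
move=> ca ab ad; have ca' := complC ca.
have e1 := E1_fst ab; have n2 := E1_snd ca ab.
have e2 := E1_fst ad; have n1 := @E1_snd (swap a) (swap d) ca' ad.
rewrite /= in e2 n1; split=> [[/E1_fst|/E1_fst]|bd].
- by rewrite -e1.
- by rewrite /= -e2 => /esym.
by apply: n1; rewrite e1 bd.
Qed.

Lemma shear_line_vec a (phi phi' : {scalar V}) (t : V) : compl a.1 a.2 ->
  (forall x, a.1 x -> phi x = 0) -> (forall x, a.1 x -> phi' x = 0) ->
  a.1 t -> t != 0 ->
  shear a phi t = shear a phi' t \/ E1 (shear a phi t) (shear a phi' t).
Proof.
move=> ca phi0 phi'0 ta t0.
pose psi : {scalar V} := mk_scalar (dual_add_linear phi' (mk_scalar (dual_opp_linear phi))).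
have [h|/forallNP h] := pselect (exists v, psi v != 0).
  right; exists psi, t; split=> //=.
    by move=> x Sx; rewrite phi0 // phi'0 // subrr.
  congr pair; apply/seteqP; split=> x /=.
    by rewrite pr_shear // => ->; rewrite scalerBl.
  by rewrite pr_shear // scalerBl => /addIr.
left; congr pair; suff e x : phi x = phi' x.
  by apply/seteqP; split=> x /=; rewrite e.
have /negP := h x; rewrite negbK /= subr_eq0 => /eqP->//.
Qed.

Lemma shear_line_form a (phi : {scalar V}) (t t' : V) : compl a.1 a.2 ->
  (forall x, a.1 x -> phi x = 0) -> (exists v, phi v != 0) -> a.1 t -> a.1 t' ->
  shear a phi t = shear a phi t' \/ E1 (shear a phi t) (shear a phi t').
Proof.
move=> ca phi0 phiN0 ta t'a; have [sa1 _ _ _] := ca.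
have [->|tt] := eqVneq t t'; first by left.
right; exists phi, (t' - t); split=> //=.
- by rewrite subr_eq0 eq_sym.
- exact: subspaceB.
congr pair; apply/seteqP; split=> x /=.
  by rewrite pr_shear // => ->; rewrite scalerBr.
by rewrite pr_shear // scalerBr => /addIr.
Qed.

(* From t (x) phi to t' (x) phi' through t' (x) phi: consecutive terms form a
   triangle with [a], and a triangle cannot mix the two kinds of adjacency. *)
Lemma E1_type k h a b c :
  (forall x, compl_pairs n k x -> compl (h x).1 (h x).2) ->
  (forall x y, compl_pairs n k x -> compl_pairs n k y ->
     adjacent x y -> adjacent (h x) (h y)) ->
  compl_pairs n k a -> E1 a b -> E1 a c ->
  E1 (h a) (h b) -> E1 (h a) (h c).
Proof.
move=> hc hadj ak.
have ca := compl_pairs_compl ak.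
have close x y : E1 a x -> E1 a y -> x = y \/ E1 x y ->
    E1 (h a) (h x) -> E1 (h a) (h y).
  move=> ax ay [->//|xy] hax; have xk := E1_pairs ak ax; have yk := E1_pairs ak ay.
  have [//|hay] := hadj _ _ ak yk (or_introl ay).
  have [] := E1_E2_not_adjacent (hc _ ak) hax hay.
  by case; apply: hadj => //; left.
move=> [phi [t [phiN0 t0 phi0 ta ->]]] [phi' [t' [phi'N0 t'0 phi'0 t'a ->]]] hab.
apply: (close (shear a phi t')); [by exists phi, t'|by exists phi', t'| |].
  exact: shear_line_vec.
apply: (close (shear a phi t)); [by exists phi, t|by exists phi, t'| |by []].
exact: shear_line_form.
Qed.

(** The difference of the projections of [b] and [a] vanishes on [a.1] and has values in [a.1].
    Along a frame of [a] it is a sum of rank-one maps, and each summand is one shear or trivial. *)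
Lemma E1_connected k (P : set V * set V -> Prop) a b :
  (forall x y, compl_pairs n k x -> P x -> E1 x y -> P y) ->
  compl_pairs n k a -> compl_pairs n k b -> a.1 = b.1 -> P a -> P b.
Proof.
move=> PE ak bk ab1 Pa.
have ca := compl_pairs_compl ak; have cb' := compl_pairs_compl bk.
have [_ [[e ee ->] /(base_subset_ofP ee)[A Ak aE] _]] := cb_refl ak.
pose N i := pr b (e i) - pr a (e i).
have N1 i : a.1 (N i).
  apply: subspaceB; [by case: ca|by rewrite ab1; exact: pr_in1|exact: pr_in1].
have co0S i x : i \notin A -> a.1 x -> co e i x = 0 by move=> iA; rewrite aE; exact.
have H (r : seq 'I_n) : {subset r <= ~: A} -> exists q, [/\ compl_pairs n k q, P q,
    q.1 = a.1 & forall x, pr q x = pr a x + \sum_(i <- r) co e i x *: N i].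
  elim: r => [_|i r IHr ir].
    by exists a; split=> // x; rewrite big_nil addr0.
  have [|q [qk Pq q1 qE]] := IHr; first by move=> x xr; apply: ir; rewrite inE xr orbT.
  have iA : i \notin A by have := ir i; rewrite inE eqxx inE; apply.
  have cq := compl_pairs_compl qk.
  pose phi := mk_scalar (co_linear ee i).
  have phi0 x : q.1 x -> phi x = 0 by rewrite q1; exact: co0S.
  have Nq : q.1 (- N i) by rewrite q1; apply: subspaceN => //; case: ca.
  exists (shear q phi (- N i)); split=> //.
  - exact: shear_pairs.
  - have [N0|N0] := eqVneq (N i) 0; first by rewrite N0 oppr0 shear0.
    apply: (PE q) => //; exists phi, (- N i); split=> //.
      by exists (e i); rewrite /= (co_b ee) eqxx oner_neq0.
    by rewrite oppr_eq0.
  by move=> x; rewrite pr_shear // qE big_cons scalerN opprK -addrA [X in _ + X]addrC.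
have [|q [qk Pq q1 qE]] := H (enum (~: A)); first by move=> i; rewrite mem_enum.
suff <- : q = b by [].
apply: pr_eq => //; first exact: compl_pairs_compl qk.
move=> x; rewrite qE -[X in pr b X](subrK (pr a x)) prD //.
rewrite [pr b (pr a x)]pr_id //; last by rewrite -ab1; exact: pr_in1.
rewrite addrC; congr (_ + _).
have -> : x - pr a x = \sum_(i in ~: A) co e i x *: e i.
  by rewrite aE (sub_pr_pt ee).
rewrite pr_sum // big_enum /=; apply: eq_bigr => i; rewrite inE => iA.
rewrite prZ // /N [pr a (e i)](_ : _ = 0) ?subr0 //.
by rewrite aE (pr_0 (p := pt e A) (compl_pt ee A)) //; apply/(sp_b ee); rewrite inE.
Qed.

Lemma E2_connected k (P : set V * set V -> Prop) a b :
  (forall x y, compl_pairs n k x -> P x -> E2 x y -> P y) ->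
  compl_pairs n k a -> compl_pairs n k b -> a.2 = b.2 -> P a -> P b.
Proof.
move=> PE ak bk ab2 Pa; rewrite -[b]swapK.
apply: (@E1_connected (n - k) (P \o swap) (swap a) (swap b)); rewrite //=.
- move=> x y xk Px xy; apply: (PE (swap x)) => //.
    by rewrite -[k](subKn (compl_pairs_le ak)); exact: compl_pairs_swap.
  by rewrite /E2 !swapK.
- exact: compl_pairs_swap.
- exact: compl_pairs_swap.
by rewrite swapK.
Qed.

(** A common complement [U] of the first components gives the path [a], [(a.1, U)], [(b.1, U)], [b],
    which changes one component at a time. *)
Lemma adjacent_connected k (P : set V * set V -> Prop) a b :
  (forall x y, compl_pairs n k x -> P x -> adjacent x y -> P y) ->
  compl_pairs n k a -> compl_pairs n k b -> P a -> P b.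
Proof.
move=> PE ak bk Pa; have kn := compl_pairs_le ak.
have [sa _ _ _] := compl_pairs_compl ak; have [sb _ _ _] := compl_pairs_compl bk.
have dab : dimv a.1 = dimv b.1 by rewrite (compl_pairs_dim ak) (compl_pairs_dim bk).
have [U [aU bU]] := common_compl sa sb dab.
have aUk : compl_pairs n k (a.1, U).
  by apply/compl_pairsP => //; split=> //; exact: compl_pairs_dim ak.
have bUk : compl_pairs n k (b.1, U).
  by apply/compl_pairsP => //; split=> //; exact: compl_pairs_dim bk.
have P1 x y : compl_pairs n k x -> P x -> E1 x y -> P y.
  by move=> xk Px xy; apply: PE Px _ => //; left.
have P2 x y : compl_pairs n k x -> P x -> E2 x y -> P y.
  by move=> xk Px xy; apply: PE Px _ => //; right.
apply: (E1_connected P1 bUk bk) => //.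
apply: (E2_connected P2 aUk bUk) => //.
exact: (E1_connected P1 ak aUk).
Qed.

Lemma ex_E1 k a : (0 < k < n)%N -> compl_pairs n k a -> exists b, E1 a b.
Proof.
move=> /andP[k0 kn] ak; have ca := compl_pairs_compl ak.
have [_ [[e ee ->] /(base_subset_ofP ee)[A Ak aE] _]] := cb_refl ak.
have /card_gt0P[i iA] : (0 < #|A|)%N by rewrite Ak.
have /card_gt0P[j jA] : (0 < #|~: A|)%N by rewrite cardsCs finset.setCK card_ord Ak; lia.
pose phi := mk_scalar (co_linear ee j).
exists (shear a phi (e i)), phi, (e i); split=> //.
- by exists (e j); rewrite /= (co_b ee) eqxx oner_neq0.
- exact/eqP/(basis_neq0 ee).
- by move=> x; rewrite aE /=; apply; rewrite inE in jA.
by rewrite aE; apply/(sp_b ee).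
Qed.

(** * Bijections preserving base subsets, and the kind of an adjacency *)

Section Automorphism.
Variables (k : nat) (f g : set V * set V -> set V * set V).

Definition base_morphism (h : set V * set V -> set V * set V) : Prop :=
  (forall p, compl_pairs n k p -> compl_pairs n k (h p)) /\
  (forall X, base_subset n k X -> base_subset n k (h @` X)).

Lemma base_subset_pairs X p : base_subset n k X -> X p -> compl_pairs n k p.
Proof. by case=> b bb -> []. Qed.

Lemma cb_morphism h p q : base_morphism h -> cb k p q -> cb k (h p) (h q).
Proof.
move=> [_ hB] [X [bX Xp Xq]]; exists (h @` X).
by split; [exact: hB|exists p|exists q].
Qed.

Hypotheses (fB : base_morphism f) (gB : base_morphism g).
Hypotheses (fK : forall p, compl_pairs n k p -> g (f p) = p).
Hypotheses (gK : forall p, compl_pairs n k p -> f (g p) = p).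

Lemma cb_morphism_inv p q : compl_pairs n k p -> compl_pairs n k q ->
  cb k (f p) (f q) -> cb k p q.
Proof. by move=> pk qk /(cb_morphism gB); rewrite !fK. Qed.

Lemma dcl_morphism a b c : compl_pairs n k a -> compl_pairs n k b ->
  dcl k a b c -> dcl k (f a) (f b) (f c).
Proof.
move=> ak bk [ck h]; split; first exact: fB.1.
move=> x xk /(cb_morphism gB) xa /(cb_morphism gB) xb.
rewrite -(gK xk); apply: cb_morphism => //; rewrite fK // in xa; rewrite fK // in xb.
by apply: h => //; exact: gB.1.
Qed.

Lemma image_fK X : base_subset n k X -> g @` (f @` X) = X.
Proof.
move=> bX; apply/seteqP; split.
  by move=> _ [_ [p Xp <-] <-]; rewrite fK //; exact: base_subset_pairs Xp.
move=> p Xp; exists (f p); first by exists p.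
by rewrite fK //; exact: base_subset_pairs Xp.
Qed.

End Automorphism.

Lemma adjrel_morphism k f g a b :
  base_morphism k f -> base_morphism k g ->
  (forall p, compl_pairs n k p -> g (f p) = p) ->
  (forall p, compl_pairs n k p -> f (g p) = p) ->
  compl_pairs n k a -> compl_pairs n k b ->
  adjrel k a b -> adjrel k (f a) (f b).
Proof.
move=> fB gB fK gK ak bk [[X [Y [bX bY Xa Yb [XY h]]]] ab dab].
have imgK := image_fK gK; have imfK := image_fK fK.
split.
- exists (f @` X), (f @` Y).
  split; [exact: fB.2|exact: fB.2|by exists a|by exists b|].
  split=> [e|Z bZ ZX XYZ p [[q Xq <-] Zp]].
    by apply: XY; rewrite -(imfK X bX) e imfK.
  have qk := base_subset_pairs bX Xq.
  exists q => //; apply: (h (g @` Z)) => //.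
  - exact: gB.2.
  - by move=> e; apply: ZX; rewrite -(imgK Z bZ) e.
  - move=> r [Xr Yr]; exists (f r); last by rewrite fK //; exact: base_subset_pairs Xr.
    by apply: XYZ; split; exists r.
  by split=> //; exists (f q); rewrite ?fK.
- by move/(cb_morphism_inv gB fK ak bk).
move=> c dc ac; have ck : compl_pairs n k c by case: dc.
rewrite -(gK c ck); apply: (@dcl_morphism k f g) => //; first exact: gB.1.
apply: dab.
  rewrite -(fK a ak) -(fK b bk); apply: (@dcl_morphism k g f) => //; exact: fB.1.
by move/(cb_morphism fB); rewrite gK.
Qed.

(** The target is an arbitrary product because the map is later also taken with values in pairs of
    subspaces of the dual. *)
Definition direct (T1 T2 : Type) k (f : set V * set V -> T1 * T2) : Prop :=
  forall a b, compl_pairs n k a -> compl_pairs n k b ->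
    (a.1 = b.1 -> (f a).1 = (f b).1) /\ (a.2 = b.2 -> (f a).2 = (f b).2).

Definition twisted k (f : set V * set V -> set V * set V) : Prop :=
  forall a b, compl_pairs n k a -> compl_pairs n k b ->
    (a.1 = b.1 -> (f a).2 = (f b).2) /\ (a.2 = b.2 -> (f a).1 = (f b).1).

Lemma E1_not_E2 a b : compl a.1 a.2 -> E1 a b -> ~ E2 a b.
Proof. by move=> ca ab /(E1_E2_not_adjacent ca ab) []. Qed.

Lemma direct_of_edges k f :
  (forall a b, compl_pairs n k a -> compl_pairs n k b -> E1 a b -> E1 (f a) (f b)) ->
  (forall a b, compl_pairs n k a -> compl_pairs n k b -> E2 a b -> E2 (f a) (f b)) ->
  direct k f.
Proof.
move=> h1 h2 a b ak bk; split=> ab.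
  apply: (@E1_connected k (fun x => (f a).1 = (f x).1) a b) => // x y xk -> xy.
  by apply/E1_fst/h1 => //; exact: E1_pairs xy.
apply: (@E2_connected k (fun x => (f a).2 = (f x).2) a b) => // x y xk -> xy.
apply: (@E1_fst (swap _) (swap _)); apply: h2 => //.
rewrite -[y]swapK -[k](subKn (compl_pairs_le xk)).
by apply: compl_pairs_swap; apply: E1_pairs xy; exact: compl_pairs_swap.
Qed.

Lemma twisted_of_edges k f :
  (forall a b, compl_pairs n k a -> compl_pairs n k b -> E1 a b -> E2 (f a) (f b)) ->
  (forall a b, compl_pairs n k a -> compl_pairs n k b -> E2 a b -> E1 (f a) (f b)) ->
  twisted k f.
Proof.
move=> h1 h2 a b ak bk.
have [||e1 e2] := @direct_of_edges k (swap \o f) _ _ a b ak bk.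
- by move=> x y xk yk /(h1 x y xk yk).
- by move=> x y xk yk /(h2 x y xk yk); rewrite /E2 /= !swapK.
by [].
Qed.

(** Call [a] good when every [E1] edge at [a] remains an [E1] edge. The inverse [g] then controls
    the [E2] edges at [a], goodness passes to adjacent pairs, and connectedness leaves only two
    possibilities: all pairs are good or none is. *)
Lemma direct_or_twisted k f g :
  (0 < k < n)%N -> n <> (2 * k)%N -> (2 < n)%N ->
  base_morphism k f -> base_morphism k g ->
  (forall p, compl_pairs n k p -> g (f p) = p) ->
  (forall p, compl_pairs n k p -> f (g p) = p) ->
  direct k f /\ direct k g \/ twisted k f /\ twisted k g.
Proof.
move=> kn n2k n3 fB gB fK gK.
have kle : (k <= n)%N by lia.
have fadj x y : compl_pairs n k x -> compl_pairs n k y ->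
    adjacent x y -> adjacent (f x) (f y).
  move=> xk yk xy; apply/(adjrelP kn n2k n3); [exact: fB.1..|].
  by apply: (adjrel_morphism fB gB) => //; apply/(adjrelP kn n2k n3).
have gadj x y : compl_pairs n k x -> compl_pairs n k y ->
    adjacent x y -> adjacent (g x) (g y).
  move=> xk yk xy; apply/(adjrelP kn n2k n3); [exact: gB.1..|].
  by apply: (adjrel_morphism gB fB) => //; apply/(adjrelP kn n2k n3).
have fc x : compl_pairs n k x -> compl (f x).1 (f x).2.
  by move=> xk; apply: (@compl_pairs_compl k); exact: fB.1.
have gc x : compl_pairs n k x -> compl (g x).1 (g x).2.
  by move=> xk; apply: (@compl_pairs_compl k); exact: gB.1.
have unswap x : compl_pairs n (n - k) x -> compl_pairs n k (swap x).
  by rewrite -{2}[k](subKn kle); exact: compl_pairs_swap.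
pose good a := forall b, E1 a b -> E1 (f a) (f b).
have E2k a d : compl_pairs n k a -> E2 a d -> compl_pairs n k d.
  move=> ak ad; rewrite -[d]swapK; apply: unswap.
  by apply: E1_pairs ad; exact: compl_pairs_swap.
(* Suppose an [E2] edge became [E1]. Since [g] returns one [E1] edge at [f a] to an [E1] edge,
   [E1_type] for [g] would make the original edge [E1] too. *)
have good2 a d : compl_pairs n k a -> good a -> E2 a d -> E2 (f a) (f d).
  move=> ak ga ad; have [b ab] := ex_E1 kn ak.
  have bk := E1_pairs ak ab; have dk := E2k _ _ ak ad.
  have [fad|//] := fadj _ _ ak dk (or_intror ad).
  have := E1_type gc gadj (fB.1 _ ak) (ga _ ab) fad; rewrite !fK // => /(_ ab) ad1.
  by case: (E1_not_E2 (compl_pairs_compl ak) ad1).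
(* One [E1] edge at [a] changes its kind; [E1_type] for [swap \o f] extends this to all of them. *)
have bad1 a : compl_pairs n k a -> ~ good a -> forall b, E1 a b -> E2 (f a) (f b).
  move=> ak nga b ab.
  have [b0 [ab0 nab0]] : exists b0, E1 a b0 /\ ~ E1 (f a) (f b0).
    apply: contra_notP nga => h b' ab'; apply: contrapT => nab'; apply: h.
    by exists b'.
  have fab0 : E2 (f a) (f b0).
    by case: (fadj _ _ ak (E1_pairs ak ab0) (or_introl ab0)).
  apply: (@E1_type k (swap \o f) a b0 b) => //.
    by move=> x xk; apply: complC; exact: fc.
  by move=> x y xk yk xy; apply/adjacent_swap/fadj.
have bad2 a d : compl_pairs n k a -> ~ good a -> E2 a d -> E1 (f a) (f d).
  move=> ak nga ad; have [b ab] := ex_E1 kn ak.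
  have bk := E1_pairs ak ab; have dk := E2k _ _ ak ad.
  have [//|fad] := fadj _ _ ak dk (or_intror ad).
  have : E1 ((g \o swap) (swap (f a))) ((g \o swap) (swap (f d))).
    apply: (@E1_type (n - k) (g \o swap) _ (swap (f b))).
    - by move=> x xk; apply: gc; exact: unswap.
    - by move=> x y xk yk xy; apply: gadj; [exact: unswap..|exact: adjacent_swap].
    - by apply: compl_pairs_swap; exact: fB.1.
    - exact: bad1.
    - exact: fad.
    by rewrite /= !swapK !fK.
  rewrite /= !swapK !fK // => ad1.
  by case: (E1_not_E2 (compl_pairs_compl ak) ad1).
have good_edge a b : compl_pairs n k a -> good a -> adjacent a b -> good b.
  move=> ak ga [ab|ab].
    have bk := E1_pairs ak ab; have ca := compl_pairs_compl ak.
    move=> c bc; apply: (E1_type fc fadj bk (E1_sym ca ab) bc).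
    by apply: E1_sym; [exact: fc|exact: ga].
  have bk := E2k _ _ ak ab; apply: contrapT => ngb.
  have ba : E2 b a.
    by apply: E1_sym ab; apply: complC; exact: compl_pairs_compl ak.
  have fba := bad2 b a bk ngb ba.
  have := E1_sym (fc _ bk) fba.
  by move/(E1_not_E2 (fc _ ak)); apply; exact: good2.
have [[a0 [a0k ga0]]|nga] := pselect (exists a0, compl_pairs n k a0 /\ good a0).
  left; have ga a : compl_pairs n k a -> good a.
    by move=> ak; apply: (adjacent_connected good_edge a0k ak).
  have h1 a b : compl_pairs n k a -> compl_pairs n k b -> E1 a b -> E1 (f a) (f b).
    by move=> ak bk; exact: ga.
  have h2 a b : compl_pairs n k a -> compl_pairs n k b -> E2 a b -> E2 (f a) (f b).
    by move=> ak bk; apply: good2 => //; exact: ga.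
  split; first exact: direct_of_edges.
  apply: direct_of_edges => a b ak bk ab.
    have [//|gab] := gadj a b ak bk (or_introl ab).
    have := h2 _ _ (gB.1 _ ak) (gB.1 _ bk) gab; rewrite !gK // => ab2.
    by case: (E1_not_E2 (compl_pairs_compl ak) ab).
  have [gab|//] := gadj a b ak bk (or_intror ab).
  have := h1 _ _ (gB.1 _ ak) (gB.1 _ bk) gab; rewrite !gK // => ab1.
  by case: (E1_not_E2 (compl_pairs_compl ak) ab1).
right; have ng a : compl_pairs n k a -> ~ good a.
  by move=> ak ga; apply: nga; exists a.
have h1 a b : compl_pairs n k a -> compl_pairs n k b -> E1 a b -> E2 (f a) (f b).
  by move=> ak bk; apply: bad1 => //; exact: ng.
have h2 a b : compl_pairs n k a -> compl_pairs n k b -> E2 a b -> E1 (f a) (f b).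
  by move=> ak bk; apply: bad2 => //; exact: ng.
split; first exact: twisted_of_edges.
apply: twisted_of_edges => a b ak bk ab.
  have [gab|//] := gadj a b ak bk (or_introl ab).
  have := h1 _ _ (gB.1 _ ak) (gB.1 _ bk) gab; rewrite !gK // => ab2.
  by case: (E1_not_E2 (compl_pairs_compl ak) ab).
have [//|gab] := gadj a b ak bk (or_intror ab).
have := h2 _ _ (gB.1 _ ak) (gB.1 _ bk) gab; rewrite !gK // => ab1.
by case: (E1_not_E2 (compl_pairs_compl ak) ab1).
Qed.
(** * Adjacent subspaces *)

(** The successor on the left excludes [i = 0], where a truncated predecessor would admit
    [S = T]. *)
Definition adj i S T : Prop :=
  [/\ grassmannian i S, grassmannian i T & (dimv (S `&` T)).+1 = i].

Lemma adjC i S T : adj i S T -> adj i T S.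
Proof. by case=> Si Ti e; split=> //; rewrite setIC. Qed.

Lemma adj_dim i S T : adj i S T -> dimv (S :+: T) = i.+1.
Proof.
case=> /grassmannianP[sS dS] /grassmannianP[sT dT] e.
by have := dimv_sumI sS sT; rewrite dS dT; lia.
Qed.

Lemma gr_eq i S T : grassmannian i S -> grassmannian i T -> S `<=` T -> S = T.
Proof.
by move=> /grassmannianP[sS dS] /grassmannianP[sT dT] ST; apply: dimv_eq => //; rewrite dS dT.
Qed.

Lemma adj_neq i S T : adj i S T -> S <> T.
Proof.
case=> /grassmannianP[sS dS] _ e ST; move: e; rewrite -ST setIid dS; lia.
Qed.

Lemma gr_sub i S : grassmannian i S -> is_subspace S.
Proof. by case. Qed.

Lemma gr_dim i S : grassmannian i S -> dimv S = i.
Proof. by case/grassmannianP. Qed.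

Lemma gr_notin i S T : grassmannian i S -> grassmannian i T -> S <> T ->
  exists x, S x /\ ~ T x.
Proof.
move=> Si Ti; apply: contra_notP => h; apply: (gr_eq Si Ti) => x Sx.
by apply: contrapT => nTx; apply: h; exists x.
Qed.

Lemma gr_cons i S x : grassmannian i S -> ~ S x -> grassmannian i.+1 (S :+: lc [:: x]).
Proof.
move=> Si nx; have sS := gr_sub Si; apply/grassmannianP; split; first exact: subspace_sums.
by rewrite dimv_cons // (gr_dim Si).
Qed.

Lemma adj_of_sup i S T W : grassmannian i S -> grassmannian i T ->
  grassmannian i.+1 W -> S `<=` W -> T `<=` W -> S <> T -> adj i S T.
Proof.
move=> Si Ti Wi SW TW ST; split=> //.
have sS := gr_sub Si; have sT := gr_sub Ti; have sW := gr_sub Wi.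
have := dimv_sumI sS sT; rewrite (gr_dim Si) (gr_dim Ti).
have := dimv_le (subspace_sums sS sT) sW (sums_sub sW SW TW).
rewrite (gr_dim Wi) => h1.
have [x [Sx nTx]] := gr_notin Si Ti ST.
have : (dimv (T :+: lc [:: x]) <= dimv (S :+: T))%N.
  apply: dimv_le; [exact: subspace_sums|exact: subspace_sums|].
  apply: sums_sub; [exact: subspace_sums|exact: sums_subr|].
  by apply: lc_sub => [|y]; [exact: subspace_sums|rewrite inE => /eqP->; exact: sums_subl].
by rewrite dimv_cons // (gr_dim Ti); lia.
Qed.

Lemma adj_of_sub i S T Z : grassmannian i.+1 S -> grassmannian i.+1 T ->
  grassmannian i Z -> Z `<=` S -> Z `<=` T -> S <> T -> adj i.+1 S T.
Proof.
move=> Si Ti Zi ZS ZT ST; split=> //; congr _.+1.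
have sS := gr_sub Si; have sT := gr_sub Ti; have sI := subspaceI sS sT.
apply/eqP; rewrite eqn_leq; apply/andP; split; last first.
  by rewrite -(gr_dim Zi); apply: dimv_le => //; [exact: gr_sub Zi|move=> x Zx; split; auto].
rewrite leqNgt; apply/negP => lt; apply: ST.
have e : S `&` T = S by apply: dimv_eq => //; rewrite (gr_dim Si).
by apply: (gr_eq Si Ti); rewrite -e; exact: subIsetr.
Qed.

Lemma gr_between A B i j m : grassmannian i A -> grassmannian j B -> A `<=` B ->
  (i <= m <= j)%N -> exists C, [/\ grassmannian m C, A `<=` C & C `<=` B].
Proof.
move=> Ai Bj AB /andP[im mj]; elim: m im mj => [|m IHm] im mj.
  by exists A; split=> //; move: Ai; have -> : i = 0%N by lia.
have [e|lt] := eqVneq i m.+1; first by exists A; split=> //; rewrite -e.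
have [||C [Cm AC CB]] := IHm; [lia..|].
have [x [Bx nCx]] : exists x, B x /\ ~ C x.
  apply: contrapT => h; have : B `<=` C.
    by move=> x Bx; apply: contrapT => nCx; apply: h; exists x.
  move/(dimv_le (gr_sub Bj) (gr_sub Cm)); rewrite (gr_dim Bj) (gr_dim Cm); lia.
exists (C :+: lc [:: x]); split; first exact: gr_cons.
  by move=> y /AC; exact: sums_subl.
apply: sums_sub => //; first exact: gr_sub Bj.
by apply: lc_sub => [|y]; [exact: gr_sub Bj|rewrite inE => /eqP->].
Qed.

Lemma ex_notin i S : grassmannian i S -> (i < n)%N -> exists x, ~ S x.
Proof.
move=> Si lt; apply: contrapT => /forallNP h.
have : dimv [set: V] = dimv S.
  by congr dimv; apply/seteqP; split=> // x _; apply: contrapT; exact: h.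
by rewrite dimvT (gr_dim Si); lia.
Qed.

(** A vector of [S] outside [T] plus one of [T] outside [S] gives a direction in neither.
    [pairmap_adj] needs such a third member to compare complements. *)
Lemma pencil_third i S T : adj i S T -> exists X : set V, [/\ grassmannian i X,
  X <> S, X <> T, S `&` T `<=` X & X `<=` S :+: T].
Proof.
move=> ST; have nST := adj_neq ST; have [Si Ti e] := ST.
have sS := gr_sub Si; have sT := gr_sub Ti; have sI := subspaceI sS sT.
have [x [Sx nTx]] := gr_notin Si Ti nST.
have [y [Ty nSy]] := gr_notin Ti Si (nesym nST).
have nxS : ~ S (x + y).
  by move=> h; apply: nSy; rewrite -(addKr x y); apply: subspaceD => //; exact: subspaceN.
have nxT : ~ T (x + y) by move=> h; apply: nTx; rewrite -(addrK y x); exact: subspaceB.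
have Ii : grassmannian (dimv (S `&` T)) (S `&` T) by apply/grassmannianP.
exists (S `&` T :+: lc [:: x + y]); split.
- by rewrite -e; apply: gr_cons => //; case.
- move=> h; apply: nxS; rewrite -h; apply: sums_subr => //.
  by apply: lc_mem; rewrite inE.
- move=> h; apply: nxT; rewrite -h; apply: sums_subr => //.
  by apply: lc_mem; rewrite inE.
- exact: sums_subl.
apply: sums_sub; first exact: subspace_sums.
  by move=> z [Sz _]; exact: sums_subl.
apply: lc_sub; first exact: subspace_sums.
by move=> z; rewrite inE => /eqP->; exact: sums_intro.
Qed.

Lemma compl_gr i S U : grassmannian i S -> is_subspace U -> dimv U = (n - i)%N ->
  (i <= n)%N -> S `&` U `<=` [set 0] -> compl S U.
Proof.
move=> Si sU dU lt I; apply: compl_dimP => //; first exact: gr_sub Si.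
by rewrite dU (gr_dim Si) subnKC.
Qed.

(** Suppose [U] meets [S] and [T] in nonzero [x] and [y]. As [X] is a hyperplane of [S + T], some
    [y - c *: x] lies in [X] and in [U], hence is zero; then [y] lies in both [S] and [T], so in
    [X], a contradiction. *)
Lemma pencil_compl i (S T X U : set V) : adj i S T -> grassmannian i X ->
  S `&` T `<=` X -> X `<=` S :+: T -> compl X U -> compl S U \/ compl T U.
Proof.
move=> ST Xi IX XST XU; have [Si Ti e] := ST.
have sS := gr_sub Si; have sT := gr_sub Ti; have sX := gr_sub Xi.
have sST := subspace_sums sS sT.
have [_ sU XU0 _] := XU; have dU := compl_dim XU; rewrite (gr_dim Xi) in dU.
have dU' : dimv U = (n - i)%N by rewrite -dU addKn.
have le : (i <= n)%N by rewrite -dU leq_addr.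
have [S0|S0] := pselect (S `&` U `<=` [set 0]); first by left; exact: compl_gr Si _ _ _ _.
have [T0|T0] := pselect (T `&` U `<=` [set 0]); first by right; exact: compl_gr Ti _ _ _ _.
have nz W : ~ W `&` U `<=` [set 0] -> exists x, [/\ W x, U x & ~ x = 0].
  apply: contra_notP => h x [Wx Ux]; apply: contrapT => x0; apply: h; by exists x.
have [x [Sx Ux x0]] := nz _ S0; have [y [Ty Uy y0]] := nz _ T0.
have nXx : ~ X x by move=> Xx; apply: x0; apply: XU0.
have nXy : ~ X y by move=> Xy; apply: y0; apply: XU0.
have WE : X :+: lc [:: x] = S :+: T.
  apply: dimv_eq => //; first exact: subspace_sums.
    apply: sums_sub => //; apply: lc_sub => // z; rewrite inE => /eqP->.
    exact: sums_subl.
  by rewrite dimv_cons // (gr_dim Xi) (adj_dim ST).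
have : (X :+: lc [:: x]) y by rewrite WE; exact: sums_subr.
case=> z Xz [_ /lc1P[c ->] zE].
have z0 : z = 0.
  apply: XU0; split=> //; rewrite -(addrK (c *: x) z) zE.
  by apply: subspaceB => //; exact: subspaceZ.
exfalso; apply: nXy; apply: IX; split=> //.
by rewrite -zE z0 add0r; exact: subspaceZ.
Qed.

(** A vector of [S] and one of [T], both outside [X], are dependent modulo [X]: otherwise some
    complement of [X] would contain both and be a complement of neither [S] nor [T]. Hence [S] and
    [T] lie in one extension of [X] by a line. *)
Lemma compl_pencil i (S T X : set V) : grassmannian i S -> grassmannian i T ->
  grassmannian i X -> S <> T -> S <> X -> T <> X ->
  (forall U, compl X U -> compl S U \/ compl T U) ->
  adj i S T /\ X `<=` S :+: T.
Proof.
move=> Si Ti Xi ST SX TX h.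
have sS := gr_sub Si; have sT := gr_sub Ti; have sX := gr_sub Xi.
have key x y : S x -> ~ X x -> T y -> ~ X y -> (X :+: lc [:: x]) y.
  move=> Sx nXx Ty nXy; apply: contrapT => nxy.
  have sxy : is_subspace (lc [:: x; y]) by [].
  have I : lc [:: x; y] `&` X `<=` [set 0].
    move=> z [[c [_ [/lc1P[d ->] ->]]]] Xz.
    have d0 : d = 0.
      apply: contrapT => /eqP d0; apply: nxy.
      apply: (scaleI (subspace_sums sX (subspace_lc [:: x])) d0).
      rewrite -(addKr (c *: x) (d *: y)) addrC; apply: sums_intro => //.
      by apply/lc1P; exists (- c); rewrite scaleNr.
    rewrite d0 scale0r addr0 in Xz *.
    have [->|c0] := eqVneq c 0; first by rewrite scale0r.
    by case: nXx; exact: scaleI Xz.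
  have [U xyU XU] := compl_extend sxy sX I.
  have x0 : x <> 0 by move=> x0; apply: nXx; rewrite x0; exact: subspace0.
  have y0 : y <> 0 by move=> y0; apply: nXy; rewrite y0; exact: subspace0.
  case: (h U XU) => c.
    by apply: x0; apply: (compl_in0 c) => //; apply/xyU/lc_mem; rewrite !inE eqxx.
  by apply: y0; apply: (compl_in0 c) => //; apply/xyU/lc_mem; rewrite !inE eqxx orbT.
have [x [Sx nXx]] := gr_notin Si Xi SX; have [y [Ty nXy]] := gr_notin Ti Xi TX.
have Wi := gr_cons Xi nXx; set W := X :+: lc [:: x] in Wi.
have sW := gr_sub Wi.
have XW : X `<=` W by exact: sums_subl.
have TW : T `<=` W.
  by move=> z Tz; have [/XW//|nXz] := pselect (X z); exact: key.
have SW : S `<=` W.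
  move=> z Sz; have [/XW//|nXz] := pselect (X z).
  have [u Xu [_ /lc1P[c ->] uE]] := key z y Sz nXz Ty nXy.
  have c0 : c != 0 by apply/eqP => c0; apply: nXy; rewrite -uE c0 scale0r addr0.
  apply: (scaleI sW c0); rewrite -(addKr u (c *: z)) uE.
  by apply: subspaceD => //; [apply: subspaceN => //; exact: XW|exact: TW].
have STa := adj_of_sup Si Ti Wi SW TW ST.
split=> //; suff -> : S :+: T = W by [].
apply: dimv_eq => //; first exact: subspace_sums.
  exact: sums_sub.
by rewrite (adj_dim STa) (gr_dim Wi).
Qed.

(** Apart from the trivial cases, [X] meets [S] and [T] in hyperplanes of [X]. If these are equal,
    they coincide with the intersection of [S] and [T]; if distinct, they span [X]. *)
Lemma adj_sub_or i (S T X : set V) : adj i S T -> X = S \/ adj i X S -> X = T \/ adj i X T ->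
  S `&` T `<=` X \/ X `<=` S :+: T.
Proof.
move=> ST; have [Si Ti e] := ST; have sS := gr_sub Si; have sT := gr_sub Ti.
case=> [->|XS]; first by left; exact: subIsetl.
case=> [->|XT]; first by left; exact: subIsetr.
have [Xi _ eS] := XS; have [_ _ eT] := XT; have sX := gr_sub Xi.
have gI A B : adj i A B -> grassmannian i.-1 (A `&` B).
  case=> /gr_sub sA /gr_sub sB eAB; apply/grassmannianP; split; first exact: subspaceI.
  by rewrite -eAB.
have [e1|n1] := pselect (X `&` S = X `&` T).
  left; rewrite -(gr_eq (gI _ _ XS) (gI _ _ ST)); first exact: subIsetl.
  by move=> x XSx; split; [case: XSx|move: XSx; rewrite e1 => -[]].
right; have [x [[Xx Sx] nx]] := gr_notin (gI _ _ XS) (gI _ _ XT) n1.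
have := gr_cons (gI _ _ XT) nx; rewrite prednK; last by rewrite -e.
move=> /gr_eq/(_ Xi) XE; rewrite -XE.
  apply: sums_sub; first exact: subspace_sums.
    by move=> z [_ Tz]; exact: sums_subr.
  apply: lc_sub; first exact: subspace_sums.
  by move=> z; rewrite inE => /eqP->; exact: sums_subl.
apply: sums_sub => //.
by apply: lc_sub => // z; rewrite inE => /eqP->.
Qed.

(* Three pairwise adjacent subspaces that span more than two of them share their
   pairwise intersection, and so does everything adjacent to all three. *)
Lemma adj_star i (S T X Y : set V) : adj i S T -> adj i S X -> adj i T X ->
  ~ X `<=` S :+: T ->
  Y = S \/ adj i Y S -> Y = T \/ adj i Y T -> Y = X \/ adj i Y X ->
  S `&` T `<=` Y.
Proof.
move=> ST SX TX nX YS YT YX.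
have [Si Ti e] := ST; have [_ Xi eX] := SX; have [_ _ eTX] := TX.
have sS := gr_sub Si; have sT := gr_sub Ti; have sX := gr_sub Xi.
have IX : S `&` T `<=` X.
  have [//|/nX//] := adj_sub_or ST (or_intror (adjC SX)) (or_intror (adjC TX)).
have gI A B : adj i A B -> grassmannian i.-1 (A `&` B).
  case=> /gr_sub sA /gr_sub sB eAB; apply/grassmannianP; split; first exact: subspaceI.
  by rewrite -eAB.
have ISX : S `&` T = S `&` X.
  by apply: (gr_eq (gI _ _ ST) (gI _ _ SX)) => x STx; split; [case: STx|exact: IX].
have [//|YST] := adj_sub_or ST YS YT.
have [|YSX] := adj_sub_or SX YS YX; first by rewrite ISX.
have sST := subspace_sums sS sT; have sSX := subspace_sums sS sX.
have sI := subspaceI sST sSX.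
(* Since [X] is not inside [S :+: T], the two sums are distinct spaces of dimension [i + 1] and can
   meet in no more than [S]. *)
have SI : S = (S :+: T) `&` (S :+: X).
  apply: dimv_eq => //; first by move=> x Sx; split; exact: sums_subl.
  rewrite leqNgt; apply/negP => lt; apply: nX.
  have E : (S :+: T) `&` (S :+: X) = S :+: X.
    apply: dimv_eq => //.
    by rewrite (adj_dim SX) -(gr_dim Si).
  move=> x Xx; have : (S :+: X) x by exact: sums_subr.
  by rewrite -E => -[].
have Yi : grassmannian i Y by case: YS => [->|[]].
have YES : Y = S by apply: (gr_eq Yi Si); rewrite SI => x Yx; split; [exact: YST|exact: YSX].
by rewrite YES; exact: subIsetl.
Qed.

Lemma gr_compl i S : grassmannian i S -> exists U, compl_pairs n i (S, U).
Proof.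
move=> Si; have [U c] := subspace_compl (gr_sub Si); exists U.
apply/compl_pairsP; first by rewrite -(gr_dim Si); apply/dimv_le_n/gr_sub/Si.
by split=> //; exact: gr_dim Si.
Qed.

Lemma gr_basis i S : grassmannian i S -> exists (b : 'I_n -> V) (A : {set 'I_n}),
  [/\ is_basis setT b, #|A| = i & S = sp b A].
Proof.
move=> /gr_compl[U SU].
have [_ [[b bb ->] /(base_subset_ofP bb)[A Ai [SA _]] _]] := cb_refl SU.
by exists b, A.
Qed.

Lemma compl_through U m x : grassmannian (n - m) U -> (0 < m <= n)%N -> ~ U x ->
  exists S, [/\ grassmannian m S, compl S U & S x].
Proof.
move=> Um mn nUx; have sU := gr_sub Um.
have I : lc [:: x] `&` U `<=` [set 0].
  move=> _ [/lc1P[c ->] Ux]; have [->|c0] := eqVneq c 0; first by rewrite scale0r.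
  by case: nUx; exact: scaleI Ux.
have [S xS US] := compl_extend (subspace_lc [:: x]) sU I.
exists S; split; last by apply/xS/lc_mem; rewrite inE.
  apply/grassmannianP; split; first by case: US.
  by have := compl_dim US; rewrite (gr_dim Um); lia.
exact: complC.
Qed.

End FiniteDim.
End LinearAlgebra.
Local Notation "A :+: B" := (sum_subspaces A B) (at level 52, left associativity).

(** * Descent to points *)

(** The fourth clause sends stars into stars and the fifth keeps the image of a pencil inside the
    sum of two of its members. Both are needed for the descent by one dimension; [chain] asks them
    of both inverse maps. *)
Definition half (R R' : unitRingType) (V : lmodType R) (W : lmodType R') (i : nat)
    (c : set V -> set W) (d : set W -> set V) : Prop :=
  [/\ forall S, grassmannian i S -> grassmannian i (c S),
      forall S, grassmannian i S -> d (c S) = S,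
      forall S T, adj i S T -> adj i (c S) (c T),
      forall Z, grassmannian i.-1 Z -> exists2 Z', grassmannian i.-1 Z' &
        forall S, grassmannian i S -> Z `<=` S -> Z' `<=` c S
    & forall S T X, adj i S T -> grassmannian i X -> S `&` T `<=` X ->
        X `<=` S :+: T -> c X `<=` c S :+: c T].

Section Descent.
Variables (R R' : unitRingType) (hR : division_ring R) (hR' : division_ring R').
Variables (V : lmodType R) (W : lmodType R') (n : nat).
Hypotheses (hV : has_dim n [set: V]) (hW : has_dim n [set: W]).

(** Pairwise adjacent subspaces share either a hyperplane or an enclosing sum. The third image, not
    inside the sum of the first two, excludes the latter, and the vertex of the image star is the
    intersection of two images. *)
Lemma star_image i (c : set V -> set W) Y S T X :
  (forall S, grassmannian i.+1 S -> grassmannian i.+1 (c S)) ->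
  (forall S T, adj i.+1 S T -> adj i.+1 (c S) (c T)) ->
  grassmannian i Y -> adj i.+1 S T -> adj i.+1 S X -> adj i.+1 T X ->
  Y `<=` S -> Y `<=` T -> Y `<=` X -> ~ c X `<=` c S :+: c T ->
  exists2 Y', grassmannian i Y' &
    forall Z, grassmannian i.+1 Z -> Y `<=` Z -> Y' `<=` c Z.
Proof.
move=> cG cA Yi ST SX TX YS YT YX nX.
exists (c S `&` c T).
  have [/gr_sub s1 /gr_sub s2 [e]] := cA _ _ ST.
  by apply/(grassmannianP hR' hW); split=> //; exact: subspaceI.
move=> Z Zi YZ.
have aux U : grassmannian i.+1 U -> Y `<=` U -> c Z = c U \/ adj i.+1 (c Z) (c U).
  move=> Ui YU; have [->|ZU] := pselect (Z = U); [by left|right]; apply: cA.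
  exact: (adj_of_sub hR hV Zi Ui Yi).
apply: (adj_star hR' hW (cA _ _ ST) (cA _ _ SX) (cA _ _ TX) nX).
- by apply: aux => //; case: ST.
- by apply: aux => //; case: ST.
by apply: aux => //; case: SX.
Qed.

(** [c1] sends the vertex of a star to the vertex of its image. The new maps are inverse since [Z]
    is the intersection of two members of its star. Adjacent [Z] and [Y] have images inside
    [c (Z :+: Y)], which is then their sum; hence pencils are respected. *)
Lemma descent_half i (c d : _) (c1 d1 : _) : (i.+2 < n)%N ->
  @half R R' V W i.+2 c d ->
  (forall Z, grassmannian i.+1 Z -> grassmannian i.+1 (c1 Z)) ->
  (forall Z, grassmannian i.+1 Z -> grassmannian i.+1 (d1 Z)) ->
  (forall Z S, grassmannian i.+1 Z -> grassmannian i.+2 S -> Z `<=` S -> c1 Z `<=` c S) ->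
  (forall Z S, grassmannian i.+1 Z -> grassmannian i.+2 S -> Z `<=` S -> d1 Z `<=` d S) ->
  half i.+1 c1 d1.
Proof.
move=> lt [cG dc cA cS cP] c1G d1G c1c d1d.
have subc U x : is_subspace U -> (lc [:: x] `<=` U) = U x.
  move=> sU; apply/propext; split=> [|Ux]; first by apply; apply: lc_mem; rewrite inE.
  by apply: lc_sub => // y; rewrite inE => /eqP->.
have K Z : grassmannian i.+1 Z -> d1 (c1 Z) = Z.
  move=> Zi; have [|x nx] := ex_notin hR hV Zi; first by lia.
  have Si := gr_cons hR hV Zi nx; set S := Z :+: _ in Si.
  have [|y ny] := ex_notin hR hV Si => //.
  have nzy : ~ Z y by move=> Zy; apply: ny; apply: sums_subl => //; exact: subspace_lc.
  have Ti := gr_cons hR hV Zi nzy; set T := Z :+: _ in Ti.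
  have ZS : Z `<=` S by apply: sums_subl; exact: subspace_lc.
  have ZT : Z `<=` T by apply: sums_subl; exact: subspace_lc.
  have ST : S <> T.
    move=> e; apply: ny; rewrite e; apply: sums_subr; first exact: gr_sub Zi.
    by apply: lc_mem; rewrite inE.
  have [_ _ [e]] := adj_of_sub hR hV Si Ti Zi ZS ZT ST.
  have sI := subspaceI (gr_sub Si) (gr_sub Ti).
  have IE : Z = S `&` T.
    apply: (dimv_eq hR hV) => //; [exact: gr_sub Zi|by move=> z Zz; split; [exact: ZS|exact: ZT]|].
    by rewrite e (gr_dim hR hV Zi).
  apply: (gr_eq hR hV (d1G _ (c1G _ Zi)) Zi) => z dz.
  rewrite IE -(dc _ Si) -(dc _ Ti).
  have cZS := c1c _ _ Zi Si ZS; have cZT := c1c _ _ Zi Ti ZT.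
  by split; apply: d1d dz => //; [exact: c1G|exact: cG|exact: c1G|exact: cG].
have A Z Y : adj i.+1 Z Y -> adj i.+1 (c1 Z) (c1 Y).
  move=> ZY; have [Zi Yi _] := ZY; have sZ := gr_sub Zi; have sY := gr_sub Yi.
  have Si : grassmannian i.+2 (Z :+: Y).
    by apply/(grassmannianP hR hV); split; [exact: subspace_sums|exact: (adj_dim hR hV ZY)].
  apply: (adj_of_sup hR' hW (c1G _ Zi) (c1G _ Yi) (cG _ Si)).
  - by apply: c1c => //; exact: sums_subl.
  - by apply: c1c => //; exact: sums_subr.
  by move=> e; apply: (adj_neq hR hV ZY); rewrite -(K _ Zi) e K.
have sumE Z Y : adj i.+1 Z Y -> c (Z :+: Y) = c1 Z :+: c1 Y.
  move=> ZY; have [Zi Yi _] := ZY; have sZ := gr_sub Zi; have sY := gr_sub Yi.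
  have Si : grassmannian i.+2 (Z :+: Y).
    by apply/(grassmannianP hR hV); split; [exact: subspace_sums|exact: (adj_dim hR hV ZY)].
  have sZ' := gr_sub (c1G _ Zi); have sY' := gr_sub (c1G _ Yi).
  apply/esym/(dimv_eq hR' hW); [exact: subspace_sums|exact: gr_sub (cG _ Si)| |].
    apply: sums_sub; first exact: gr_sub (cG _ Si).
      by apply: c1c => //; exact: sums_subl.
    by apply: c1c => //; exact: sums_subr.
  by rewrite (adj_dim hR' hW (A _ _ ZY)) (gr_dim hR' hW (cG _ Si)).
split=> //.
  move=> Y Yi; have [|x nx] := ex_notin hR hV Yi; first by rewrite /=; lia.
  rewrite /= in Yi; have Si := gr_cons hR hV Yi nx; set S := Y :+: _ in Si.
  have [|y ny] := ex_notin hR hV Si; first by lia.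
  have nYy : ~ Y y by move=> Zy; apply: ny; apply: sums_subl => //; exact: subspace_lc.
  have Ti := gr_cons hR hV Yi nYy; set T := Y :+: _ in Ti.
  have YS : Y `<=` S by apply: sums_subl; exact: subspace_lc.
  have YT : Y `<=` T by apply: sums_subl; exact: subspace_lc.
  have sY := gr_sub Yi; have Ty : T y by apply: sums_subr => //; apply: lc_mem; rewrite inE.
  have nST : S <> T by move=> e; apply: ny; rewrite e.
  have ST := adj_of_sub hR hV Si Ti Yi YS YT nST.
  have sS := gr_sub Si; have sT := gr_sub Ti; have sST := subspace_sums sS sT.
  have STi : grassmannian i.+2 (S :+: T).
    by apply/(grassmannianP hR hV); split => //; exact: (adj_dim hR hV ST).
  have [|z nz] := ex_notin hR hV STi => //.
  have nYz : ~ Y z by move=> Yz; apply: nz; apply: sums_subl => //; exact: YS.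
  have Xi := gr_cons hR hV Yi nYz; set X := Y :+: _ in Xi.
  have YX : Y `<=` X by apply: sums_subl; exact: subspace_lc.
  have Xz : X z by apply: sums_subr => //; apply: lc_mem; rewrite inE.
  have nSX : S <> X by move=> e; apply: nz; apply: sums_subl => //; rewrite e.
  have nTX : T <> X by move=> e; apply: nz; apply: sums_subr => //; rewrite e.
  have SX := adj_of_sub hR hV Si Xi Yi YS YX nSX.
  have TX := adj_of_sub hR hV Ti Xi Yi YT YX nTX.
  apply: (@star_image i c1 Y S T X) => //.
  (* If the third image were inside the sum of the first two, applying [d1] would put [X] inside
     [S :+: T]. *)
  rewrite -sumE // => h; apply: nz; rewrite -(dc _ STi).
  by apply: (d1d (c1 X)); [exact: c1G|exact: cG|exact: h|rewrite K].
move=> Z Y X ZY Xi _ XZY; rewrite -sumE //.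
have [/gr_sub sZ /gr_sub sY _] := ZY.
apply: c1c => //; apply/(grassmannianP hR hV).
by split; [exact: subspace_sums|exact: (adj_dim hR hV ZY)].
Qed.

End Descent.

Definition chain (R R' : unitRingType) (V : lmodType R) (W : lmodType R') (i : nat)
  (c : set V -> set W) (d : set W -> set V) : Prop := half i c d /\ half i d c.

Section Incidence.
Variables (R R' : unitRingType) (hR : division_ring R) (hR' : division_ring R').
Variables (V : lmodType R) (W : lmodType R') (n : nat).
Hypotheses (hV : has_dim n [set: V]) (hW : has_dim n [set: W]).

Lemma star_choice (R1 R2 : unitRingType) (V1 : lmodType R1) (V2 : lmodType R2) i
    (c : set V1 -> set V2) d : half i.+1 c d ->
  exists c1, (forall Z, grassmannian i Z -> grassmannian i (c1 Z)) /\
   forall Z S, grassmannian i Z -> grassmannian i.+1 S -> Z `<=` S -> c1 Z `<=` c S.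
Proof.
case=> _ _ _ h _.
have H Z : exists Z', grassmannian i Z -> grassmannian i Z' /\
    forall S, grassmannian i.+1 S -> Z `<=` S -> Z' `<=` c S.
  have [Zi|nZ] := pselect (grassmannian i Z); last by exists classical_sets.set0 => /nZ.
  by have [Z' Z'i Z'P] := h _ Zi; exists Z'.
have [c1 c1P] := choice H.
exists c1; split=> [Z /c1P[]//|Z S Zi Si ZS].
by have [_] := c1P Z Zi; exact.
Qed.

Lemma descent i (c : set V -> set W) d : (i.+2 < n)%N -> chain i.+2 c d ->
  exists c1 d1, [/\ chain i.+1 c1 d1,
    forall Z S, grassmannian i.+1 Z -> grassmannian i.+2 S -> Z `<=` S -> c1 Z `<=` c S &
    forall Z S, grassmannian i.+1 Z -> grassmannian i.+2 S -> Z `<=` S -> d1 Z `<=` d S].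
Proof.
move=> lt [cd dc]; have [c1 [c1G c1c]] := star_choice cd.
have [d1 [d1G d1d]] := star_choice dc; exists c1, d1; split=> //; split.
  exact: (descent_half hR hR' hV hW lt cd).
exact: (descent_half hR' hR hW hV lt dc).
Qed.

Lemma chain_points i (c : set V -> set W) d : (i.+1 < n)%N -> chain i.+1 c d ->
  exists c1 d1, [/\ chain 1 c1 d1,
    forall Z S, grassmannian 1 Z -> grassmannian i.+1 S -> Z `<=` S -> c1 Z `<=` c S &
    forall Z S, grassmannian 1 Z -> grassmannian i.+1 S -> Z `<=` S -> d1 Z `<=` d S].
Proof.
elim: i c d => [|i IHi] c d lt cd.
  exists c, d; split=> // Z S Z1 S1 ZS.
    by rewrite (gr_eq hR hV Z1 S1 ZS).
  by rewrite (gr_eq hR' hW Z1 S1 ZS).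
have [c2 [d2 [cd2 c2c d2d]]] := descent lt cd.
have [|c1 [d1 [cd1 c1c d1d]]] := IHi c2 d2 _ cd2; first by lia.
exists c1, d1; split=> // Z S Z1 Si ZS.
  have [|X [Xi ZX XS]] := gr_between hR hV (m := i.+1) Z1 Si ZS; first by lia.
  by apply: subset_trans (c2c _ _ Xi Si XS); exact: c1c.
have [|X [Xi ZX XS]] := gr_between hR' hW (m := i.+1) Z1 Si ZS; first by lia.
by apply: subset_trans (d2d _ _ Xi Si XS); exact: d1d.
Qed.

End Incidence.

(** * Maps of pairs that act componentwise *)

Lemma direct_lift (R : unitRingType) (V : lmodType R) (n k : nat) (T1 T2 : pointedType)
    (F : set V * set V -> T1 * T2) : direct n k F ->
  exists g h, forall S U, compl_pairs n k (S, U) -> F (S, U) = (g S, h U).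
Proof.
move=> dF.
have Hg S : exists S', forall U, compl_pairs n k (S, U) -> (F (S, U)).1 = S'.
  have [[U SU]|nU] := pselect (exists U, compl_pairs n k (S, U)).
    by exists (F (S, U)).1 => U' SU'; apply: (dF (S, U') (S, U) SU' SU).1.
  by exists point => U SU; case: nU; exists U.
have Hh U : exists U', forall S, compl_pairs n k (S, U) -> (F (S, U)).2 = U'.
  have [[S SU]|nS] := pselect (exists S, compl_pairs n k (S, U)).
    by exists (F (S, U)).2 => S' SU'; apply: (dF (S', U) (S, U) SU' SU).2.
  by exists point => S SU; case: nS; exists S.
have [g gP] := choice Hg; have [h hP] := choice Hh.
exists g, h => S U SU; rewrite [LHS]surjective_pairing.
by rewrite (gP S U SU) (hP U S SU).
Qed.

Definition pairmap (R R' : unitRingType) (V : lmodType R) (W : lmodType R')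
    (n k : nat) (g h : set V -> set W) (g' h' : set W -> set V) : Prop :=
  [/\ forall S U, compl_pairs n k (S, U) -> compl_pairs n k (g S, h U),
      forall S, grassmannian k S -> g' (g S) = S
    & forall U, grassmannian (n - k) U -> h' (h U) = U].

Section TopHalf.
Variables (R R' : unitRingType) (hR : division_ring R) (hR' : division_ring R').
Variables (V : lmodType R) (W : lmodType R') (n k : nat).
Hypotheses (hV : has_dim n [set: V]) (hW : has_dim n [set: W]).
Variables (g h : set V -> set W) (g' h' : set W -> set V).
Hypotheses (gh : pairmap n k g h g' h') (gh' : pairmap n k g' h' g h).
Hypothesis kn : (k < n)%N.

Let kle : (k <= n)%N. Proof. exact: ltnW. Qed.

Lemma pairmap_gr S : grassmannian k S -> grassmannian k (g S).
Proof.
move=> Sk; have [U SU] := gr_compl hR hV Sk.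
by case: gh => h1 _ _; case: (h1 _ _ SU).
Qed.

Lemma gr_pairs (S U : set V) : grassmannian k S -> compl S U -> compl_pairs n k (S, U).
Proof.
move=> Sk SU; apply/(compl_pairsP hR hV) => //; split=> //.
exact: (gr_dim hR hV Sk).
Qed.

Lemma pairmap_compl (S U : set V) : grassmannian k S -> compl S U -> compl (g S) (h U).
Proof.
move=> Sk SU; case: gh => h1 _ _.
have := h1 _ _ (gr_pairs Sk SU).
by move/(compl_pairs_compl hR' hW).
Qed.

Lemma pairmap_compl_inv S U : grassmannian k S -> compl (g S) U ->
  h (h' U) = U /\ compl S (h' U).
Proof.
move=> Sk SU; have gSk := pairmap_gr Sk.
have gSU : compl_pairs n k (g S, U).
  by apply/(compl_pairsP hR' hW) => //; split=> //; exact: (gr_dim hR' hW gSk).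
case: gh' => h1 _ h3; case: gh => _ g'g _; split.
  by apply: h3; case: gSU.
have := h1 _ _ gSU; rewrite g'g // => /(compl_pairs_compl hR hV).
by [].
Qed.

Lemma pairmap_inj S T : grassmannian k S -> grassmannian k T -> g S = g T -> S = T.
Proof. by case: gh => _ g'g _ Sk Tk e; rewrite -(g'g S) // e g'g. Qed.

(** Every complement of [g X] is the image under [h] of a complement of [X], so the description of
    pencils by complements carries over. *)
Lemma pairmap_pencil S T X : adj k S T -> grassmannian k X -> S `&` T `<=` X ->
  X `<=` S :+: T -> X <> S -> X <> T ->
  adj k (g S) (g T) /\ g X `<=` g S :+: g T.
Proof.
move=> ST Xk IX XST XS XT; have [Sk Tk _] := ST.
have nST := adj_neq hR hV ST.
apply: (compl_pencil hR' hW (pairmap_gr Sk) (pairmap_gr Tk) (pairmap_gr Xk)).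
- by move/(pairmap_inj Sk Tk).
- by move/(pairmap_inj Sk Xk)/esym.
- by move/(pairmap_inj Tk Xk)/esym.
move=> U /(pairmap_compl_inv Xk)[UE XU]; rewrite -UE.
have [SU|TU] := pencil_compl hR hV ST Xk IX XST XU; [left|right];
  exact: pairmap_compl.
Qed.

Lemma pairmap_adj S T : adj k S T -> adj k (g S) (g T).
Proof.
move=> ST; have [X [Xk XS XT IX XST]] := pencil_third hR hV ST.
by have [] := pairmap_pencil ST Xk IX XST XS XT.
Qed.

Lemma pairmap_pen S T X : adj k S T -> grassmannian k X -> S `&` T `<=` X ->
  X `<=` S :+: T -> g X `<=` g S :+: g T.
Proof.
move=> ST Xk IX XST; have [Sk Tk _] := ST.
have sS := gr_sub (pairmap_gr Sk); have sT := gr_sub (pairmap_gr Tk).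
have [->|XS] := pselect (X = S); first exact: sums_subl.
have [->|XT] := pselect (X = T); first exact: sums_subr.
by have [] := pairmap_pencil ST Xk IX XST XS XT.
Qed.

End TopHalf.

Section Star.
Variables (R R' : unitRingType) (hR : division_ring R) (hR' : division_ring R').
Variables (V : lmodType R) (W : lmodType R') (n k : nat).
Hypotheses (hV : has_dim n [set: V]) (hW : has_dim n [set: W]).
Variable (c : set V -> set W).
Hypotheses (cG : forall S, grassmannian k.+1 S -> grassmannian k.+1 (c S))
  (cA : forall S T, adj k.+1 S T -> adj k.+1 (c S) (c T))
  (cI : forall S T, grassmannian k.+1 S -> grassmannian k.+1 T -> c S = c T -> S = T).
Hypothesis c_frame : forall b : 'I_n -> V, is_basis setT b ->
  exists2 e : 'I_n -> W, is_basis setT e &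
  forall A : {set 'I_n}, #|A| = k.+1 -> exists2 B : {set 'I_n}, #|B| = k.+1 & c (sp b A) = sp e B.
Hypothesis k2n : (2 * k.+1 < n)%N.

(* In a frame, the star of [Z] contains [n - k] members, too many to be mapped
   into the [k + 2] coordinate subspaces of a single one of dimension [k + 2]. *)
Lemma frame_star Z : grassmannian k Z -> exists2 Z', grassmannian k Z' &
  forall S, grassmannian k.+1 S -> Z `<=` S -> Z' `<=` c S.
Proof.
move=> Zk; have [b [A0 [bb A0k ZE]]] := gr_basis hR hV Zk.
have [e ee eP] := c_frame bb.
pose S (x : 'I_n) := sp b (x |: A0).
have cardS x : x \notin A0 -> #|x |: A0| = k.+1 by move=> xA; rewrite cardsU1 xA A0k.
have SG x : x \notin A0 -> grassmannian k.+1 (S x).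
  move=> xA; apply/(grassmannianP hR hV); split; first exact: subspace_sp.
  by rewrite (dimv_sp hR hV bb) cardS.
have ZS x : Z `<=` S x by rewrite ZE; apply: (spS bb); exact: finset.subsetUr.
have S_inj x y : x \notin A0 -> S x = S y -> x = y.
  move=> xA /(sp_inj bb)/setP/(_ x); rewrite !inE eqxx (negPf xA) !orbF.
  by move/esym/eqP.
have Sadj x y : x \notin A0 -> y \notin A0 -> x != y -> adj k.+1 (S x) (S y).
  move=> xA yA xy; apply: (adj_of_sub hR hV (SG x xA) (SG y yA) Zk) => //.
  by move/(S_inj x y xA)/eqP; exact/negP.
have cardA0 : #|~: A0| = (n - k)%N by rewrite cardsCs finset.setCK card_ord A0k.
have /card_gt0P[x xA] : (0 < #|~: A0|)%N by rewrite cardA0; lia.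
have /card_gt0P[y] : (0 < #|~: A0 :\ x|)%N.
  by have := cardsD1 x (~: A0); rewrite xA cardA0; lia.
rewrite !inE => /andP[yx yA]; rewrite inE in xA.
have xy : x != y by rewrite eq_sym.
(* Either a third member of the star has its image outside the sum of the first two, and
   [star_image] applies, or the images of all [n - k] members lie in that sum. *)
have [[z [zA nz]]|h] :=
    pselect (exists z, z \notin A0 /\ ~ c (S z) `<=` sum_subspaces (c (S x)) (c (S y))).
  have sxy := Sadj x y xA yA xy; have [cx cy _] := cA sxy.
  have sx := gr_sub cx; have sy := gr_sub cy.
  have xz : x != z by apply: contra_notN nz => /eqP <-; exact: sums_subl.
  have yz : y != z by apply: contra_notN nz => /eqP <-; exact: sums_subr.
  by apply: (star_image hR hR' hV hW cG cA Zk sxy (Sadj x z xA zA xz) (Sadj y z yA zA yz)).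
exfalso.
have [Bx Bxk BxE] := eP _ (cardS x xA); have [By Byk ByE] := eP _ (cardS y yA).
pose D := (Bx :|: By)%SET.
have DE : sum_subspaces (c (S x)) (c (S y)) = sp e D.
  by rewrite [c (S x)]BxE [c (S y)]ByE (spU ee).
have Dk : #|D| = k.+2.
  rewrite -(dimv_sp hR' hW ee) -DE; apply: (adj_dim hR' hW).
  exact/cA/Sadj.
have HB z : exists B : {set 'I_n}, z \notin A0 -> #|B| = k.+1 /\ c (S z) = sp e B.
  have [zA|zA] := boolP (z \in A0); first by exists finset.set0.
  by have [B Bk BE] := eP _ (cardS z zA); exists B.
have [B BP] := choice HB.
have Binj : {in ~: A0 &, injective B}.
  move=> z1 z2; rewrite !inE => z1A z2A e12; apply: (S_inj z1 z2 z1A).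
  apply: cI; [exact: SG|exact: SG|].
  by rewrite (BP z1 z1A).2 (BP z2 z2A).2 e12.
have : ([set B z | z in ~: A0] \subset [set B : {set 'I_n} | B \subset D & #|B| == k.+1])%SET.
  apply/fintype.subsetP => _ /imsetP[z zA ->]; rewrite inE in zA.
  have [Bk BE] := BP z zA; rewrite inE Bk eqxx andbT.
  apply/(spSP ee); rewrite -BE -DE; apply: contrapT => nz; apply: h.
  by exists z.
(* A set of [k + 2] indices has [k + 2] subsets of size [k + 1]; the resulting [n - k <= k + 2]
   contradicts [2 * (k + 1) < n]. *)
move/subset_leq_card; rewrite card_in_imset // cardA0 cards_draws Dk binSn.
lia.
Qed.

End Star.

Section Top.
Variables (R R' : unitRingType) (hR : division_ring R) (hR' : division_ring R').
Variables (V : lmodType R) (W : lmodType R') (n k : nat).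
Hypotheses (hV : has_dim n [set: V]) (hW : has_dim n [set: W]).

Lemma pairmap_half (g h : set V -> set W) (g' h' : set W -> set V) :
  pairmap n k.+1 g h g' h' -> pairmap n k.+1 g' h' g h -> (2 * k.+1 < n)%N ->
  (forall b : 'I_n -> V, is_basis setT b ->
    exists2 e : 'I_n -> W, is_basis setT e &
    forall A : {set 'I_n}, #|A| = k.+1 ->
      exists2 B : {set 'I_n}, #|B| = k.+1 & g (sp b A) = sp e B) ->
  half k.+1 g g'.
Proof.
move=> gh gh' k2n frame; have kn : (k.+1 < n)%N by lia.
have gG S := pairmap_gr hR hV gh (S := S).
have gA S T := pairmap_adj hR hR' hV hW gh gh' kn (S := S) (T := T).
split=> //.
- by case: gh.
- apply: (frame_star hR hR' hV hW) => // S T Sk Tk.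
  exact: (pairmap_inj gh).
exact: (pairmap_pen hR hR' hV hW gh gh' kn).
Qed.

End Top.
(** * The fundamental theorem of projective geometry *)

Section Morphisms.
Variables (R R' : unitRingType) (s : R -> R').
Hypotheses (sB : forall a b, s (a - b) = s a - s b).
Hypotheses (sM : forall a b, s (a * b) = s a * s b) (s1 : s 1 = 1).

Fact mk_monoid_morphism : GRing.monoid_morphism s. Proof. by split. Qed.

Definition mk_rmorphism : {rmorphism R -> R'} :=
  HB.pack_for {rmorphism R -> R'} s (GRing.isZmodMorphism.Build R R' s sB)
    (GRing.isMonoidMorphism.Build R R' s mk_monoid_morphism).

Variables (V : lmodType R) (W : lmodType R') (l : V -> W).
Hypothesis l_lin : forall a x y, l (a *: x + y) = s a *: l x + l y.

Definition mk_semilinear : {linear V -> W | mk_rmorphism \; *:%R} :=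
  HB.pack_for {linear V -> W | mk_rmorphism \; *:%R} l
    (GRing.isLinear.Build R V W (mk_rmorphism \; *:%R) l l_lin).
End Morphisms.

Section FundamentalTheorem.
Variables (R R' : unitRingType) (hR : division_ring R) (hR' : division_ring R').
Variables (V : lmodType R) (W : lmodType R') (n : nat).
Hypotheses (hV : has_dim n [set: V]) (hW : has_dim n [set: W]) (n3 : (2 < n)%N).
Variables (c : set V -> set W) (d : set W -> set V).
Hypothesis cd : chain 1 c d.

Notation "<[ x ]>" := (lc [:: x]) (format "<[ x ]>").

Lemma line_gr (R1 : unitRingType) (V1 : lmodType R1) (x : V1) :
  division_ring R1 -> x != 0 -> grassmannian 1 <[x]>.
Proof.
move=> hR1 x0; split; first exact: subspace_lc.
apply/(has_dimP hR1); exists [:: x]; split=> //; split=> //.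
by move=> /eqP; exact/negP.
Qed.

Lemma gr_line (R1 : unitRingType) (V1 : lmodType R1) (X : set V1) :
  division_ring R1 -> grassmannian 1 X -> exists2 x, x != 0 & X = <[x]>.
Proof.
move=> hR1 [_ /(has_dimP hR1)[[|x [|y s]] [// _ [nx _] <-]]].
by exists x => //; apply/eqP.
Qed.

Lemma mem_line (R1 : unitRingType) (V1 : lmodType R1) (x : V1) : <[x]> x.
Proof. by apply: lc_mem; rewrite inE. Qed.

Lemma line_sub (R1 : unitRingType) (V1 : lmodType R1) (X : set V1) x :
  is_subspace X -> X x -> <[x]> `<=` X.
Proof. by move=> sX Xx; apply: lc_sub => // y; rewrite inE => /eqP->. Qed.

Lemma line_eq (R1 : unitRingType) (V1 : lmodType R1) (x y : V1) :
  division_ring R1 -> y != 0 -> <[x]> y -> <[x]> = <[y]>.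
Proof.
move=> hR1 y0 /lc1P[a yE].
have a0 : a != 0 by apply: contraNneq y0 => a0; rewrite yE a0 scale0r.
apply/seteqP; split; apply: line_sub; [exact: subspace_lc| |exact: subspace_lc|].
  by apply/lc1P; exists a^-1; rewrite yE scalerA mulVr ?scale1r //; exact: hR1.
by apply/lc1P; exists a.
Qed.

Lemma adj1 (R1 R2 : unitRingType) (V1 : lmodType R1) (V2 : lmodType R2)
    (hR1 : division_ring R1) (hV1 : has_dim n [set: V1]) c1 d1 (x y z : V1) :
  @half R1 R2 V1 V2 1 c1 d1 -> x != 0 -> y != 0 -> z != 0 ->
  (<[x]> :+: <[y]>) z -> c1 <[z]> `<=` c1 <[x]> :+: c1 <[y]>.
Proof.
move=> [cG _ cA _ cP] x0 y0 z0 xyz.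
have gx := line_gr hR1 x0; have gy := line_gr hR1 y0; have gz := line_gr hR1 z0.
have sx := subspace_lc [:: x]; have sy := subspace_lc [:: y].
have scx := gr_sub (cG _ gx).
have [xy|nxy] := pselect (<[x]> = <[y]>).
  have -> : <[z]> = <[x]>.
    apply/esym/line_eq => //; case: xyz => u xu [v]; rewrite -xy => xv <-.
    exact: subspaceD.
  by apply: sums_subl; exact: gr_sub (cG _ gy).
have nyx : ~ <[x]> y by move=> /(line_eq hR1 y0).
apply: cP => //; last exact: (line_sub (subspace_sums sx sy)).
- split=> //; congr _.+1.
  have -> : <[x]> `&` <[y]> = lc [::].
    apply/seteqP; split=> [u [xu /lc1P[b uE]]|_ ->]; last by split; exact: subspace0.
    have [b0|b0] := eqVneq b 0; first by rewrite uE b0 scale0r.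
    by case: nyx; apply: (scaleI hR1 sx b0); rewrite -uE.
  by rewrite (dimv_lc hR1 hV1).
move=> u [xu /lc1P[b uE]]; have [b0|b0] := eqVneq b 0.
  by rewrite uE b0 scale0r; apply: subspace0; exact: subspace_lc.
by case: nyx; apply: (scaleI hR1 sx b0); rewrite -uE.
Qed.

Let cG S : grassmannian 1 S -> grassmannian 1 (c S).
Proof. by case: cd => -[+ _ _ _ _] _; apply. Qed.
Let dG S : grassmannian 1 S -> grassmannian 1 (d S).
Proof. by case: cd => _ [+ _ _ _ _]; apply. Qed.
Let dc S : grassmannian 1 S -> d (c S) = S.
Proof. by case: cd => -[_ + _ _ _] _; apply. Qed.
Let dK S : grassmannian 1 S -> c (d S) = S.
Proof. by case: cd => _ [_ + _ _ _]; apply. Qed.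
Let Rx x : x != 0 -> is_subspace (c <[x]>).
Proof. by move=> x0; apply/gr_sub/cG/line_gr. Qed.

Lemma image_line x w : x != 0 -> w != 0 -> c <[x]> w -> c <[x]> = <[w]>.
Proof.
move=> x0 w0; have [v v0 ->] := gr_line hR' (cG (line_gr hR x0)).
exact: line_eq.
Qed.

Lemma image_reflect x y z w : x != 0 -> y != 0 -> z != 0 -> w != 0 ->
  c <[z]> w -> (c <[x]> :+: c <[y]>) w -> (<[x]> :+: <[y]>) z.
Proof.
move=> x0 y0 z0 w0 zw xyw.
have [u u0 uE] := gr_line hR' (cG (line_gr hR x0)).
have [v v0 vE] := gr_line hR' (cG (line_gr hR y0)).
rewrite uE vE in xyw.
have := adj1 hR' hW cd.2 u0 v0 w0 xyw.
rewrite -uE -vE -(image_line z0 w0 zw) !dc; try exact: line_gr.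
by apply; exact: mem_line.
Qed.

Lemma image_disjoint x y w : x != 0 -> y != 0 -> ~ <[x]> y ->
  c <[x]> w -> c <[y]> w -> w = 0.
Proof.
move=> x0 y0 nxy xw yw; apply: contrapT => /eqP w0; apply: nxy.
rewrite -[<[x]>]dc; last exact: line_gr.
rewrite (image_line x0 w0 xw) -(image_line y0 w0 yw) dc; last exact: line_gr.
exact: mem_line.
Qed.

Variable b : 'I_n -> V.
Hypothesis bb : is_basis setT b.
Let i0 : 'I_n := Ordinal (ltnW (ltnW n3)).
Let x0 := b i0.
Let H : set V := [set x | co b i0 x = 0].
Variable w0 : W.
Hypotheses (w0N0 : w0 != 0) (w0P : c <[x0]> w0).

Let x0N0 : x0 != 0. Proof. exact/eqP/(basis_neq0 bb). Qed.
Let cox0 : co b i0 x0 = 1. Proof. by rewrite (co_b bb) eqxx. Qed.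
Let sH : is_subspace H.
Proof.
apply/subspaceP; split; first exact: (co0 bb).
by move=> a u v Hu Hv; rewrite /H /= (coD bb) (coZ bb) Hu Hv mulr0 addr0.
Qed.

Let nHx0 : ~ H x0.
Proof. by rewrite /H /= cox0 => /eqP; rewrite oner_eq0. Qed.

Let nline y : H y -> ~ <[y]> x0.
Proof. by move=> Hy /(line_sub sH Hy). Qed.

Let addx0 y : H y -> x0 + y != 0.
Proof.
move=> Hy; apply/eqP => e; apply: nHx0.
by move/eqP: e; rewrite addr_eq0 => /eqP ->; exact: subspaceN.
Qed.

Let nline_add y : H y -> y != 0 -> ~ <[x0 + y]> y.
Proof.
move=> Hy y0 /lc1P[a yE]; have : co b i0 y = 0 by [].
rewrite yE (coZ bb) (coD bb) cox0 [co b i0 y](_ : _ = 0) // addr0 mulr1 => a0.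
by move/eqP: y0; apply; rewrite yE a0 scale0r.
Qed.

(* The hyperplane [H] is at infinity and [w0] is the image of the origin: a vector
   y of [H] is recovered from the image of the affine point x0 + y. *)
Definition lift (y : V) : W :=
  if y == 0 then 0 else xget 0 [set w | c <[y]> w /\ c <[x0 + y]> (w0 + w)].

(** A generator of the image of the line of [x0 + y] is [a *: w0 + w]. Here [a] is nonzero because
    [c] is injective on lines, and dividing by it normalises the first term. *)
Lemma lift_ex y : H y -> y != 0 -> exists w, c <[y]> w /\ c <[x0 + y]> (w0 + w).
Proof.
move=> Hy y0; have p0 := addx0 Hy.
have [v v0 vE] := gr_line hR' (cG (line_gr hR p0)).
have : (c <[x0]> :+: c <[y]>) v.
  apply: (adj1 hR hV cd.1 x0N0 y0 p0); last by rewrite vE; exact: mem_line.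
  by apply: sums_intro; exact: mem_line.
case=> u; rewrite (image_line x0N0 w0N0 w0P) => /lc1P[a ->] [w yw vw].
have a0 : a != 0.
  apply/eqP => a0; apply: (nline_add Hy y0).
  have vy : c <[y]> v by rewrite -vw a0 scale0r add0r.
  rewrite -[<[x0 + y]>]dc; last exact: line_gr.
  rewrite (image_line p0 v0) -?(image_line y0 v0 vy) ?dc; last 2 first.
  - exact: line_gr.
  - by rewrite vE; exact: mem_line.
  exact: mem_line.
exists (a^-1 *: w); split; first exact: (subspaceZ _ (Rx y0)).
rewrite vE; apply/lc1P; exists a^-1; rewrite -vw scalerDr scalerA mulVr ?scale1r //.
exact: hR'.
Qed.

Lemma lift0 : lift 0 = 0.
Proof. by rewrite /lift eqxx. Qed.

Lemma liftP y : H y -> y != 0 -> c <[y]> (lift y) /\ c <[x0 + y]> (w0 + lift y).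
Proof.
move=> Hy y0; rewrite /lift (negPf y0); have [w h] := lift_ex Hy y0.
exact: (xgetI 0 (h : [set w | c <[y]> w /\ c <[x0 + y]> (w0 + w)] w)).
Qed.

Lemma lift_uniq y w : H y -> y != 0 ->
  c <[y]> w -> c <[x0 + y]> (w0 + w) -> lift y = w.
Proof.
move=> Hy y0 yw pw; have [yl pl] := liftP Hy y0; have p0 := addx0 Hy.
apply/eqP; rewrite -subr_eq0; apply/eqP.
apply: (image_disjoint p0 y0 (nline_add Hy y0)); last exact: (subspaceB (Rx y0)).
have -> : lift y - w = (w0 + lift y) - (w0 + w) by rewrite opprD addrACA subrr add0r.
exact: (subspaceB (Rx p0)).
Qed.

Lemma lift_base y : H y -> w0 + lift y != 0.
Proof.
move=> Hy; have [->|y0] := eqVneq y 0; first by rewrite lift0 addr0.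
apply/eqP => /eqP; rewrite addr_eq0 => /eqP w0E; apply: (nline Hy).
have yw : c <[y]> w0.
  by rewrite w0E; apply: (subspaceN (Rx y0)); exact: (liftP Hy y0).1.
apply: contrapT => nyx; move/eqP: w0N0; apply.
exact: (image_disjoint y0 x0N0 nyx).
Qed.

Lemma lift_neq0 y : H y -> y != 0 -> lift y != 0.
Proof.
move=> Hy y0; apply/eqP => l0; have [_] := liftP Hy y0; rewrite l0 addr0 => pw.
move/eqP: w0N0; apply; apply: (image_disjoint (addx0 Hy) x0N0 _ pw w0P).
move=> /lc1P[a xE]; have := cox0; rewrite xE (coZ bb) (coD bb) cox0.
rewrite [co b i0 y](_ : _ = 0) // addr0 mulr1 => a1; move: xE; rewrite a1 scale1r.
by rewrite -{1}[x0]addr0 => /addrI/esym/eqP; exact/negP.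
Qed.

Lemma lift_line y : H y -> y != 0 -> c <[y]> = <[lift y]>.
Proof.
by move=> Hy y0; apply: image_line; [|exact: lift_neq0|exact: (liftP Hy y0).1].
Qed.

Lemma lift_line_add y : H y -> c <[x0 + y]> = <[w0 + lift y]>.
Proof.
move=> Hy; apply: image_line; [exact: addx0|exact: lift_base|].
have [->|y0] := eqVneq y 0; first by rewrite lift0 !addr0.
exact: (liftP Hy y0).2.
Qed.

(** Were [w0] in the sum of the images of two lines of [H], [image_reflect] would put [x0] in [H].
    The images of distinct lines meet trivially, which settles the other two coefficients. *)
Lemma lift_indep y z (a e f : R') : H y -> H z -> y != 0 -> z != 0 -> ~ <[y]> z ->
  a *: w0 + e *: lift y + f *: lift z = 0 -> [/\ a = 0, e = 0 & f = 0].
Proof.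
move=> Hy Hz y0 z0 nyz.
have sy := Rx y0; have sz := Rx z0.
have yl e' : c <[y]> (e' *: lift y) by apply: (subspaceZ _ sy); exact: (liftP Hy y0).1.
have zl e' : c <[z]> (e' *: lift z) by apply: (subspaceZ _ sz); exact: (liftP Hz z0).1.
have [->|a0] := eqVneq a 0; last first.
  move=> /eqP; rewrite -addrA addr_eq0 => /eqP E; exfalso.
  have aw : a *: w0 != 0.
    by apply/eqP => aw; move/eqP: a0; apply; exact: (scaler_eq0_div hR' aw w0N0).
  have xw : c <[x0]> (a *: w0) by exact: (subspaceZ _ (Rx x0N0)).
  have yzw : (c <[y]> :+: c <[z]>) (a *: w0).
    by rewrite E opprD -!scaleNr; exact: sums_intro.
  have [u /(line_sub sH Hy) Hu [v /(line_sub sH Hz) Hv uv]] :=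
    image_reflect y0 z0 x0N0 aw xw yzw.
  by apply: nHx0; rewrite -uv; exact: subspaceD.
rewrite scale0r add0r => /eqP; rewrite addr_eq0 => /eqP E.
have e0 : e *: lift y = 0.
  apply: (image_disjoint y0 z0 nyz (yl _)); rewrite E -scaleNr; exact: zl.
split=> //; first exact: (scaler_eq0_div hR' e0 (lift_neq0 Hy y0)).
apply: (scaler_eq0_div hR' _ (lift_neq0 Hz z0)).
by apply/eqP; rewrite -oppr_eq0 -E e0.
Qed.

(** A parallelogram argument: the affine point x0 + y + z lies on the line through x0 + y in
    direction z and on that through x0 + z in direction y. Independence of [w0], [lift y] and
    [lift z] fixes the coefficients. *)
Lemma lift_add_indep y z : H y -> H z -> y != 0 -> z != 0 -> ~ <[y]> z ->
  lift (y + z) = lift y + lift z.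
Proof.
move=> Hy Hz y0 z0 nyz; have Hyz := subspaceD sH Hy Hz.
have yz0 : y + z != 0.
  apply/eqP => /eqP; rewrite addrC addr_eq0 => /eqP zE; apply: nyz; rewrite zE.
  by apply: subspaceN; [exact: subspace_lc|exact: mem_line].
have p0 := addx0 Hyz.
have [v v0 vE] := gr_line hR' (cG (line_gr hR p0)).
have pv : c <[x0 + (y + z)]> v by rewrite vE; exact: mem_line.
have main : c <[x0 + (y + z)]> (w0 + (lift y + lift z)).
  have : (c <[x0 + y]> :+: c <[z]>) v.
    apply: (adj1 hR hV cd.1 (addx0 Hy) z0 p0) => //.
    by rewrite addrA; apply: sums_intro; exact: mem_line.
  rewrite lift_line_add // lift_line // => -[_ /lc1P[a ->] [_ /lc1P[e ->] v1]].
  have : (c <[x0 + z]> :+: c <[y]>) v.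
    apply: (adj1 hR hV cd.1 (addx0 Hz) y0 p0) => //.
    by rewrite [y + z]addrC addrA; apply: sums_intro; exact: mem_line.
  rewrite lift_line_add // lift_line // => -[_ /lc1P[f ->] [_ /lc1P[g ->] v2]].
  have [|a_f a_g e_f] := @lift_indep y z (a - f) (a - g) (e - f) Hy Hz y0 z0 nyz.
    rewrite !scalerBl (addrACA (a *: w0)) (addrACA (a *: w0 + _)) -!opprD -scalerDr v1 -v2 scalerDr.
    by rewrite [X in _ - X]addrAC subrr.
  move/eqP: a_g; rewrite subr_eq0 => /eqP ag.
  move/eqP: a_f; rewrite subr_eq0 => /eqP af.
  move/eqP: e_f; rewrite subr_eq0 => /eqP ef.
  rewrite -af in ef; move: v1; rewrite ef -scalerDr -addrA => v1.
  have a0 : a != 0 by apply/eqP => a0; move/eqP: v0; apply; rewrite -v1 a0 scale0r.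
  rewrite vE; apply/lc1P; exists a^-1; rewrite -v1 scalerA mulVr ?scale1r //.
  exact: hR'.
have m0 : w0 + (lift y + lift z) != 0.
  apply/eqP => m0; have [|/eqP] := @lift_indep y z 1 1 1 Hy Hz y0 z0 nyz.
    by rewrite !scale1r -addrA.
  by rewrite oner_eq0.
apply: lift_uniq => //.
(* The direction [y + z] is the point at infinity of the line joining [x0] to x0 + y + z, and it
   also lies in the plane of [y] and [z]; comparing the two descriptions gives its image. *)
have [u u0 uE] := gr_line hR' (cG (line_gr hR yz0)).
have uu : c <[y + z]> u by rewrite uE; exact: mem_line.
have : (c <[y]> :+: c <[z]>) u.
  by apply: (adj1 hR hV cd.1 y0 z0 yz0) => //; apply: sums_intro; exact: mem_line.
rewrite (lift_line Hy y0) (lift_line Hz z0) => -[_ /lc1P[p ->] [_ /lc1P[q ->] u1]].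
have : (c <[x0 + (y + z)]> :+: c <[x0]>) u.
  apply: (adj1 hR hV cd.1 p0 x0N0 yz0) => //.
  exists (x0 + (y + z)); first exact: mem_line.
  exists (- x0); last by rewrite addrAC subrr add0r.
  by apply: subspaceN; [exact: subspace_lc|exact: mem_line].
rewrite (image_line p0 m0 main) (image_line x0N0 w0N0 w0P).
move=> -[_ /lc1P[r ->] [_ /lc1P[s ->] u2]].
have [|_ r_p r_q] := @lift_indep y z (r + s) (r - p) (r - q) Hy Hz y0 z0 nyz.
  rewrite scalerDl !scalerBl -addrA (addrACA (r *: lift y)) -opprD u1 -scalerDr addrA.
  by rewrite -u2 (scalerDr r w0) [X in _ - X]addrAC subrr.
move/eqP: r_p; rewrite subr_eq0 => /eqP rp.
move/eqP: r_q; rewrite subr_eq0 => /eqP rq.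
move: u1; rewrite -rp -rq -scalerDr => u1.
have r0 : r != 0 by apply/eqP => r0; move/eqP: u0; apply; rewrite -u1 r0 scale0r.
by rewrite uE; apply/lc1P; exists r^-1; rewrite -u1 scalerA mulVr ?scale1r //; exact: hR'.
Qed.

(** [H] has dimension [n - 1 >= 2]: two basis vectors cannot both be multiples of [y]. *)
Lemma ex_indep y : H y -> exists2 z, H z & ~ <[y]> z.
Proof.
move=> Hy; pose i1 : 'I_n := Ordinal (ltnW n3); pose i2 : 'I_n := Ordinal n3.
have H1 : H (b i1) by rewrite /H /= (co_b bb).
have H2 : H (b i2) by rewrite /H /= (co_b bb).
have [/lc1P[e eE]|] := pselect (<[y]> (b i1)); last by exists (b i1).
have [/lc1P[f fE]|] := pselect (<[y]> (b i2)); last by exists (b i2).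
have h1 : e * co b i1 y = 1 by rewrite -(coZ bb) -eE (co_b bb) eqxx.
have h3 : f * co b i1 y = 0 by rewrite -(coZ bb) -fE (co_b bb).
have f0 : f != 0.
  by apply/eqP => f0; apply: (basis_neq0 bb (i := i2)); rewrite fE f0 scale0r.
have y0 : co b i1 y = 0 by apply: (mulrI (hR f0)); rewrite h3 mulr0.
by move/eqP: h1; rewrite y0 mulr0 eq_sym oner_eq0.
Qed.

Let nline_sym (y z : V) : y != 0 -> z != 0 -> ~ <[y]> z -> ~ <[z]> y.
Proof. by move=> y0 z0 nyz /(line_eq hR y0) e; apply: nyz; rewrite -e; exact: mem_line. Qed.

Lemma lift_add_off v u : H v -> H u -> ~ <[u]> v -> lift (v + u) = lift v + lift u.
Proof.
move=> Hv Hu nuv; have v0 : v != 0.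
  by apply/eqP => v0; apply: nuv; rewrite v0; apply: subspace0; exact: subspace_lc.
have [->|u0] := eqVneq u 0; first by rewrite lift0 !addr0.
by apply: lift_add_indep => //; exact: nline_sym.
Qed.

(** For [z] on the line of [y], choose [v] off that line and evaluate [lift] on v + (y + z) and on
    (v + y) + z, where only independent vectors are added. *)
Lemma liftD y z : H y -> H z -> lift (y + z) = lift y + lift z.
Proof.
move=> Hy Hz; have sy := subspace_lc [:: y].
have [y0|y0] := eqVneq y 0; first by rewrite y0 lift0 !add0r.
have [z0|z0] := eqVneq z 0; first by rewrite z0 lift0 !addr0.
have [yz|nyz] := pselect (<[y]> z); last first.
  by apply: lift_add_off => //; exact: nline_sym.
have [v Hv nyv] := ex_indep Hy.
have zE : <[y]> = <[z]> by exact: line_eq.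
have nz : ~ <[z]> (v + y).
  rewrite -zE => h; apply: nyv; rewrite -(addrK y v); apply: subspaceB => //.
  exact: mem_line.
have yzy : <[y]> (y + z) by apply: subspaceD => //; exact: mem_line.
have nyzv : ~ <[y + z]> v.
  by move=> h; apply: nyv; exact: (line_sub sy yzy).
apply: (addrI (lift v)); rewrite -(lift_add_off Hv (subspaceD sH Hy Hz) nyzv).
rewrite [v + _]addrA (lift_add_off (subspaceD sH Hv Hy) Hz nz).
by rewrite (lift_add_off Hv Hy nyv) addrA.
Qed.

Lemma liftZ_ex y a : H y -> y != 0 -> exists s, lift (a *: y) = s *: lift y.
Proof.
move=> Hy y0; have [->|a0] := eqVneq a 0.
  by exists 0; rewrite !scale0r lift0.
have Hay : H (a *: y) by exact: (subspaceZ _ sH Hy).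
have ay0 : a *: y != 0.
  by apply/eqP => ay; move/eqP: a0; apply; exact: (scaler_eq0_div hR ay y0).
apply/lc1P; rewrite -lift_line //.
have -> : <[y]> = <[a *: y]>.
  by apply: line_eq => //; apply/lc1P; exists a.
exact: (liftP Hay ay0).1.
Qed.

(** Additivity on [y + z] makes the factors of [y], [z] and [y + z] agree, so the scalar does not
    depend on the direction. *)
Lemma liftZ_indep y z a s : H y -> H z -> y != 0 -> z != 0 -> ~ <[y]> z ->
  lift (a *: y) = s *: lift y -> lift (a *: z) = s *: lift z.
Proof.
move=> Hy Hz y0 z0 nyz yE; have Hyz := subspaceD sH Hy Hz.
have yz0 : y + z != 0.
  apply/eqP => /eqP; rewrite addrC addr_eq0 => /eqP zE; apply: nyz; rewrite zE.
  by apply: subspaceN; [exact: subspace_lc|exact: mem_line].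
have [t zE] := liftZ_ex a Hz z0; have [r yzE] := liftZ_ex a Hyz yz0.
move: yzE; rewrite scalerDr !liftD //; try exact: (subspaceZ _ sH).
rewrite zE yE scalerDr => /eqP; rewrite -subr_eq0 opprD addrACA -!scalerBl => /eqP e.
have [|_ /eqP sr /eqP tr] := @lift_indep y z 0 (s - r) (t - r) Hy Hz y0 z0 nyz.
  by rewrite scale0r add0r.
by rewrite subr_eq0 in sr; rewrite subr_eq0 in tr; rewrite (eqP tr) (eqP sr).
Qed.

Lemma lift_scalar : exists s : R -> R', forall y a, H y -> lift (a *: y) = s a *: lift y.
Proof.
pose i1 : 'I_n := Ordinal (ltnW n3); have H1 : H (b i1) by rewrite /H /= (co_b bb).
have b10 : b i1 != 0 by exact/eqP/(basis_neq0 bb).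
have [s sE] := choice (fun a => liftZ_ex a H1 b10).
exists s => y a Hy; have [->|y0] := eqVneq y 0.
  by rewrite scaler0 lift0 scaler0.
have [v Hv nv] := ex_indep H1.
have v0 : v != 0.
  by apply/eqP => v0; apply: nv; rewrite v0; apply: subspace0; exact: subspace_lc.
(* A vector on the line of [b i1] is reached in two steps, through [v] off that line. *)
have [h|h] := pselect (<[b i1]> y); last exact: liftZ_indep (sE a).
apply: (@liftZ_indep v y) => //; last exact: liftZ_indep (sE a).
by rewrite (line_eq hR y0 h) in nv; exact: nline_sym.
Qed.

Theorem fundamental_theorem : exists (sigma : {rmorphism R -> R'})
    (l : {linear V -> W | sigma \; *:%R}),
  [/\ bijective sigma, bijective l & forall x, x != 0 -> c <[x]> = <[l x]>].
Proof.
have [s sE] := lift_scalar.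
pose i1 : 'I_n := Ordinal (ltnW n3); have H1 : H (b i1) by rewrite /H /= (co_b bb).
have b10 : b i1 != 0 by exact/eqP/(basis_neq0 bb).
have lb0 := lift_neq0 H1 b10.
have sD a e : s (a + e) = s a + s e.
  apply: (scaler_inj hR' lb0); rewrite scalerDl -!sE // scalerDl liftD //; exact: (subspaceZ _ sH).
have s0 : s 0 = 0.
  by apply: (scaler_inj hR' lb0); rewrite -sE // !scale0r lift0.
have sN a : s (- a) = - s a.
  by apply/eqP; rewrite -addr_eq0 -sD addNr s0.
have sB a e : s (a - e) = s a - s e by rewrite sD sN.
have s1 : s 1 = 1.
  by apply: (scaler_inj hR' lb0); rewrite -sE // !scale1r.
have sM a e : s (a * e) = s a * s e.
  apply: (scaler_inj hR' lb0); rewrite -(sE _ _ H1) -(scalerA a e).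
  by rewrite (sE _ a (subspaceZ e sH H1)) sE // scalerA.
have s_neq0 a : a != 0 -> s a != 0.
  move=> a0; apply/eqP => sa0; have := s1; rewrite -(mulVr (hR a0)) sM sa0 mulr0.
  by move/eqP; rewrite eq_sym oner_eq0.
(* [h] projects to [H] along [x0], and [l] extends [lift] by sending [x0] to [w0]. *)
pose h x := x - co b i0 x *: x0.
have Hh x : H (h x) by rewrite /H /h /= (coB bb) (coZ bb) cox0 mulr1 subrr.
pose l x := s (co b i0 x) *: w0 + lift (h x).
have l_lin a x y : l (a *: x + y) = s a *: l x + l y.
  rewrite /l (coD bb) (coZ bb) sD sM scalerDl scalerDr scalerA addrACA.
  congr (_ + _); rewrite -sE // -liftD //; last exact: (subspaceZ _ sH).
  congr lift; rewrite /h (coD bb) (coZ bb) scalerBr scalerDl scalerA.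
  by rewrite opprD addrACA.
have l0 x : x != 0 -> l x != 0 /\ c <[x]> (l x).
  move=> xN0; rewrite /l; have [a0|a0] := eqVneq (co b i0 x) 0.
    have hx : h x = x by rewrite /h a0 scale0r subr0.
    have Hx : H x by [].
    rewrite a0 s0 scale0r add0r hx; split; first exact: lift_neq0.
    exact: (liftP Hx xN0).1.
  set a := co b i0 x in a0 *; have a_s := s_neq0 a a0.
  have Hy : H (a^-1 *: h x) by exact: (subspaceZ _ sH).
  have -> : s a *: w0 + lift (h x) = s a *: (w0 + lift (a^-1 *: h x)).
    rewrite scalerDr -sE // scalerA mulrV ?scale1r //; exact: hR.
  have B0 := lift_base Hy.
  have xE : <[x]> = <[x0 + a^-1 *: h x]>.
    apply/esym/line_eq => //; apply/lc1P; exists a.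
    rewrite scalerDr scalerA mulrV ?scale1r; last exact: hR.
    by rewrite /h addrC subrK.
  split.
    by apply/eqP => e; move/eqP: a_s; apply; exact: (scaler_eq0_div hR' e B0).
  by rewrite xE lift_line_add //; apply/lc1P; exists (s a).
pose sigma := mk_rmorphism sB sM s1.
pose L : {linear V -> W | sigma \; *:%R} := mk_semilinear sB sM s1 l_lin.
have Lline x : x != 0 -> c <[x]> = <[L x]>.
  by move=> xN0; have [lx cx] := l0 x xN0; exact: image_line.
have L_inj0 x : L x = 0 -> x = 0.
  by move=> e; apply/eqP/negPn/negP => xN0; have [/eqP] := l0 x xN0.
(* Pull back the line of [lift (b i1) + r *: lift v]: it is spanned by some [e *: b i1 + f *: v]
   with [e] nonzero, and [s] takes [e^-1 * f] to [r]. *)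
have s_surj (r : R') : exists a, s a = r.
  have [v Hv nv] := ex_indep H1.
  have v0 : v != 0.
    by apply/eqP => v0; apply: nv; rewrite v0; apply: subspace0; exact: subspace_lc.
  have lHE y : H y -> l y = lift y.
    by move=> Hy; rewrite /l /h [co b i0 y](_ : _ = 0) // s0 !scale0r add0r subr0.
  pose w := lift (b i1) + r *: lift v.
  have w_neq0 : w != 0.
    apply/eqP => e; have [|_ /eqP] := @lift_indep (b i1) v 0 1 r H1 Hv b10 v0 nv.
      by rewrite scale0r add0r scale1r.
    by rewrite oner_eq0.
  have [z zN0 zE] := gr_line hR (dG (line_gr hR' w_neq0)).
  have czw : c <[z]> = <[w]> by rewrite -zE dK //; exact: line_gr.
  have : (<[b i1]> :+: <[v]>) z.
    apply: (image_reflect b10 v0 zN0 w_neq0); first by rewrite czw; exact: mem_line.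
    rewrite !lift_line //; apply: sums_intro; first exact: mem_line.
    by apply/lc1P; exists r.
  case=> _ /lc1P[e ->] [_ /lc1P[f ->] efz].
  have := mem_line (L z); rewrite -Lline // czw => /lc1P[g Lz].
  move: Lz; rewrite -efz -[L _]/(l _) l_lin -[f *: v]addr0 l_lin.
  have -> : l 0 = 0 by rewrite lHE ?lift0 //; exact: subspace0.
  rewrite addr0 !lHE // /w scalerDr scalerA => /eqP.
  rewrite -subr_eq0 opprD addrACA -!scalerBl => /eqP E.
  have [|_ /eqP eg /eqP fg] := @lift_indep (b i1) v 0 (s e - g) (s f - g * r) H1 Hv b10 v0 nv.
    by rewrite scale0r add0r.
  rewrite subr_eq0 in eg; rewrite subr_eq0 in fg.
  have e0 : e != 0.
    apply/eqP => e0; have g0 : g = 0 by rewrite -(eqP eg) e0 s0.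
    move/eqP: zN0; apply; apply: L_inj0; rewrite -efz -[L _]/(l _) l_lin.
    rewrite -[f *: v]addr0 l_lin (eqP fg) (eqP eg) g0 mul0r !scale0r !add0r.
    by rewrite lHE ?lift0 //; exact: subspace0.
  exists (e^-1 * f); rewrite sM (eqP fg) -(eqP eg) mulrA -sM mulVr ?s1 ?mul1r //.
  exact: hR.
have s_inj : injective s.
  move=> a e /eqP; rewrite -subr_eq0 -sB => ae; apply/eqP; rewrite -subr_eq0.
  by apply: contraT => /s_neq0; rewrite ae.
have L_inj : injective L.
  move=> x y /eqP; rewrite -subr_eq0 -linearB => /eqP /L_inj0 /eqP.
  by rewrite subr_eq0 => /eqP.
have L_surj w : exists x, L x = w.
  have [->|w_neq0] := eqVneq w 0; first by exists 0; exact: linear0.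
  have [z zN0 zE] := gr_line hR (dG (line_gr hR' w_neq0)).
  have czw : c <[z]> = <[w]> by rewrite -zE dK //; exact: line_gr.
  have := mem_line w; rewrite -czw Lline // => /lc1P[r wE].
  have [a aE] := s_surj r; exists (a *: z).
  by rewrite wE -aE -[a *: z]addr0 -[L _]/(l _) l_lin -[l 0]/(L 0) linear0 addr0.
exists sigma, L; split=> //.
  have [si siE] := choice s_surj.
  by exists si => // a; apply: s_inj; rewrite siE.
have [Li LiE] := choice L_surj.
by exists Li => // x; apply: L_inj; rewrite LiE.
Qed.

End FundamentalTheorem.
(** * Semilinear maps inducing a pair of subspace maps *)

Section Induced.
Variables (R R' : unitRingType) (hR : division_ring R) (hR' : division_ring R').
Variables (V : lmodType R) (W : lmodType R') (n k : nat).
Hypotheses (hV : has_dim n [set: V]) (hW : has_dim n [set: W]).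
Hypotheses (n3 : (2 < n)%N) (k0 : (0 < k)%N) (k2n : (2 * k < n)%N).

(** Preservation of base subsets frame by frame, in a form that makes sense between different
    spaces, in particular from [V] to its dual. *)
Definition frame_map (R1 R2 : unitRingType) (V1 : lmodType R1) (V2 : lmodType R2)
    (F : set V1 * set V1 -> set V2 * set V2) : Prop :=
  forall b : 'I_n -> V1, is_basis setT b ->
    exists2 e : 'I_n -> V2, is_basis setT e & forall A : {set 'I_n}, #|A| = k ->
      exists2 B : {set 'I_n}, #|B| = k & F (pt b A) = pt e B.

Lemma frame_map_pairs (R1 R2 : unitRingType) (V1 : lmodType R1) (V2 : lmodType R2)
    (F : set V1 * set V1 -> set V2 * set V2) p :
  division_ring R1 -> division_ring R2 ->
  has_dim n [set: V1] -> has_dim n [set: V2] -> frame_map F ->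
  compl_pairs n k p -> compl_pairs n k (F p).
Proof.
move=> hR1 hR2 hV1 hV2 FF pk.
have [_ [[b bb ->] /(base_subset_ofP hR1 hV1 bb)[A Ak ->] _]] := cb_refl hR1 hV1 pk.
by have [e ee /(_ _ Ak)[B Bk ->]] := FF b bb; exact: pt_compl_pairs.
Qed.

Variables (F : set V * set V -> set W * set W) (G : set W * set W -> set V * set V).
Hypotheses (FF : frame_map F) (GF : frame_map G).
Hypotheses (dF : direct n k F) (dG : direct n k G).
Hypotheses (FK : forall p, compl_pairs n k p -> G (F p) = p).
Hypotheses (GK : forall q, compl_pairs n k q -> F (G q) = q).

Lemma lift_pairmap (R1 R2 : unitRingType) (V1 : lmodType R1) (V2 : lmodType R2)
    (F1 : set V1 * set V1 -> set V2 * set V2) G1 g h g' h' :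
  division_ring R1 -> division_ring R2 ->
  has_dim n [set: V1] -> has_dim n [set: V2] -> frame_map F1 ->
  (forall p, compl_pairs n k p -> G1 (F1 p) = p) ->
  (forall S U, compl_pairs n k (S, U) -> F1 (S, U) = (g S, h U)) ->
  (forall S U, compl_pairs n k (S, U) -> G1 (S, U) = (g' S, h' U)) ->
  pairmap n k g h g' h'.
Proof.
move=> hR1 hR2 hV1 hV2 FF1 FK1 Fgh Ggh.
have P S U : compl_pairs n k (S, U) -> compl_pairs n k (g S, h U).
  by move=> SU; rewrite -Fgh //; exact: frame_map_pairs.
have K S U : compl_pairs n k (S, U) -> (g' (g S), h' (h U)) = (S, U).
  by move=> SU; rewrite -(Ggh _ _ (P _ _ SU)) -(Fgh _ _ SU) FK1.
split=> // S Sk.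
  by have [U /K[]] := gr_compl hR1 hV1 Sk.
have [U] := gr_compl hR1 hV1 Sk; rewrite -[S in (S, U)]/((U, S).2) => SU.
have := compl_pairs_swap hR1 hV1 SU; rewrite /swap /= subKn => [/K[]//|]; lia.
Qed.

(** Incidence with points identifies [g] with the action of [l]. For [h] complementarity is used: a
    vector outside [U] lies in a [k]-dimensional complement of [U], whose image is a complement of
    [h U]. *)
Theorem induced_by_semilinear : exists (sigma : {rmorphism R -> R'})
    (l : {linear V -> W | sigma \; *:%R}),
  [/\ bijective sigma, bijective l & forall S U, compl_pairs n k (S, U) ->
    F (S, U) = (l @` S, l @` U)].
Proof.
have [g [h Fgh]] := direct_lift dF; have [g' [h' Ggh]] := direct_lift dG.
have gh := lift_pairmap hR hR' hV hW FF FK Fgh Ggh.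
have gh' := lift_pairmap hR' hR hW hV GF GK Ggh Fgh.
have kE : k.-1.+1 = k by rewrite prednK.
have frame_g (R1 R2 : unitRingType) (V1 : lmodType R1) (V2 : lmodType R2)
    (F1 : set V1 * set V1 -> set V2 * set V2) g1 h1 :
    division_ring R1 -> has_dim n [set: V1] -> frame_map F1 ->
    (forall S U, compl_pairs n k (S, U) -> F1 (S, U) = (g1 S, h1 U)) ->
    forall b : 'I_n -> V1, is_basis setT b ->
    exists2 e : 'I_n -> V2, is_basis setT e &
    forall A : {set 'I_n}, #|A| = k.-1.+1 ->
      exists2 B : {set 'I_n}, #|B| = k.-1.+1 & g1 (sp b A) = sp e B.
  move=> hR1 hV1 FF1 Fgh1 b bb; have [e ee eP] := FF1 b bb; exists e => // A.
  rewrite kE => Ak; have [B Bk BE] := eP A Ak; exists B => //.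
  by have := Fgh1 _ _ (pt_compl_pairs hR1 hV1 bb Ak); rewrite BE => -[].
have ch : chain k.-1.+1 g g'.
  split.
    apply: (pairmap_half hR hR' hV hW (h := h) (h' := h')); rewrite ?kE //.
    by have := frame_g _ _ _ _ F g h hR hV FF Fgh; rewrite kE.
  apply: (pairmap_half hR' hR hW hV (h := h') (h' := h)); rewrite ?kE //.
  by have := frame_g _ _ _ _ G g' h' hR' hW GF Ggh; rewrite kE.
have [|c [d [cd cg dg]]] := chain_points hR hR' hV hW _ ch; first by lia.
rewrite kE in cg dg.
have [b bb] := hV.
have b0 : b (Ordinal (ltnW (ltnW n3))) != 0 by exact/eqP/(basis_neq0 bb).
have [w w0 wE] : exists2 w, w != 0 & c (lc [:: b (Ordinal (ltnW (ltnW n3)))]) = lc [:: w].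
  by apply: gr_line => //; case: cd => -[h1 _ _ _ _] _; apply: h1; exact: line_gr.
have wP : c (lc [:: b (Ordinal (ltnW (ltnW n3)))]) w by rewrite wE; exact: mem_line.
have [sigma [l [sb lb lE]]] := fundamental_theorem hR hR' hV hW cd bb w0 wP.
exists sigma, l; split=> // S U SU.
have [li liK lK] := lb.
(* Lines of [T] go into [g T] by incidence for [c]; the reverse inclusion is incidence for the
   inverse map [d]. *)
have gE T : grassmannian k T -> g T = l @` T.
  move=> Tk; have sT := gr_sub Tk; have sgT := gr_sub (pairmap_gr hR hV gh Tk).
  apply/seteqP; split=> [y gy|_ [x Tx <-]]; last first.
    have [->|x0] := eqVneq x 0; first by rewrite linear0; exact: subspace0.
    have : c (lc [:: x]) `<=` g T by apply: cg => //; [exact: line_gr|exact: line_sub].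
    by apply; rewrite lE //; exact: mem_line.
  exists (li y) => //; have [y0|y0] := eqVneq (li y) 0.
    by rewrite y0; exact: subspace0.
  have ly := line_gr hR y0; have ck : grassmannian 1 (c (lc [:: li y])).
    by case: cd => -[h1 _ _ _ _] _; apply: h1.
  have : d (c (lc [:: li y])) `<=` g' (g T).
    apply: dg => //; first exact: (pairmap_gr hR hV gh).
    by rewrite lE // lK; exact: line_sub.
  have -> : d (c (lc [:: li y])) = lc [:: li y].
    by case: cd => -[_ h1 _ _ _] _; apply: h1.
  case: gh => _ -> // _; apply; exact: mem_line.
rewrite Fgh //; congr pair; first by apply: gE; case: SU.
have Uk : grassmannian (n - k) U by case: SU.
have hUk : grassmannian (n - k) (h U) by case: gh => /(_ _ _ SU)[].
have sU := gr_sub Uk; have shU := gr_sub hUk.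
have kle : (k < n)%N by lia.
apply/seteqP; split=> [y hy|_ [x Ux <-]].
  exists (li y) => //; apply: contrapT => nU.
  have [|T [Tk TU Ty]] := compl_through hR hV Uk _ nU; first by lia.
  have TU' := pairmap_compl hR hR' hV hW gh kle Tk TU.
  have y0 : y = 0.
    by apply: (compl_in0 TU') => //; rewrite gE //; exists (li y).
  apply: nU; rewrite y0 (_ : li 0 = 0); first exact: subspace0.
  by rewrite -[in LHS](linear0 l) liK.
apply: contrapT => nhU.
have [|T' [T'k TU Tx]] := compl_through hR' hW hUk _ nhU; first by lia.
have T'U := pairmap_compl hR' hR hW hV gh' kle T'k TU.
have Tk := pairmap_gr hR' hW gh' T'k.
case: (gh') => _ gg' _; case: (gh) => _ _ hh'.
rewrite hh' // in T'U.
have x0 : x = 0.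
  apply: (compl_in0 T'U) => //.
  have : g (g' T') (l x) by rewrite gg'.
  by rewrite gE // => -[z Tz /(can_inj liK) <-].
by apply: nhU; rewrite x0 linear0; exact: subspace0.
Qed.

End Induced.

(** * Duality *)

(** Fixing the unit ring structure of the opposite ring lets everything proved above for [V] be
    applied to its dual. *)
Definition opposite (R : unitRingType) : unitRingType := R^c.

Definition dual_module (R : unitRingType) (V : lmodType R) : lmodType (opposite R) :=
  dual V.

Section DualSpace.
Variables (R : unitRingType) (hR : division_ring R) (V : lmodType R) (n : nat).
Hypothesis hV : has_dim n [set: V].

Definition coannihilator (S : set V) : set (dual_module V) :=
  [set phi | forall x, S x -> (phi : {scalar V}) x = 0].

Lemma dual_sumE (I : finType) (F : I -> dual_module V) x :
  ((\sum_i F i : dual_module V) : {scalar V}) x = \sum_i (F i : {scalar V}) x.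
Proof.
by apply: (big_morph (fun phi : dual_module V => (phi : {scalar V}) x)).
Qed.

Definition dual_pair (b : 'I_n -> V) (e : 'I_n -> dual_module V) : Prop :=
  [/\ is_basis setT b, is_basis setT e &
    forall i j, (e i : {scalar V}) (b j) = (i == j)%:R].

Section DualPair.
Variables (b : 'I_n -> V) (e : 'I_n -> dual_module V).
Hypothesis be : dual_pair b e.
Let bb : is_basis setT b. Proof. by case: be. Qed.
Let ee : is_basis setT e. Proof. by case: be. Qed.

Lemma co_dual i (phi : dual_module V) : co e i phi = (phi : {scalar V}) (b i).
Proof.
case: be => _ _ d; rewrite [X in (X : {scalar V}) _](co_sum ee phi) dual_sumE.
rewrite (bigD1 i) //= d eqxx mul1r big1 ?addr0 // => j /negPf ji.
by rewrite d ji mul0r.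
Qed.

Lemma co_primal i x : co b i x = (e i : {scalar V}) x.
Proof.
case: be => _ _ d; rewrite {2}(co_sum bb x) linear_sum (bigD1 i) //=.
rewrite linearZ /= d eqxx mulr1 big1 ?addr0 // => j /negPf ji.
by rewrite linearZ /= d eq_sym ji mulr0.
Qed.

Lemma dual_eval (phi : dual_module V) x :
  (phi : {scalar V}) x = \sum_i co b i x * co e i phi.
Proof.
rewrite {1}(co_sum bb x) linear_sum; apply: eq_bigr => i _.
by rewrite linearZ /= co_dual.
Qed.

Lemma annihilator_sp (A : {set 'I_n}) : annihilator (sp e A) = sp b (~: A).
Proof.
apply/seteqP; split=> [x h i|x h phi ephi].
  by rewrite inE negbK => iA; rewrite co_primal; apply: h; apply/(sp_b ee).
rewrite dual_eval big1 // => i _; have [iA|iA] := boolP (i \in A).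
  by rewrite h ?mul0r // inE negbK.
by rewrite (ephi i iA) mulr0.
Qed.

Lemma coannihilator_sp (A : {set 'I_n}) : coannihilator (sp b A) = sp e (~: A).
Proof.
apply/seteqP; split=> [phi h i|phi h x bx].
  by rewrite inE negbK => iA; rewrite co_dual; apply: h; apply/(sp_b bb).
rewrite dual_eval big1 // => i _; have [iA|iA] := boolP (i \in A).
  by rewrite h ?mulr0 // inE negbK.
by rewrite (bx i iA) mul0r.
Qed.

End DualPair.

Lemma dual_basis b : is_basis setT b -> exists e, dual_pair b e.
Proof.
move=> bb; pose e i : dual_module V := mk_scalar (co_linear bb i).
have d i j : (e i : {scalar V}) (b j) = (i == j)%:R by exact: co_b.
exists e; split=> //; split.
  move=> a a0 j; have := congr1 (fun phi : dual_module V => (phi : {scalar V}) (b j)) a0.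
  rewrite dual_sumE (bigD1 j) //= co_b // eqxx mul1r big1 ?addr0 // => i /negPf ij.
  by rewrite co_b // ij mul0r.
rewrite span_range; apply/seteqP; split=> // phi _; apply/lc_enum.
exists (fun i => (phi : {scalar V}) (b i)); apply: scalar_ext => x.
rewrite dual_sumE /= {1}(co_sum bb x) linear_sum; apply: eq_bigr => i _.
by rewrite linearZ.
Qed.

Lemma dual_dim : has_dim n [set: dual_module V].
Proof. by have [b bb] := hV; have [e [_ ee _]] := dual_basis bb; exists e. Qed.

Lemma row_dim : has_dim n [set: 'rV[R]_n].
Proof.
exists (fun i => delta_mx 0 i); split.
  move=> a a0 j; have := congr1 (fun u : 'rV_n => u 0 j) a0.
  rewrite summxE (bigD1 j) //= !mxE !eqxx mulr1 big1 ?addr0 // => i ij.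
  by rewrite !mxE eq_sym (negPf ij) andbF mulr0.
rewrite span_range; apply/seteqP; split=> // u _; apply/lc_enum.
by exists (fun i => u 0 i); exact: row_sum_delta.
Qed.

(* The evaluation map x |-> (e_i(x))_i is injective because the forms span the
   dual, hence onto R^n by dimension. *)
Lemma primal_basis (e : 'I_n -> dual_module V) : is_basis setT e -> exists b, dual_pair b e.
Proof.
move=> ee; have [b0 bb0] := hV.
pose T x : 'rV[R]_n := \row_i (e i : {scalar V}) x.
have TS (I : finType) (a : I -> R) (y : I -> V) :
    T (\sum_i a i *: y i) = \sum_i a i *: T (y i).
  apply/rowP => j; rewrite mxE linear_sum summxE; apply: eq_bigr => i _.
  by rewrite linearZ !mxE.
(* The forms [e i] span the dual, so a vector killed by all of them is killed by every coordinate
   form of [b0]. *)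
have T0 x : T x = 0 -> x = 0.
  move=> Tx; have phi0 (phi : dual_module V) : (phi : {scalar V}) x = 0.
    rewrite [X in (X : {scalar V}) _](co_sum ee phi) dual_sumE big1 // => i _ /=.
    by move/rowP/(_ i): Tx; rewrite !mxE => ->; rewrite mul0r.
  apply: (co_ext bb0) => i; rewrite (co0 bb0).
  exact: (phi0 (mk_scalar (co_linear bb0 i))).
have Tb : lin_indep (T \o b0).
  by move=> a; rewrite -TS => /T0; exact: bb0.1.
have /(lin_indep_free hR) fT := Tb.
have Tspan : lc [seq (T \o b0) i | i <- enum 'I_n] = setT.
  by apply: (free_spanning hR row_dim) => //; rewrite size_map size_enum_ord.
have Tsurj u : exists x, T x = u.
  have : lc [seq (T \o b0) i | i <- enum 'I_n] u by rewrite Tspan.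
  by case/lc_enum=> a ->; exists (\sum_i a i *: b0 i); rewrite TS.
have [b bE] := choice (fun j : 'I_n => Tsurj (delta_mx 0 j)).
have d i j : (e i : {scalar V}) (b j) = (i == j)%:R.
  by have /rowP/(_ i) := bE j; rewrite !mxE eqxx.
exists b; split=> //.
have ib : lin_indep b.
  move=> a /(congr1 (fun x => (e _ : {scalar V}) x)) a0 i.
  have := a0 i; rewrite linear0 linear_sum (bigD1 i) //= linearZ /= d eqxx mulr1.
  rewrite big1 ?addr0 // => j /negPf ji.
  by rewrite linearZ /= d eq_sym ji mulr0.
split=> //; rewrite span_range.
apply: (free_spanning hR hV); first by rewrite size_map size_enum_ord.
exact/(lin_indep_free hR).
Qed.

End DualSpace.

(** * The case 2k < n *)

Section Core.
Variables (R : unitRingType) (hR : division_ring R) (V : lmodType R) (n k : nat).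
Hypotheses (hV : has_dim n [set: V]) (n3 : (2 < n)%N).
Hypotheses (k0 : (0 < k)%N) (k2n : (2 * k < n)%N).
Variables (f g : set V * set V -> set V * set V).
Hypotheses (fB : base_morphism n k f) (gB : base_morphism n k g).
Hypotheses (fK : forall p, compl_pairs n k p -> g (f p) = p).
Hypotheses (gK : forall p, compl_pairs n k p -> f (g p) = p).

Lemma base_morphism_frame (h : set V * set V -> set V * set V) :
  base_morphism n k h -> frame_map n k h.
Proof.
move=> [_ hB] b bb.
have [|e ee eE] := hB (base_subset_of n k (range b)); first by exists b.
exists e => // A Ak.
have : (h @` base_subset_of n k (range b)) (h (pt b A)).
  by exists (pt b A) => //; apply/(base_subset_ofP hR hV bb); exists A.
by rewrite eE => /(base_subset_ofP hR hV ee)[B Bk BE]; exists B.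
Qed.

(** The opposite ring has the same units, so [hR] serves unchanged. *)
Let hRc : division_ring (opposite R) := hR.
Let hVd : has_dim n [set: dual_module V] := dual_dim hV.

Definition induced : Prop :=
  (exists (sigma : {rmorphism R -> R}) (l : {linear V -> V | sigma \; *:%R}),
     [/\ bijective sigma, bijective l
       & forall S U : set V, compl_pairs n k (S, U) ->
           f (S, U) = (l @` S, l @` U)])
  \/
  (exists (sigma : {rmorphism R -> R^c})
          (s : {linear V -> dual V | sigma \; *:%R}),
     [/\ bijective sigma, bijective s
       & forall S U : set V, compl_pairs n k (S, U) ->
           f (S, U) = (annihilator (s @` U), annihilator (s @` S))]).

Lemma pairs_pt p : compl_pairs n k p -> exists (b : 'I_n -> V) (e : 'I_n -> dual_module V)
  (A : {set 'I_n}), [/\ dual_pair b e, #|A| = k & p = pt b A].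
Proof.
move=> pk; have [_ [[b bb ->] /(base_subset_ofP hR hV bb)[A Ak ->] _]] := cb_refl hR hV pk.
by have [e be] := dual_basis bb; exists b, e, A.
Qed.

Lemma dual_pairs_pt p : compl_pairs n k p -> exists (b : 'I_n -> V) (e : 'I_n -> dual_module V)
  (A : {set 'I_n}), [/\ dual_pair b e, #|A| = k & p = pt e A].
Proof.
move=> pk.
have [_ [[e ee ->] /(base_subset_ofP hRc hVd ee)[A Ak ->] _]] := cb_refl hRc hVd pk.
by have [b be] := primal_basis hR hV ee; exists b, e, A.
Qed.

(** The components are exchanged so that the first keeps dimension [k]; with dual frames [b] and
    [e], [pt b A] goes to [pt e A] with the same index set. *)
Definition dualize (p : set V * set V) : set (dual_module V) * set (dual_module V) :=
  (coannihilator p.2, coannihilator p.1).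
Definition undualize (q : set (dual_module V) * set (dual_module V)) : set V * set V :=
  (annihilator q.2, annihilator q.1).

Lemma dualize_pt b e (A : {set 'I_n}) : dual_pair b e -> dualize (pt b A) = pt e A.
Proof.
by move=> be; rewrite /dualize /= !(coannihilator_sp be) finset.setCK.
Qed.

Lemma undualize_pt b e (A : {set 'I_n}) : dual_pair b e -> undualize (pt e A) = pt b A.
Proof.
by move=> be; rewrite /undualize /= !(annihilator_sp be) finset.setCK.
Qed.

Lemma dualizeK p : compl_pairs n k p -> undualize (dualize p) = p.
Proof.
by case/pairs_pt=> b [e [A [be _ ->]]]; rewrite (dualize_pt _ be) (undualize_pt _ be).
Qed.

Lemma undualizeK q : compl_pairs n k q -> dualize (undualize q) = q.
Proof.
by case/dual_pairs_pt=> b [e [A [be _ ->]]]; rewrite (undualize_pt _ be) (dualize_pt _ be).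
Qed.

Lemma undualize_pairs q : compl_pairs n k q -> compl_pairs n k (undualize q).
Proof.
case/dual_pairs_pt=> b [e [A [be Ak ->]]]; rewrite (undualize_pt _ be).
by apply: (pt_compl_pairs hR hV) => //; case: be.
Qed.

(** Since [dualize] exchanges the components, a twisted map becomes direct after it; the semilinear
    map into the dual is then read back through annihilators. *)
Lemma core : induced.
Proof.
have kn : (0 < k < n)%N by lia.
have n2k : n <> (2 * k)%N by lia.
have [[df dg]|[tf tg]] := direct_or_twisted hR hV kn n2k n3 fB gB fK gK.
  left; apply: (induced_by_semilinear hR hR hV hV n3 k0 k2n _ _ df dg fK gK);
    exact: base_morphism_frame.
right.
pose F p := dualize (f p); pose G q := g (undualize q).
have ff := base_morphism_frame fB; have gf := base_morphism_frame gB.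
have FF : frame_map n k F.
  move=> b bb; have [b' bb' b'P] := ff b bb; have [e be] := dual_basis bb'.
  exists e; first by case: be.
  move=> A Ak; have [B Bk BE] := b'P A Ak; exists B => //.
  by rewrite /F BE (dualize_pt _ be).
have GF : frame_map n k G.
  move=> e ee; have [b be] := primal_basis hR hV ee.
  have bb : is_basis setT b by case: be.
  have [b' bb' b'P] := gf b bb; exists b' => // A Ak.
  by rewrite /G (undualize_pt _ be); exact: b'P.
have dF : direct n k F.
  move=> p q pk qk; have [t1 t2] := tf p q pk qk.
  by split=> /= [/t1->|/t2->].
have dG : direct n k G.
  move=> p q pk qk; have [t1 t2] := tg _ _ (undualize_pairs pk) (undualize_pairs qk).
  by split=> e; [apply: t2|apply: t1]; rewrite /= e.
have FK p : compl_pairs n k p -> G (F p) = p.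
  by move=> pk; rewrite /G /F dualizeK ?fK //; exact: fB.1.
have GK q : compl_pairs n k q -> F (G q) = q.
  move=> qk; rewrite /G /F gK; first exact: undualizeK.
  exact: undualize_pairs.
have [sigma [s [sb lb sE]]] :=
  induced_by_semilinear hR hRc hV hVd n3 k0 k2n FF GF dF dG FK GK.
exists sigma, s; split=> // S U SU.
by rewrite -[LHS]dualizeK ?[dualize _]sE //; exact: fB.1.
Qed.

End Core.

Theorem theorem1 (R : unitRingType) (hR : division_ring R)
    (V : lmodType R) (n k : nat) (hV : has_dim n [set: V])
    (hn : (3 <= n)%N) (hk : (1 <= k <= n - 1)%N) (hnk : n <> (2 * k)%N)
    (f : set V * set V -> set V * set V)
    (f_bij : set_bij (compl_pairs n k) (compl_pairs n k) f)
    (f_base : preserves_base_subsets n k f) :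
  (exists (sigma : {rmorphism R -> R})
          (l : {linear V -> V | sigma \; *:%R}),
     [/\ bijective sigma, bijective l
       & forall S U : set V, compl_pairs n k (S, U) ->
           f (S, U) = (l @` S, l @` U)])
  \/
  (exists (sigma : {rmorphism R -> R^c})
          (s : {linear V -> dual V | sigma \; *:%R}),
     [/\ bijective sigma, bijective s
       & forall S U : set V, compl_pairs n k (S, U) ->
           f (S, U) = (annihilator (s @` U), annihilator (s @` S))]).
Proof.
have [f_fun f_inj f_surj] := f_bij.
have Hg p : exists q, compl_pairs n k p -> compl_pairs n k q /\ f q = p.
  have [pk|npk] := pselect (compl_pairs n k p); last by exists p => /npk.
  by have [q qk qp] := f_surj p pk; exists q.
have [g gP] := choice Hg.
have fG p : compl_pairs n k p -> compl_pairs n k (f p) by exact: f_fun.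
have gG p : compl_pairs n k p -> compl_pairs n k (g p) by move=> /gP[].
have gK p : compl_pairs n k p -> f (g p) = p by move=> /gP[].
have fK p : compl_pairs n k p -> g (f p) = p.
  by move=> pk; apply: f_inj; rewrite ?inE ?gK //; [exact/gG/fG|exact: fG].
have fB : base_morphism n k f by split=> //; case: f_base.
have gB : base_morphism n k g.
  split=> // X bX; have [_ /(_ X bX)] := f_base.
  rewrite (_ : compl_pairs n k `&` _ = g @` X) //.
  apply/seteqP; split=> [p [pk Xp]|_ [p Xp <-]]; first by exists (f p); rewrite ?fK.
  have pk := base_subset_pairs bX Xp.
  by split; [exact: gG|rewrite /= gK].
have kle : (k <= n)%N by lia.
have [k2n|k2n] := ltnP (2 * k) n.
  have k0 : (0 < k)%N by lia.
  exact: (core hR hV hn k0 k2n fB gB fK gK).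
(* Here [n < 2 * k]. Conjugating [f] by [swap] turns [k] into [n - k], and both forms of the
   conclusion are symmetric in the two components. *)
have unswap (p : set V * set V) : compl_pairs n (n - k) p -> compl_pairs n k (swap p).
  by rewrite -{2}[k](subKn kle); exact: (compl_pairs_swap hR hV).
have swB (h : set V * set V -> set V * set V) : base_morphism n k h ->
    base_morphism n (n - k) (@swap R V \o h \o @swap R V).
  move=> [hG hB]; split=> [p pk|X bX].
    by apply: (compl_pairs_swap hR hV); apply: hG; exact: unswap.
  rewrite (_ : _ @` X = @swap R V @` (h @` (@swap R V @` X))).
    apply: (base_subset_swap hR hV) => //; apply: hB.
    by rewrite -[k](subKn kle); apply: (base_subset_swap hR hV) => //; exact: leq_subr.
  by rewrite !image_comp.
have swK (h1 h2 : set V * set V -> set V * set V) :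
    (forall p, compl_pairs n k p -> h2 (h1 p) = p) ->
    forall p, compl_pairs n (n - k) p ->
      (@swap R V \o h2 \o @swap R V) ((@swap R V \o h1 \o @swap R V) p) = p.
  by move=> hK p pk /=; rewrite swapK hK ?swapK //; exact: unswap.
have k0' : (0 < n - k)%N by lia.
have k2n' : (2 * (n - k) < n)%N by lia.
have sw (S U : set V) : compl_pairs n k (S, U) -> compl_pairs n (n - k) (U, S).
  by move=> SU; exact: (compl_pairs_swap hR hV SU).
have fE (S U : set V) : f (S, U) = swap ((@swap R V \o f \o @swap R V) (U, S)) by rewrite /= swapK.
have [[sigma [l [sb lb lE]]]|[sigma [s [sb lb sE]]]] :=
  core hR hV hn k0' k2n' (swB _ fB) (swB _ gB) (swK _ _ fK) (swK _ _ gK).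
  by left; exists sigma, l; split=> // S U SU; rewrite fE lE //; exact: sw.
by right; exists sigma, s; split=> // S U SU; rewrite fE sE //; exact: sw.
Qed.
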